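(* A closed, orientable 3-manifold with $\mathrm{Sol}$ geometry is $SU(2)$-abelian if and only if it is the mapping torus of a diffeomorphism $\phi:T^2\to T^2$, represented by a matrix $\phi\in SL(2,\mathbb{Z})$ which is conjugate in $GL(2,\mathbb{Z})$ to one of \[ \begin{pmatrix} -3 & -1 \\ 1 & 0 \end{pmatrix},\quad \begin{pmatrix} -3 & 1 \\ 2 & -1 \end{pmatrix},\quad\text{or}\quad \begin{pmatrix} -3 & 4 \\ 2 & -3 \end{pmatrix}. \] Since the mapping torus depends (up to homeomorphism) only on the conjugacy class, there are thus three such $SU(2)$-abelian manifolds.
   Context: A 3-manifold $Y$ is $SU(2)$-abelian if every representation $\rho:\pi_1(Y)\to SU(2)$ has abelian image. $\mathrm{Sol}$ is one of Thurston's eight 3-dimensional model geometries. A diffeomorphism of $T^2$ is identified, up to isotopy, with the matrix of its action on $\pi_1(T^2)\cong\mathbb{Z}^2$ with respect to a basis. *)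

(* Defs.v *)
From HB Require Import structures.
From Stdlib Require Import Relations.Relation_Operators.
From mathcomp Require Import all_boot all_order all_algebra generic_quotient.
From mathcomp Require Import spectral complex.
From mathcomp Require Import all_classical all_reals all_analysis.

Set Implicit Arguments.
Unset Strict Implicit.
Unset Printing Implicit Defensive.

Import Order.TTheory GRing.Theory Num.Theory.
Import numFieldNormedType.Exports.

Local Open Scope classical_set_scope.
Local Open Scope quotient_scope.
Local Open Scope ring_scope.

Definition homeomorphic (T U : topologicalType) : Prop :=
  exists (f : T -> U) (g : U -> T),
    [/\ continuous f, continuous g, cancel f g & cancel g f].

Section QuotientSpace.
Variables (T : topologicalType) (r : T -> T -> Prop).

Definition generated_rel : rel T :=
  fun x y => `[< clos_refl_sym_trans T r x y >].

Fact generated_rel_refl : reflexive generated_rel.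
Proof. by move=> x; apply/asboolP; exact: rst_refl. Qed.

Fact generated_rel_sym : symmetric generated_rel.
Proof.
by move=> x y; apply/idP/idP => /asboolP h; apply/asboolP; exact: rst_sym.
Qed.

Fact generated_rel_trans : transitive generated_rel.
Proof.
move=> y x z /asboolP hxy /asboolP hyz.
by apply/asboolP; exact: rst_trans hxy hyz.
Qed.

Canonical generated_equiv :=
  EquivRel generated_rel
    generated_rel_refl generated_rel_sym generated_rel_trans.

Definition quotient_space : topologicalType :=
  quotient_topology {eq_quot generated_equiv}.

Definition quotient_proj (x : T) : quotient_space :=
  \pi_({eq_quot generated_equiv})%qT x.

End QuotientSpace.

Section FundamentalGroup.
Variables (R : realType) (T : topologicalType).

(** Paths are maps on [R] of which only the restriction to [0, 1] matters. *)
Local Notation I := (`[0, 1]%classic : set R).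
Local Notation II := (I `*` I : set (R * R)).

Definition is_loop (y : T) (c : R -> T) : Prop :=
  [/\ {within I, continuous c}, c 0 = y & c 1 = y].

Definition loop_homotopic (y : T) (c d : R -> T) : Prop :=
  exists H : R * R -> T,
    [/\ {within II, continuous H},
        (forall t, I t -> H (0, t) = c t),
        (forall t, I t -> H (1, t) = d t) &
        (forall s, I s -> H (s, 0) = y /\ H (s, 1) = y)].

Definition freely_homotopic (c d : R -> T) : Prop :=
  exists H : R * R -> T,
    [/\ {within II, continuous H},
        (forall t, I t -> H (0, t) = c t),
        (forall t, I t -> H (1, t) = d t) &
        (forall s, I s -> H (s, 0) = H (s, 1))].

Definition loop_concat (c d : R -> T) : R -> T :=
  fun t => if t <= 2^-1 then c (2 * t) else d (2 * t - 1).

Definition in_SU2 (M : 'M[R[i]]_2) : Prop := M \is unitarymx /\ \det M = 1.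

(** A homomorphism from [pi_1(T, y)] to [SU(2)] is given as a map on the loops
    at [y] that is constant on homotopy classes. *)
Definition SU2_representation (y : T) (rho : (R -> T) -> 'M[R[i]]_2) : Prop :=
  [/\ (forall c, is_loop y c -> in_SU2 (rho c)),
      (forall c d, is_loop y c -> is_loop y d ->
         loop_homotopic y c d -> rho c = rho d) &
      (forall c d, is_loop y c -> is_loop y d ->
         rho (loop_concat c d) = rho c *m rho d)].

Definition SU2_abelian : Prop :=
  forall (y : T) (rho : (R -> T) -> 'M[R[i]]_2), SU2_representation y rho ->
  forall c d, is_loop y c -> is_loop y d -> rho c *m rho d = rho d *m rho c.

End FundamentalGroup.

Section SmoothMaps.
Variable R : realType.

(** The set [U] is meant to be open. *)
Fixpoint Ck_on (n m k : nat) (U : set 'rV[R]_n)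
    (f : 'rV[R]_n -> 'rV[R]_m) : Prop :=
  match k with
  | 0 => forall x, U x -> {for x, continuous f}
  | k'.+1 => (forall x, U x -> differentiable f x) /\
             (forall v, Ck_on k' U (fun x => 'D_v f x))
  end.

Definition smooth_on (n m : nat) (U : set 'rV[R]_n)
    (f : 'rV[R]_n -> 'rV[R]_m) : Prop :=
  forall k, Ck_on k U f.

End SmoothMaps.

(** The maps [chart_fun] and [chart_inv] are total and
    only meaningful on [chart_dom] and [chart_cod]. *)
Record chart (R : realType) (n : nat) (T : topologicalType) := Chart {
  chart_dom : set T;
  chart_cod : set 'rV[R]_n;
  chart_fun : T -> 'rV[R]_n;
  chart_inv : 'rV[R]_n -> T
}.

Section Manifolds.
Variables (R : realType) (n : nat).
Implicit Types T U : topologicalType.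

Definition is_chart T (c : chart R n T) : Prop :=
  [/\ open (chart_dom c) /\ open (chart_cod c),
      (forall x, chart_dom c x ->
         chart_cod c (chart_fun c x) /\ chart_inv c (chart_fun c x) = x),
      (forall v, chart_cod c v ->
         chart_dom c (chart_inv c v) /\ chart_fun c (chart_inv c v) = v),
      {within chart_dom c, continuous (chart_fun c)} &
      {within chart_cod c, continuous (chart_inv c)}].

Definition overlap T (c d : chart R n T) : set 'rV[R]_n :=
  chart_cod c `&` chart_inv c @^-1` chart_dom d.

Definition transition T (c d : chart R n T) : 'rV[R]_n -> 'rV[R]_n :=
  chart_fun d \o chart_inv c.

Definition compatible T (c d : chart R n T) : Prop :=
  smooth_on (overlap c d) (transition c d) /\
  smooth_on (overlap d c) (transition d c).

Definition smooth_atlas T (A : set (chart R n T)) : Prop :=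
  [/\ (forall c, A c -> is_chart c),
      (forall x : T, exists2 c, A c & chart_dom c x) &
      (forall c d, A c -> A d -> compatible c d)].

Definition smooth_manifold T (A : set (chart R n T)) : Prop :=
  [/\ hausdorff_space T, @second_countable T & smooth_atlas A].

(** Closed manifolds are compact (the charts rule out a boundary), and
    connected. *)
Definition closed_manifold T (A : set (chart R n T)) : Prop :=
  [/\ smooth_manifold A, compact [set: T] & connected [set: T]].

Definition orientable T (A : set (chart R n T)) : Prop :=
  exists B : set (chart R n T),
    [/\ smooth_atlas B,
        (forall c d, A c -> B d -> compatible c d) &
        (forall c d, B c -> B d -> forall v, overlap c d v ->
           0 < \det ('J (transition c d) v))].

Definition smooth_map T U (A : set (chart R n T)) (B : set (chart R n U))
    (f : T -> U) : Prop :=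
  continuous f /\
  forall c d, A c -> B d ->
    smooth_on (chart_cod c `&` (f \o chart_inv c) @^-1` chart_dom d)
              (chart_fun d \o f \o chart_inv c).

Definition diffeomorphism T U (A : set (chart R n T)) (B : set (chart R n U))
    (f : T -> U) : Prop :=
  exists g : U -> T,
    [/\ cancel f g, cancel g f, smooth_map A B f & smooth_map B A g].

(** The smooth structure that a covering [p : R^n -> T] with smooth deck
    transformations induces on [T]: its charts are the local inverses of [p]. *)
Definition cover_atlas T (p : 'rV[R]_n -> T) : set (chart R n T) :=
  [set c | is_chart c /\ forall v, chart_cod c v -> chart_inv c v = p v].

End Manifolds.

Section Sol.
Variable R : realType.

(** Sol is [R^3], with coordinates [(x, y, z)], endowed with the left-invariant
    metric [e^(2z) dx^2 + e^(-2z) dy^2 + dz^2]. *)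
Local Notation Sol := 'rV[R]_3.

Definition Sol_metric (p u v : Sol) : R :=
  let z := p 0 2 in
  expR (2 * z) * (u 0 0 * v 0 0) + expR (- (2 * z)) * (u 0 1 * v 0 1)
  + u 0 2 * v 0 2.

Definition Sol_isometry (f : Sol -> Sol) : Prop :=
  (exists g : Sol -> Sol,
     [/\ cancel f g, cancel g f, smooth_on setT f & smooth_on setT g]) /\
  (forall p u v, Sol_metric (f p) ('d f p u) ('d f p v) = Sol_metric p u v).

Definition isometry_subgroup (G : set (Sol -> Sol)) : Prop :=
  [/\ G `<=` Sol_isometry, G id,
      (forall f g, G f -> G g -> G (f \o g)) &
      (forall f, G f -> exists2 g, G g & cancel f g /\ cancel g f)].

(** Discreteness in [Isom(Sol)] amounts to the action being properly
    discontinuous. *)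
Definition properly_discontinuous (G : set (Sol -> Sol)) : Prop :=
  forall K : set Sol, compact K ->
    finite_set [set f | G f /\ (f @` K) `&` K !=set0].

Definition acts_freely (G : set (Sol -> Sol)) : Prop :=
  forall f p, G f -> f p = p -> f = id.

Definition same_orbit (G : set (Sol -> Sol)) (p q : Sol) : Prop :=
  exists2 f, G f & q = f p.

Definition has_Sol_geometry (Y : topologicalType) (A : set (chart R 3 Y)) :
    Prop :=
  exists G : set (Sol -> Sol),
    [/\ isometry_subgroup G, properly_discontinuous G, acts_freely G &
        exists f : Y -> quotient_space (same_orbit G),
          diffeomorphism A (cover_atlas (quotient_proj (same_orbit G))) f].

End Sol.

Definition closed_orientable_Sol_manifold (R : realType) (Y : topologicalType)
    (A : set (chart R 3 Y)) : Prop :=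
  [/\ closed_manifold A, orientable A & has_Sol_geometry A].

Section Torus.
Variable R : realType.

Definition lattice_translate (u v : 'rV[R]_2) : Prop :=
  exists n : 'rV[int]_2, v = u + map_mx intr n.

Definition torus : topologicalType := quotient_space lattice_translate.

Definition torus_proj : 'rV[R]_2 -> torus := quotient_proj lattice_translate.

Definition torus_diffeo (phi : torus -> torus) : Prop :=
  diffeomorphism (cover_atlas torus_proj) (cover_atlas torus_proj) phi.

(** The loop in the class [n] of [pi_1(T^2) = Z^2]. *)
Definition torus_loop (n : 'rV[int]_2) : R -> torus :=
  fun t => torus_proj (t *: map_mx intr n).

(** The action of [phi] on [pi_1(T^2) = Z^2] is [n |-> A n]. As [pi_1(T^2)] is
    abelian, base points are immaterial, and loops are freely homotopic exactly
    when they have the same class. Elements of [Z^2] and of [R^2] are row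
    vectors, whence the transpose. *)
Definition represented_by (phi : torus -> torus) (A : 'M[int]_2) : Prop :=
  forall n : 'rV[int]_2,
    freely_homotopic (phi \o torus_loop n) (torus_loop (n *m A^T)).

Definition linear_torus_map (A : 'M[int]_2) (x : torus) : torus :=
  torus_proj ((repr x : 'rV[R]_2) *m (map_mx intr A)^T).

Definition isotopic (phi psi : torus -> torus) : Prop :=
  exists H : R * torus -> torus,
    [/\ {within `[0, 1]%classic `*` [set: torus], continuous H},
        (forall t, 0 <= t <= 1 -> torus_diffeo (fun x => H (t, x))),
        (forall x, H (0, x) = phi x) &
        (forall x, H (1, x) = psi x)].

(** [T^2 x R] modulo [(x, t + 1) ~ (phi x, t)]. *)
Definition mapping_torus_rel (phi : torus -> torus) (a b : torus * R) : Prop :=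
  a.2 = b.2 + 1 /\ b.1 = phi a.1.

Definition mapping_torus (phi : torus -> torus) : topologicalType :=
  quotient_space (mapping_torus_rel phi).

End Torus.

Definition mx2 (a b c d : int) : 'M[int]_2 :=
  \matrix_(i < 2, j < 2) (nth [::] [:: [:: a; b]; [:: c; d]] i)`_j.

Definition GL2Z_conjugate (A B : 'M[int]_2) : Prop :=
  exists2 P : 'M[int]_2, P \in unitmx & B = P *m A *m invmx P.

Definition monodromy (i : 'I_3) : 'M[int]_2 :=
  nth 0 [:: mx2 (-3) (-1) 1 0; mx2 (-3) 1 2 (-1); mx2 (-3) 4 2 (-3)] i.

(* Main.v *)
(** Representations of [pi_1(Y)] are the same as representations of the deck
    group of a simply connected covering, so everything is read off an explicit
    group acting on [R^3].

    A local isometry of Sol changes the height [z] to a function with gradient of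
    norm 1, and Bochner's formula forces its [z]-derivative to be 1 or -1; hence
    the isometries are explicit affine maps, which either preserve the two
    horizontal foliations or swap them. For a cocompact orientation preserving
    group, the horizontal translations form a lattice and the heights a cyclic
    group. If some element swaps the foliations, half-integral values of a linear
    functional on the lattice at the squares of the swaps give a non-abelian binary
    dihedral representation. Otherwise the quotient is the mapping torus of a
    hyperbolic [M] in [SL(2, Z)]. Inverting the image of the lattice by a
    dihedral representation shows that if the mapping torus is [SU(2)]-abelian,
    then [2 (M + 1)^-1] is integral; conversely this integrality suffices. So
    [det (M + 1) = tr M + 2] is -1, -2 or -4, with [M + 1] even in the last case,
    and reduction theory leaves the three conjugacy classes. They are
    distinguished by the odd primes [p] for which [H_1] has [p]-rank at least 2. *)
Require Import Defs.
From Stdlib Require Import Relations.Relation_Operators.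
From mathcomp Require Import all_boot all_order all_algebra generic_quotient.
From mathcomp Require Import spectral complex.
From mathcomp Require Import all_classical all_reals all_analysis.
From mathcomp Require Import ring lra zify.

Set Implicit Arguments.
Unset Strict Implicit.
Unset Printing Implicit Defensive.

Import Order.TTheory GRing.Theory Num.Theory.
Import numFieldNormedType.Exports.

Local Open Scope classical_set_scope.
Local Open Scope ring_scope.

(** * Coverings and lifts *)

(** The total space of every covering whose representations are studied is a normed space: straight
    lines supply both the lifting theory and simple connectivity, and a covering enters only through
    its deck group. No Riemannian geometry is set up either; Bochner's formula is an identity
    between partial derivatives of the components of an isometry.

    The integrality criterion arises as follows. A character of the lattice with values in $\mathbb
    R/\mathbb Z$ that is inverted by $M$ extends to the mapping torus group: the lattice goes to
    rotations, the circle direction to a flip. The image is abelian exactly when the character has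
    order at most 2. The inverted characters are those that vanish on the image of $M+1$, so they
    all have order at most 2 exactly when 2 kills the cokernel of $M+1$.

    If the foliations get swapped, the swaps themselves become flips. A flip squares to $-1$, so the
    translation that is the square of a swap must go to a half turn; freeness of the action is what
    makes this consistent.

    The torsion of $H_1$ is the cokernel of $M-1$, of order $2-\mathrm{tr}\,M$, which is 5, 6 or
    8. *)

Lemma near_continuous (T U : topologicalType) (f g : T -> U) (x : T) :
  (\forall z \near x, f z = g z) -> {for x, continuous f} -> {for x, continuous g}.
Proof.
move=> E cf; suff: g z @[z --> x] --> g x by [].
by rewrite -(nbhs_singleton E); exact: cvg_trans (near_eq_cvg E) cf.
Qed.

(** Connectedness of $[0,1]$ as an induction principle. The points [a] and [b] of [U] play symmetric
    roles, so both [P] and its negation spread from a point to a neighbourhood, and the set where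
    [P] holds is open and closed. *)
Lemma real_ind (R : realType) (P : R -> Prop) :
  P 0 ->
  (forall t : R, 0 <= t <= 1 -> exists2 U, nbhs t U &
     forall a b, U a -> U b -> 0 <= a <= 1 -> 0 <= b <= 1 -> P a -> P b) ->
  forall t, 0 <= t <= 1 -> P t.
Proof.
move=> P0 loc.
pose B : set R := [set t | 0 <= t <= 1 /\ P t].
have key : B = `[0, 1]%classic.
  apply: (@segment_connected R 0 1) => //.
  - by exists 0; split => //; rewrite lexx ler01.
  - exists ([set b | 0 <= b <= 1 -> P b]°); first exact: open_interior.
    rewrite eqEsubset; split=> t /=.
      move=> [t01 Pt]; split; first by rewrite /= in_itv.
      have [U Ut PU] := loc t t01.
      by rewrite /interior; near=> b => b01; apply: (PU t) => //;
        [exact: nbhs_singleton|near: b].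
    by move=> [+ /interior_subset /= H]; rewrite /= in_itv /= => t01; split => //; exact: H.
  - exists (~` ([set b | 0 <= b <= 1 -> ~ P b]°)).
      by rewrite closedC; exact: open_interior.
    rewrite eqEsubset; split=> t /=.
      move=> [t01 Pt]; split; first by rewrite /= in_itv.
      by move=> /interior_subset /= /(_ t01).
    move=> [+ H]; rewrite /= in_itv /= => t01; split => //.
    apply: contrapT => nPt; apply: H.
    have [U Ut PU] := loc t t01.
    rewrite /interior; near=> b => b01 Pb; apply: nPt; apply: (PU b) => //; first by near: b.
    exact: nbhs_singleton.
move=> t t01; have : B t by rewrite key /= in_itv.
by case.
Unshelve. all: by end_near. Qed.

(** [p] is a normal covering with group of deck transformations [G]. *)
Record gcover (X Y : topologicalType) (G : set (X -> X)) (p : X -> Y) : Prop :=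
  GCover {
    gc_id : G id;
    gc_comp : forall f g, G f -> G g -> G (f \o g);
    gc_inv : forall f, G f -> exists2 g, G g & cancel f g /\ cancel g f;
    gc_cts : forall f, G f -> continuous f;
    gc_pcts : continuous p;
    gc_open : forall E0, open E0 -> open (p @` E0);
    gc_surj : forall y, exists x, p x = y;
    gc_eq : forall x x', p x = p x' <-> exists2 g, G g & x' = g x;
    gc_free : forall x : X, exists2 W : set X, nbhs x W &
      forall g a, G g -> W a -> W (g a) -> g = id }.

Section Lift.
Variables (R : realType) (X Y : topologicalType) (G : set (X -> X)) (p : X -> Y).
Hypothesis gc : gcover G p.

Lemma gc_nbhs (x : X) (U : set X) : nbhs x U -> nbhs (p x) (p @` U).
Proof.
rewrite nbhsE => -[E0 [oE0 E0x] E0U].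
apply: (@filterS _ _ _ (p @` E0)); first exact: image_subset.
by apply: open_nbhs_nbhs; split; [exact: (gc_open gc)|exists x].
Qed.

Lemma gc_fix g x : G g -> g x = x -> g = id.
Proof.
move=> Gg gx; have [W Wx WG] := gc_free gc x.
by apply: (WG g x) => //; rewrite ?gx; exact: nbhs_singleton.
Qed.

Lemma gc_inj g x h : G g -> G h -> g x = h x -> g = h.
Proof.
move=> Gg Gh e; have [h' Gh' [hK h'K]] := gc_inv gc Gh.
have /(congr1 (fun f => h \o f)) : h' \o g = id.
  by apply: (@gc_fix _ x); [exact: (gc_comp gc)|rewrite /= e hK].
by move=> E; apply/funext => z; move/(congr1 (fun f => f z)): E => /=; rewrite h'K.
Qed.

Lemma gc_orb x g : G g -> p (g x) = p x.
Proof. by move=> Gg; apply/esym/(gc_eq gc); exists g. Qed.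

(** Near a given time, one deck transformation [g] carries [f1] to [f2]. If the lifts agree at some
    nearby time, [g] has a fixed point and is the identity, so they agree at all nearby times. *)
Lemma lift_path_unique (f1 f2 : R -> X) :
  (forall t, 0 <= t <= 1 -> {for t, continuous f1}) ->
  (forall t, 0 <= t <= 1 -> {for t, continuous f2}) ->
  (forall t, 0 <= t <= 1 -> p (f1 t) = p (f2 t)) ->
  f1 0 = f2 0 -> forall t, 0 <= t <= 1 -> f1 t = f2 t.
Proof.
move=> c1 c2 e e0; apply: real_ind => // t t01.
have [W Wt WG] := gc_free gc (f1 t).
have /(gc_eq gc) [g Gg gE] := e _ t01.
have [g' Gg' [gK g'K]] := gc_inv gc Gg.
have cg' : {for f2 t, continuous g'} by exact: (gc_cts gc).
have n1 : \forall a \near t, W (f1 a) by apply: (c1 t t01).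
have n2 : \forall a \near t, W (g' (f2 a)).
  by apply: (c2 t t01 (g' @^-1` W)); apply: (cg' W); rewrite gE gK.
exists (fun a => W (f1 a) /\ W (g' (f2 a))); first exact: filterI.
have step a : 0 <= a <= 1 -> W (f1 a) /\ W (g' (f2 a)) -> f2 a = g (f1 a).
  move=> a01 [Wa Wb]; have /(gc_eq gc) [h Gh hE] := e _ a01.
  have : g' \o h = id by apply: (WG _ (f1 a)) => //=; [exact: (gc_comp gc)|rewrite -hE].
  by move=> /(congr1 (fun k => g (k (f1 a)))) /=; rewrite g'K hE.
move=> a b Ua Ub a01 b01 eab.
have gid : g = id.
  by apply: (@gc_fix _ (f1 a)) => //; rewrite -(step a) // eab.
by rewrite (step b) // gid.
Qed.

(** On an open set that is disjoint from its nontrivial translates, [p] is injective; since it is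
    also open, its inverse there is continuous. *)
Lemma gc_section x : exists (U : set Y) (s : Y -> X),
  [/\ open U, U (p x), s (p x) = x &
      forall y, U y -> p (s y) = y /\ {for y, continuous s}].
Proof.
have [W Wx WG] := gc_free gc x.
move: Wx; rewrite nbhsE => -[E0 [oE0 E0x] E0W].
have /choice [s sP] : forall y, exists x', (p @` E0) y -> E0 x' /\ p x' = y.
  move=> y; have [[x' E0x' <-]|n] := pselect ((p @` E0) y); first by exists x'.
  by exists x.
have uniq a b : E0 a -> E0 b -> p a = p b -> a = b.
  move=> Oa Ob /(gc_eq gc) [g Gg E]; rewrite E in Ob *.
  by rewrite (WG g a) //; exact: E0W.
exists (p @` E0), s; split; first exact: (gc_open gc).
- by exists x.
- have [|Os pE] := sP (p x); first by exists x.
  exact: uniq.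
move=> y Uy; have [Os pE] := sP y Uy; split => //.
move=> N; rewrite /= nbhsE => -[M [oM Ms] MN].
have : nbhs (p (s y)) (p @` (E0 `&` M)).
  by apply: gc_nbhs; apply: open_nbhs_nbhs; split; [exact: openI|].
rewrite pE; apply: filterS => z [w [Ow Mw] <-]; apply: MN => /=.
have [|Oz pz] := sP (p w); first by exists w.
by rewrite (uniq (s (p w)) w).
Qed.

Lemma gc_section_at x x' : p x' = p x -> exists2 h : X -> X, continuous h &
  h x = x' /\ forall a, p (h a) = p a.
Proof.
move=> /esym/(gc_eq gc) [g Gg gE]; exists g; first exact: (gc_cts gc).
by split => // a; rewrite gc_orb.
Qed.

Variables (V : normedModType R).

Lemma lift_unique (f1 f2 : V -> X) a : continuous f1 -> continuous f2 ->
  (forall v, p (f1 v) = p (f2 v)) -> f1 a = f2 a -> f1 = f2.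
Proof.
move=> c1 c2 e e0; apply/funext => v.
pose l (t : R) := a + t *: (v - a).
have cl : continuous l.
  move=> t; apply: cvgD; first exact: cvg_cst.
  by apply: cvgZ; [exact: cvg_id|exact: cvg_cst].
have l1 : l 1 = v by rewrite /l scale1r addrC subrK.
have := @lift_path_unique (f1 \o l) (f2 \o l) _ _ _ _ 1.
rewrite /= l1 /l; apply; rewrite ?scale0r ?addr0 ?lexx ?ler01 //.
- by move=> t _; apply: continuous_comp; [exact: cl|exact: c1].
- by move=> t _; apply: continuous_comp; [exact: cl|exact: c2].
Qed.

Section LiftEx.
Variables (F : V -> Y) (x0 : X).
Hypothesis cF : continuous F.
Hypothesis px0 : p x0 = F 0.

(** An open neighbourhood of the segment from 0 to [v], star-shaped about 0. Lifts over two tubes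
    therefore agree on the intersection, by uniqueness along rays, and no subdivision of cubes is
    needed. *)
Let tube (v : V) (e : R) : set V :=
  [set w | exists2 t, 0 <= t <= 1 & `|w - t *: v| < e].

Let tube_line v e w t : 0 < e -> tube v e w -> 0 <= t <= 1 -> tube v e (t *: w).
Proof.
move=> e0 [s /andP[s0 s1] h] /andP[t0 t1]; exists (t * s).
  by rewrite mulr_ge0 //= mulr_ile1.
rewrite -scalerA -scalerBr normrZ ger0_norm //.
by apply: le_lt_trans h; rewrite ler_piMl.
Qed.

Let tube0 v e : 0 < e -> tube v e 0.
Proof. by move=> e0; exists 0; rewrite ?lexx ?ler01 // scale0r subrr normr0. Qed.

Let tube_end v e : 0 < e -> tube v e v.
Proof. by move=> e0; exists 1; rewrite ?lexx ?ler01 // scale1r subrr normr0. Qed.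

Let lift_on (N : set V) (f : V -> X) :=
  f 0 = x0 /\ forall w, N w -> {for w, continuous f} /\ p (f w) = F w.

Let lift_agree v e v' e' f f' w : 0 < e -> 0 < e' ->
  lift_on (tube v e) f -> lift_on (tube v' e') f' ->
  tube v e w -> tube v' e' w -> f w = f' w.
Proof.
move=> e0 e'0 [f0 fP] [f'0 f'P] Tw T'w.
pose l (t : R) := t *: w.
have cl : continuous l.
  by move=> t; apply: cvgZ; [exact: cvg_id|exact: cvg_cst].
have := @lift_path_unique (f \o l) (f' \o l) _ _ _ _ 1.
rewrite /= /l scale1r; apply; rewrite ?lexx ?ler01 //.
- move=> t t01; apply: continuous_comp; first exact: cl.
  by have [] := fP _ (tube_line e0 Tw t01).
- move=> t t01; apply: continuous_comp; first exact: cl.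
  by have [] := f'P _ (tube_line e'0 T'w t01).
- move=> t t01; have [_ ->] := fP _ (tube_line e0 Tw t01).
  by have [_ ->] := f'P _ (tube_line e'0 T'w t01).
- by rewrite !scale0r f0.
Qed.

Let good v := exists2 e, 0 < e & exists f, lift_on (tube v e) f.

Let open_tube v e : open (tube v e).
Proof.
rewrite openE => w [t t01 h]; rewrite /interior.
have : \forall w' \near w, `|w' - t *: v| < e.
  have : {for w, continuous (fun w' => `|w' - t *: v|)}.
    by apply: continuous_comp; [apply: cvgB; [exact: cvg_id|exact: cvg_cst]|exact: norm_continuous].
  by move=> /(_ _ (lt_nbhsl h)).
by apply: filterS => w' h'; exists t.
Qed.

Let good_step v : forall t : R, 0 <= t <= 1 -> exists2 U : set R, nbhs t U &
  forall a b, U a -> U b -> 0 <= a <= 1 -> 0 <= b <= 1 -> good (a *: v) -> good (b *: v).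
Proof.
move=> t t01.
have [x1 px1] := gc_surj gc (F (t *: v)).
have [U [s [oU Ux sx sP]]] := gc_section x1.
have : nbhs (t *: v) (F @^-1` U).
  by apply: cF; apply: open_nbhs_nbhs; split => //; rewrite -px1.
move=> /nbhs_ballP [d /= d0 dU].
(* Half of the radius [d] is spent on the distance of [a *: v] and [b *: v] from [t *: v], the other
   half on the radius of the new tube. *)
have n1 : \forall a \near t, `|t *: v - a *: v| < d / 2.
  have : {for t, continuous (fun a : R => `|t *: v - a *: v|)}.
    apply: continuous_comp; last exact: norm_continuous.
    by apply: cvgB; [exact: cvg_cst|apply: cvgZ; [exact: cvg_id|exact: cvg_cst]].
  by move=> /(_ _ (lt_nbhsl _)); apply; rewrite subrr normr0 divr_gt0.
exists [set a | `|t *: v - a *: v| < d / 2] => // a b /= Ua Ub a01 b01.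
case=> e e0 [f fP].
pose B : set V := ball (t *: v) d.
have Bline w w' r : 0 <= r <= 1 -> B w -> B w' -> B (w + r *: (w' - w)).
  rewrite /B -!ball_normE /ball_ /= => /andP[r0 r1] h h'.
  have -> : t *: v - (w + r *: (w' - w)) = (1 - r) *: (t *: v - w) + r *: (t *: v - w').
    rewrite !scalerBr !scalerBl !scale1r !opprB !opprD !addrA.
    by rewrite opprK [RHS](ACl (1*4*6*3*(5*2))) /= subrr addr0.
  apply: (le_lt_trans (ler_normD _ _)); rewrite !normrZ (ger0_norm r0) ger0_norm ?subr_ge0 //.
  have [/eqP->|r00] := boolP (r == 0); first by rewrite mul0r addr0 subr0 mul1r.
  have -> : d = (1 - r) * d + r * d by rewrite mulrBl mul1r subrK.
  by rewrite ler_ltD // ?ler_wpM2l ?subr_ge0 // 1?ltW // ltr_pM2l // lt_def r00.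
have Ba : B (a *: v) by rewrite /B -ball_normE /ball_ /=; apply: lt_trans Ua _; lra.
have [_ fa] := fP.2 _ (tube_end (a *: v) e0).
have Uball w : B w -> U (F w) by exact: dU.
have ps : p (s (F (a *: v))) = F (a *: v) by have [] := sP _ (Uball _ Ba).
have [h ch [hs ph]] : exists2 h : X -> X, continuous h &
    h (s (F (a *: v))) = f (a *: v) /\ forall x, p (h x) = p x.
  by apply: gc_section_at; rewrite ps.
pose f' w := if `[< tube (a *: v) e w >] then f w else h (s (F w)).
have f'1 w : tube (a *: v) e w -> f' w = f w by rewrite /f'; case: asboolP.
have csB w : B w -> {for w, continuous (fun w => h (s (F w)))}.
  move=> Bw; apply: continuous_comp; last exact: ch.
  by apply: continuous_comp; [exact: cF|have [] := sP _ (Uball _ Bw)].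
have f'2 w : B w -> f' w = h (s (F w)).
  move=> Bw; rewrite /f'; case: asboolP => // Tw.
  pose l (r : R) := a *: v + r *: (w - a *: v).
  have cl : continuous l.
    move=> r; apply: cvgD; first exact: cvg_cst.
    by apply: cvgZ; [exact: cvg_id|exact: cvg_cst].
  have Bl r : 0 <= r <= 1 -> B (l r) by move=> r01; exact: Bline.
  (* The tube is star-shaped about its end point [a *: v] too. So the segment from there to [w]
     stays in both the tube and the ball, and the old lift and the translated local section agree
     along it. *)
  have Tl r : 0 <= r <= 1 -> tube (a *: v) e (l r).
    move=> /andP[r0 r1]; have [q /andP[q0 q1] hq] := Tw.
    exists ((1 - r) + r * q).
      by apply/andP; split; nra.
    have -> : l r - (1 - r + r * q) *: (a *: v) = r *: (w - q *: (a *: v)).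
      rewrite /l scalerBr scalerBr scalerDl scalerBl scale1r (scalerA r q).
      rewrite !opprD opprK !addrA.
      by rewrite (ACl ((1*4)*(3*5)*2*6)) /= addrN addNr !add0r.
    rewrite normrZ ger0_norm //.
    by apply: le_lt_trans hq; rewrite ler_piMl.
  have := @lift_path_unique (f \o l) ((fun w => h (s (F w))) \o l) _ _ _ _ 1.
  have l1 : l 1 = w by rewrite /l scale1r addrC subrK.
  rewrite /= l1; apply; rewrite ?lexx ?ler01 //.
  - move=> r r01; apply: continuous_comp; first exact: cl.
    by have [] := fP.2 _ (Tl _ r01).
  - move=> r r01; apply: continuous_comp; first exact: cl.
    exact: csB (Bl _ r01).
  - move=> r r01; have [_ ->] := fP.2 _ (Tl _ r01).
    by rewrite ph; have [->] := sP _ (Uball _ (Bl _ r01)).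
  - by rewrite /l scale0r addr0 hs.
pose e' := Num.min e (d / 2).
have e'0 : 0 < e' by rewrite lt_min e0 divr_gt0.
exists e' => //; exists f'; split.
  by rewrite f'1 ?fP.1 //; exact: tube0.
(* A point close to [(r * b) *: v] with [r * b <= a] is in the old tube. Otherwise [(r * b) *: v]
   lies between [a *: v] and [b *: v], hence within [d / 2] of [t *: v], and the point is in the
   ball. *)
have cover w : tube (b *: v) e' w -> tube (a *: v) e w \/ B w.
  move=> [r /andP[r0 r1]]; rewrite lt_min => /andP[h1 h2].
  have [rab|rab] := leP (r * b) a.
    left; have [/eqP a0|a0] := boolP (a == 0).
      exists 0; first by rewrite lexx ler01.
      rewrite scale0r subr0.
      have rb0 : r * b = 0.
        apply/le_anti; rewrite -{1}a0 rab /= mulr_ge0 //.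
        by case/andP: b01.
      by move: h1; rewrite scalerA rb0 scale0r subr0.
    have a0' : 0 < a by rewrite lt_def a0; case/andP: a01.
    exists (r * b / a).
      have b0 : 0 <= b by case/andP: b01.
      by rewrite divr_ge0 ?mulr_ge0 ?(ltW a0') //= ler_pdivrMr // mul1r.
    by rewrite scalerA divfK // -scalerA.
  right; rewrite /B -ball_normE /ball_ /=.
  have : `|t *: v - (r * b) *: v| <= d / 2.
    have ab : a <= r * b <= b.
      by rewrite ltW //= ler_piMl //; case/andP: b01.
    move: Ua Ub ab; rewrite -!scalerBl !normrZ => Ua Ub ab.
    have [tb|tb] := leP t (r * b).
      apply: le_trans (ltW Ub); apply: ler_wpM2r => //.
      case/andP: ab => _ rbb.
      by rewrite !ler0_norm ?subr_le0 // ?opprB ?lerB // (le_trans tb).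
    apply: le_trans (ltW Ua); apply: ler_wpM2r => //.
    case/andP: ab => ab _; have ta := le_trans ab (ltW tb).
    by rewrite !ger0_norm ?subr_ge0 // ?lerB // ltW.
  rewrite scalerA in h2; move=> h3.
  have -> : t *: v - w = (t *: v - (r * b) *: v) - (w - (r * b) *: v).
    by rewrite opprB addrA subrK.
  apply: le_lt_trans (ler_normB _ _) _.
  have -> : d = d / 2 + d / 2 by lra.
  exact: ler_ltD.
move=> w /cover [Tw|Bw].
  have [cw pw] := fP.2 _ Tw; split; last by rewrite f'1.
  have : \forall z \near w, f z = f' z.
    have : nbhs w (tube (a *: v) e) by apply: open_nbhs_nbhs; split.
    by apply: filterS => z /f'1.
  by move=> E; exact: near_continuous cw.
split; last by rewrite f'2 // ph; have [->] := sP _ (Uball _ Bw).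
have : \forall z \near w, h (s (F z)) = f' z.
  have : nbhs w B by apply: open_nbhs_nbhs; split => //; exact: ball_open.
  by apply: filterS => z /f'2.
by move=> E; exact: near_continuous (csB _ Bw).
Qed.

(** The value at [v] is taken from the lift over the tube of [v] itself. Near [v] this diagonal
    choice coincides with the one lift over that tube, so it is continuous. *)
Lemma lift_exists :
  exists f : V -> X, [/\ continuous f, forall v, p (f v) = F v & f 0 = x0].
Proof.
have good0 : good 0.
  have [U [s [oU Ux sx sP]]] := gc_section x0.
  have : nbhs (0 : V) (F @^-1` U).
    by apply: cF; apply: open_nbhs_nbhs; split => //; rewrite -px0.
  move=> /nbhs_ballP [d /= d0 dU].
  exists d => //; exists (s \o F); split; first by rewrite /= -px0.
  move=> w [t _]; rewrite scaler0 subr0 => wd.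
  have Uw : U (F w) by apply: dU; rewrite -ball_normE /ball_ /= sub0r normrN.
  have [pw cw] := sP _ Uw.
  by split => //; apply: continuous_comp => //; exact: cF.
have allgood v : good v.
  rewrite -[v]scale1r; apply: (@real_ind R (fun t => good (t *: v))).
  - by rewrite scale0r.
  - exact: good_step.
  - by rewrite lexx ler01.
have /choice [e eP] : forall v, exists e, 0 < e /\ exists f, lift_on (tube v e) f.
  by move=> v; have [e ? ?] := allgood v; exists e.
have /choice [f fP] : forall v, exists f, lift_on (tube v (e v)) f.
  by move=> v; have [_] := eP v.
have e0 v : 0 < e v by have [] := eP v.
exists (fun v => f v v); split.
- move=> v; have [cv pv] := (fP v).2 _ (tube_end v (e0 v)).
  have E : \forall w \near v, f v w = f w w.
    have : nbhs v (tube v (e v)).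
      by apply: open_nbhs_nbhs; split; [exact: open_tube|exact: tube_end].
    apply: filterS => w Tw; apply: (lift_agree (e0 v) (e0 w)) => //.
    exact: tube_end.
  exact: near_continuous E cv.
- by move=> v; have [_] := (fP v).2 _ (tube_end v (e0 v)).
- by have [] := fP 0.
Qed.

End LiftEx.

End Lift.

(** * Representations of the deck group *)

(** The retraction onto $[0,1]$ turns paths and homotopies, which are continuous only within the
    interval or the square, into maps on a whole normed space, as [lift_exists] requires. *)
Definition clamp (R : realType) (t : R) : R := Num.max 0 (Num.min 1 t).

Section Clamp.
Variable R : realType.
Implicit Types t : R.

Lemma clamp01 t : 0 <= clamp t <= 1.
Proof. by rewrite /clamp le_max lexx /= ge_max ler01 ge_min lexx. Qed.

Lemma clampE t : 0 <= t <= 1 -> clamp t = t.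
Proof. by move=> /andP[t0 t1]; rewrite /clamp (min_idPr t1) (max_idPr t0). Qed.

Lemma clamp_ge1 t : 1 <= t -> clamp t = 1.
Proof. by move=> t1; rewrite /clamp (min_idPl t1) (max_idPr ler01). Qed.

Lemma clamp_le0 t : t <= 0 -> clamp t = 0.
Proof.
by move=> t0; rewrite /clamp (min_idPr (le_trans t0 ler01)) (max_idPl t0).
Qed.

Lemma clamp_continuous : continuous (@clamp R).
Proof.
move=> t; apply: (@continuous_max R R (cst 0) (fun t => Num.min 1 t)).
  exact: cvg_cst.
by apply: (@continuous_min R R (cst 1) id); [exact: cvg_cst|exact: cvg_id].
Qed.

End Clamp.

Lemma within_retract (T U : topologicalType) (A : set T) (f : T -> U) (r : T -> T) :
  {within A, continuous f} -> continuous r -> (forall x, A (r x)) ->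
  continuous (f \o r).
Proof.
move=> /subspace_continuousP cf cr Ar x N /= fN.
have h : nbhs (r x) [set z | A z -> N (f z)] := cf _ (Ar x) N fN.
have h2 : nbhs x (r @^-1` [set z | A z -> N (f z)]) := cr x _ h.
suff : nbhs x ((f \o r) @^-1` N) by [].
by apply: filterS h2 => z; exact.
Qed.

Lemma within_eq (T U : topologicalType) (A : set T) (f g : T -> U) :
  (forall x, A x -> f x = g x) -> continuous f -> {within A, continuous g}.
Proof.
move=> e cf; apply/subspace_continuousP => x Ax N gN.
have h : nbhs x (f @^-1` N) by apply: cf; rewrite e.
suff : nbhs x [set z | A z -> N (g z)] by [].
by apply: filterS h => z h Az /=; rewrite -e.
Qed.

Lemma cvg_pairT (T U V : topologicalType) (f : T -> U) (g : T -> V) :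
  continuous f -> continuous g -> continuous (fun x => (f x, g x)).
Proof. by move=> cf cg x; apply: cvg_pair; [exact: cf|exact: cg]. Qed.

Definition SU2_hom (R : realType) (X : Type) (G : set (X -> X))
    (r : (X -> X) -> 'M[R[i]]_2) : Prop :=
  (forall g, G g -> in_SU2 (r g)) /\
  (forall g h, G g -> G h -> r (g \o h) = r g *m r h).

Section Holonomy.
Variables (R : realType) (X : normedModType R) (Y : topologicalType).
Variables (G : set (X -> X)) (p : X -> Y).
Hypothesis gc : gcover G p.

(** The isomorphism from $\pi_1(Y, p(x_0))$ to the deck group, as a relation: the lift of [c] from
    [x0] ends at [g x0]. The lemmas below show that it is total and single-valued on loops, and that
    it identifies exactly the homotopic ones. *)
Definition Hol (x0 : X) (c : R -> Y) (g : X -> X) : Prop :=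
  exists l : R -> X, [/\ continuous l, l 0 = x0, l 1 = g x0 &
    forall t, 0 <= t <= 1 -> p (l t) = c t].

Lemma hol_loop x0 c g : G g -> Hol x0 c g -> is_loop (p x0) c.
Proof.
move=> Gg [l [cl l0 l1 pl]]; split.
- apply: (@within_eq _ _ _ (p \o l)).
    by move=> t; rewrite /= in_itv /= => /pl.
  by move=> t; apply: continuous_comp; [exact: cl|exact: (gc_pcts gc)].
- by rewrite -pl ?lexx ?ler01 // l0.
- by rewrite -pl ?lexx ?ler01 // l1 (gc_orb gc).
Qed.

Lemma loop_clamp y (c : R -> Y) : is_loop y c -> continuous (c \o @clamp R).
Proof.
case=> cc _ _; apply: within_retract cc _ _; first exact: clamp_continuous.
by move=> t; rewrite /= in_itv /= clamp01.
Qed.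

Lemma hol_ex x0 c : is_loop (p x0) c -> exists2 g, G g & Hol x0 c g.
Proof.
move=> lc; have := @lift_exists R X Y G p gc R^o (c \o @clamp R) x0.
case.
- exact: loop_clamp lc.
- by rewrite /= clampE ?lexx ?ler01 //; case: lc.
move=> l [cl pl l0]; have /esym/(gc_eq gc)[g Gg gE] : p (l 1) = p x0.
  by rewrite pl /= clampE ?lexx ?ler01 //; case: lc.
exists g => //; exists l; split => // t t01.
by rewrite pl /= clampE.
Qed.

Lemma hol_line x0 g : G g ->
  Hol x0 (fun t => p (x0 + t *: (g x0 - x0))) g.
Proof.
move=> Gg; exists (fun t => x0 + t *: (g x0 - x0)); split => //.
- move=> t; apply: cvgD; first exact: cvg_cst.
  by apply: cvgZ; [exact: cvg_id|exact: cvg_cst].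
- by rewrite scale0r addr0.
- by rewrite scale1r addrC subrK.
Qed.

Lemma hol_uniq x0 c g h : G g -> G h -> Hol x0 c g -> Hol x0 c h -> g = h.
Proof.
move=> Gg Gh [l [cl l0 l1 pl]] [m [cm m0 m1 pm]].
apply: (@gc_inj _ _ _ _ gc _ x0) => //; rewrite -l1 -m1.
apply: (lift_path_unique gc) => //; rewrite ?lexx ?ler01 //.
- by move=> t _; exact: cl.
- by move=> t _; exact: cm.
- by move=> t t01; rewrite pl // pm.
- by rewrite l0.
Qed.

(** Lift the homotopy to the square. The two sides traced by the end points lie over a constant path
    and are constant, so the lifted loops end at the same point. *)
Lemma hol_homotopic x0 c d g h : G g -> G h -> Hol x0 c g -> Hol x0 d h ->
  loop_homotopic (p x0) c d -> g = h.
Proof.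
move=> Gg Gh [l [cl l0 l1 pl]] [m [cm m0 m1 pm]] [H [cH H0 H1 Hend]].
pose r (z : R * R) := (clamp z.1, clamp z.2).
have cr : continuous r.
  apply: cvg_pairT => z; (apply: continuous_comp; [|exact: clamp_continuous]).
    exact: cvg_fst.
  exact: cvg_snd.
have cF : continuous (H \o r).
  apply: within_retract cH cr _ => z; split => /=; rewrite in_itv /= clamp01 //.
have i0 : 0 <= (0 : R) <= 1 by rewrite lexx ler01.
have i1 : 0 <= (1 : R) <= 1 by rewrite lexx ler01.
have I t : 0 <= t <= 1 -> (`[0, 1]%classic : set R) t by rewrite /= in_itv.
have [f [cf pf f0]] : exists f : (R^o * R^o)%type -> X,
    [/\ continuous f, forall v, p (f v) = (H \o r) v & f 0 = x0].
  apply: (lift_exists gc) => //.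
  by rewrite /= /r /= !clampE // H0 ?I // -pl // l0.
have path (a b : R -> R^o) : continuous a -> continuous b ->
    continuous (fun t => f (a t, b t)).
  move=> ca cb t; apply: (@continuous_comp _ _ _ (fun t => (a t, b t)) f); last exact: cf.
  exact: (cvg_pairT ca cb).
have cid : continuous (fun t : R => t : R^o) by move=> t; exact: cvg_id.
have ccst (k : R) : continuous (fun t : R => k : R^o) by move=> t; exact: cvg_cst.
have e0 s : 0 <= s <= 1 -> f (s, 0) = x0.
  move=> s01; apply: (lift_path_unique gc (f1 := fun s => f (s, 0)) (f2 := cst x0)) => //.
  - by move=> t _; exact: path.
  - by move=> t _; exact: cvg_cst.
  - move=> t t01; rewrite pf /= /r /= !clampE //.
    by have [] := Hend t (I _ t01).
have e1 s : 0 <= s <= 1 -> f (s, 1) = f (0, 1).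
  move=> s01; apply: (lift_path_unique gc (f1 := fun s => f (s, 1)) (f2 := cst (f (0, 1)))) => //.
  - by move=> t _; exact: path.
  - by move=> t _; exact: cvg_cst.
  - move=> t t01; rewrite !pf /= /r /= !clampE //.
    have [_ ->] := Hend t (I _ t01).
    by have [_ ->] := Hend 0 (I _ i0).
have -> := @gc_inj _ _ _ _ gc g x0 h => //.
rewrite -l1 -m1.
have -> : l 1 = f (0, 1).
  apply: (lift_path_unique gc (f2 := fun t => f (0, t))) => //.
  - by move=> t _; exact: cl.
  - by move=> t _; exact: path.
  - by move=> t t01; rewrite pl // pf /= /r /= !clampE // H0 // I.
  - by rewrite l0 f0.
rewrite -(e1 1) //; apply: (lift_path_unique gc (f1 := fun t => f (1, t))) => //.
- by move=> t _; exact: path.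
- by move=> t _; exact: cm.
- by move=> t t01; rewrite pm // pf /= /r /= !clampE // H1 // I.
- by rewrite m0 e0.
Qed.

(** Simple connectivity of [X] enters here: two lifts with common end points are joined by straight
    segments. *)
Lemma homotopic_hol x0 c d g : G g -> Hol x0 c g -> Hol x0 d g ->
  loop_homotopic (p x0) c d.
Proof.
move=> Gg [l [cl l0 l1 pl]] [m [cm m0 m1 pm]].
exists (fun z => p (l z.2 + z.1 *: (m z.2 - l z.2))); split.
- apply: continuous_subspaceT => z.
  apply: (@continuous_comp _ _ _ (fun z : R * R => l z.2 + z.1 *: (m z.2 - l z.2)) p);
    last exact: (gc_pcts gc).
  have c2 : {for z, continuous (fun z : R * R => l z.2)}.
    by apply: continuous_comp; [exact: cvg_snd|exact: cl].
  apply: cvgD => //; apply: cvgZ; first exact: cvg_fst.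
  apply: cvgB => //.
  by apply: continuous_comp; [exact: cvg_snd|exact: cm].
- by move=> t; rewrite /= in_itv /= => t01; rewrite scale0r addr0 pl.
- by move=> t; rewrite /= in_itv /= => t01; rewrite scale1r addrC subrK pm.
- move=> s _ /=; rewrite l0 m0 l1 m1 !subrr !scaler0 !addr0; split => //.
  exact: (gc_orb gc).
Qed.

Lemma hol_concat x0 c d g h : G g -> G h -> Hol x0 c g -> Hol x0 d h ->
  Hol x0 (loop_concat c d) (g \o h).
Proof.
move=> Gg Gh [l [cl l0 l1 pl]] [m [cm m0 m1 pm]].
have c1 : continuous (fun t : R => clamp (2 * t)).
  move=> t; apply: (@continuous_comp _ _ _ (fun t : R => 2 * t)); last exact: clamp_continuous.
  by apply: cvgM; [exact: cvg_cst|exact: cvg_id].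
have c2 : continuous (fun t : R => clamp (2 * t - 1)).
  move=> t; apply: (@continuous_comp _ _ _ (fun t : R => 2 * t - 1)); last exact: clamp_continuous.
  apply: cvgB; last exact: cvg_cst.
  by apply: cvgM; [exact: cvg_cst|exact: cvg_id].
(* The lift is [l] followed by the translate of [m] by [g]. At each time one of the first two
   summands equals [g x0] and cancels with the third, so continuity needs no gluing. *)
exists (fun t => l (clamp (2 * t)) + g (m (clamp (2 * t - 1))) - g x0); split.
- move=> t; apply: cvgB; last exact: cvg_cst.
  apply: cvgD.
    by apply: (@continuous_comp _ _ _ (fun t : R => clamp (2 * t))); [exact: c1|exact: cl].
  apply: (@continuous_comp _ _ _ (fun t : R => m (clamp (2 * t - 1)))); last exact: (gc_cts gc).
  by apply: (@continuous_comp _ _ _ (fun t : R => clamp (2 * t - 1))); [exact: c2|exact: cm].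
- by rewrite mulr0 !clamp_le0 // ?m0 ?addrK //; lra.
- have -> : clamp (2 * 1 : R) = 1 by apply: clamp_ge1; lra.
  have -> : clamp (2 * 1 - 1 : R) = 1 by apply: clamp_ge1; lra.
  by rewrite l1 m1 addrAC subrr add0r.
- move=> t /andP[t0 t1]; rewrite /loop_concat; case: ifPn => [h2|].
    rewrite (@clamp_le0 _ (2 * t - 1)); last by lra.
    by rewrite m0 addrK clampE ?pl //; lra.
  rewrite -ltNge => h2; rewrite (@clamp_ge1 _ (2 * t)); last by lra.
  rewrite l1 addrAC subrr add0r (gc_orb gc) // clampE ?pm //; lra.
Qed.

Lemma rep_to_hom x0 (rho : (R -> Y) -> 'M[R[i]]_2) :
  SU2_representation (p x0) rho ->
  exists2 r, SU2_hom G r & forall c g, G g -> Hol x0 c g -> rho c = r g.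
Proof.
move=> [rU rh rM].
pose r (g : X -> X) := rho (fun t => p (x0 + t *: (g x0 - x0))).
have rE c g : G g -> Hol x0 c g -> rho c = r g.
  move=> Gg Hc; have Hl := hol_line x0 Gg.
  apply: rh; [exact: hol_loop Hc|exact: hol_loop Hl|exact: homotopic_hol Hc Hl].
exists r => //; split.
  by move=> g Gg; apply: rU; exact: hol_loop Gg (hol_line x0 Gg).
move=> g h Gg Gh; rewrite -rM; last 2 first.
- exact: hol_loop Gg (hol_line x0 Gg).
- exact: hol_loop Gh (hol_line x0 Gh).
apply/esym/rE; first exact: (gc_comp gc).
by apply: hol_concat => //; exact: hol_line.
Qed.

Lemma hom_to_rep x0 r : SU2_hom G r ->
  exists2 rho : (R -> Y) -> 'M[R[i]]_2, SU2_representation (p x0) rho &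
    forall c g, G g -> Hol x0 c g -> rho c = r g.
Proof.
move=> [rU rM].
have /choice [s sP] : forall c, exists h, (exists2 g, G g & Hol x0 c g) -> G h /\ Hol x0 c h.
  move=> c; have [[g Gg Hg]|n] := pselect (exists2 g, G g & Hol x0 c g); first by exists g.
  by exists id.
pose rho c := r (s c).
have rE c g : G g -> Hol x0 c g -> rho c = r g.
  move=> Gg Hg; have [|Gh Hh] := sP c; first by exists g.
  by rewrite /rho (hol_uniq Gg Gh Hg Hh).
exists rho => //; split.
- by move=> c /hol_ex [g Gg Hg]; rewrite (rE _ g) //; exact: rU.
- move=> c d /hol_ex [g Gg Hg] /hol_ex [h Gh Hh] /(hol_homotopic Gg Gh Hg Hh) gh.
  by rewrite (rE _ g) // (rE _ h) // gh.
- move=> c d /hol_ex [g Gg Hg] /hol_ex [h Gh Hh].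
  rewrite (rE _ _ Gg Hg) (rE _ _ Gh Hh) -rM //.
  by apply: rE; [exact: (gc_comp gc)|exact: hol_concat].
Qed.

Lemma SU2_abelianP : SU2_abelian R Y <->
  forall r : (X -> X) -> 'M[R[i]]_2, SU2_hom G r ->
  forall g h, G g -> G h -> r g *m r h = r h *m r g.
Proof.
split=> [ab r rhom g h Gg Gh|ab y rho rep c d lc ld].
  have [rho rep rE] := hom_to_rep 0 rhom.
  have Hg := hol_line 0 Gg; have Hh := hol_line 0 Gh.
  rewrite -(rE _ _ Gg Hg) -(rE _ _ Gh Hh).
  by apply: ab rep _ _ _ _; [exact: hol_loop Gg Hg|exact: hol_loop Gh Hh].
have [x0 e] := gc_surj gc y; rewrite -e in rep lc ld.
have [r rhom rE] := rep_to_hom rep.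
have [g Gg Hg] := hol_ex lc; have [h Gh Hh] := hol_ex ld.
by rewrite (rE _ _ Gg Hg) (rE _ _ Gh Hh); exact: ab.
Qed.

End Holonomy.

(** * Representations into SU(2) *)

Section SU2Algebra.
Variable R : realType.
Local Notation M2 := 'M[R[i]]_2.
Implicit Types (A B T : M2).

Lemma ord2_dec (P : 'I_2 -> Prop) : P 0 -> P 1 -> forall i, P i.
Proof.
by move=> P0 P1 [[|[|//]] h]; [move: P0|move: P1]; congr P; exact: val_inj.
Qed.

Lemma mx2_eqP (S : Type) (A B : 'M[S]_2) : A 0 0 = B 0 0 -> A 0 1 = B 0 1 ->
  A 1 0 = B 1 0 -> A 1 1 = B 1 1 -> A = B.
Proof.
by move=> a b c d; apply/matrixP; apply: ord2_dec; apply: ord2_dec.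
Qed.

Lemma mulmx2E (S : nzRingType) (A B : 'M[S]_2) i j :
  (A *m B) i j = A i 0 * B 0 j + A i 1 * B 1 j.
Proof.
rewrite mxE !big_ord_recl big_ord0 addr0; congr (_ + A i _ * B _ j);
exact: val_inj.
Qed.

Lemma SU2_1 : in_SU2 (1%:M : M2).
Proof.
split; last by rewrite det1.
by apply/unitarymxP; rewrite trmx1 map_mx1 mulmx1.
Qed.

(** The real span of [SU(2)] is the skew field of quaternions. *)
Definition quat A := A 1 1 = (A 0 0)^* /\ A 1 0 = - (A 0 1)^*.

Lemma quatB A B : quat A -> quat B -> quat (A - B).
Proof.
by move=> [a b] [c d]; rewrite /quat !mxE a b c d !rmorphB !opprB; split => //; ring.
Qed.

Lemma SU2_mulVmx A : in_SU2 A -> invmx A *m A = 1%:M.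
Proof. by move=> [_ d]; rewrite mulVmx // unitmxE d unitr1. Qed.

Lemma SU2_mulmxV A : in_SU2 A -> A *m invmx A = 1%:M.
Proof. by move=> [_ d]; rewrite mulmxV // unitmxE d unitr1. Qed.

Lemma det_mx2 (S : comNzRingType) (A : 'M[S]_2) : \det A = A 0 0 * A 1 1 - A 0 1 * A 1 0.
Proof.
rewrite (expand_det_row _ 0) !big_ord_recl big_ord0 addr0 /cofactor !det_mx11 !mxE /=.
rewrite expr0 expr1 mul1r mulN1r mulrN.
by congr (A _ _ * A _ _ - A _ _ * A _ _); exact: val_inj.
Qed.

Lemma SU2_invE A : in_SU2 A -> invmx A = \matrix_(i, j) (A j i)^*.
Proof.
move=> [/unitarymxP u d].
have Au : A \in unitmx by rewrite unitmxE d unitr1.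
apply: (can_inj (mulKmx Au)); rewrite mulmxV // -u; congr (_ *m _).
by apply/matrixP => i j; rewrite !mxE.
Qed.

Lemma SU2_adjE A : in_SU2 A ->
  invmx A = \matrix_(i, j) (if i == j then A (1 - i) (1 - i) else - A i j).
Proof.
move=> [u d].
have Au : A \in unitmx by rewrite unitmxE d unitr1.
apply: (can_inj (mulKmx Au)); rewrite mulmxV //; rewrite det_mx2 in d.
by apply: mx2_eqP; rewrite mulmx2E !mxE /= ?subr0 ?subrr; rewrite -?d; ring.
Qed.

Lemma SU2_quat A : in_SU2 A -> quat A.
Proof.
move=> sA; have := SU2_invE sA; rewrite (SU2_adjE sA) => /matrixP e; split.
  by have := e 0 0; rewrite !mxE /= subr0.
by have := e 1 0; rewrite !mxE /= => /esym/eqP; rewrite -eqr_oppLR => /eqP <-.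
Qed.

(** The determinant of a quaternion is $|a|^2+|b|^2$ in terms of its first row, so a nonzero
    quaternion is invertible. *)
Lemma quat_integral A B : quat A -> A *m B = 0 -> A = 0 \/ B = 0.
Proof.
move=> [a b] AB.
have [d0|d0] := eqVneq (\det A) 0; last first.
  right; have Au : A \in unitmx by rewrite unitmxE unitfE.
  by apply: (can_inj (mulKmx Au)); rewrite AB mulmx0.
left; move: d0; rewrite det_mx2 a b mulrN opprK => d0.
have n0 (z : R[i]) : 0 <= z * z^* by exact: mul_conjC_ge0.
have z0 (z w : R[i]) : z * z^* + w * w^* = 0 -> z = 0.
  move=> /eqP; rewrite paddr_eq0 // => /andP[/eqP h _].
  by apply/eqP; rewrite -mul_conjC_eq0 h.
have e0 := z0 _ _ d0.
have e1 : A 0 1 = 0 by apply: (z0 _ (A 0 0)); rewrite addrC.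
by apply: mx2_eqP; rewrite ?mxE ?a ?b ?e0 ?e1 ?rmorph0 ?oppr0.
Qed.

Lemma SU2_CH A : in_SU2 A -> A + invmx A = (A 0 0 + A 1 1)%:M.
Proof.
move=> sA; rewrite (SU2_adjE sA).
by apply: mx2_eqP; rewrite !mxE /= ?subr0 ?subrr ?mulr1n ?mulr0n; ring.
Qed.

(** Conjugate matrices have the same trace, so $A+A^{-1}=B+B^{-1}$ by Cayley-Hamilton. As $A$ and
    $B$ commute, this says $(B-A)(B-A^{-1})=0$, and quaternions have no zero divisors. *)
Lemma SU2_commuting_conj A B T : in_SU2 A -> in_SU2 B -> in_SU2 T ->
  T *m A = B *m T -> A *m B = B *m A -> A = B \/ B *m A = 1%:M.
Proof.
move=> sA sB sT TA AB.
have Au : A \in unitmx by rewrite unitmxE sA.2 unitr1.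
have trE : A 0 0 + A 1 1 = B 0 0 + B 1 1.
  have -> : B = T *m A *m invmx T by rewrite TA -mulmxA SU2_mulmxV // mulmx1.
  have := mxtrace_mulC (T *m A) (invmx T); rewrite mulmxA SU2_mulVmx // mul1mx.
  rewrite /mxtrace !big_ord_recl !big_ord0 !addr0.
  by rewrite (_ : lift ord0 ord0 = 1) //; exact: val_inj.
have E : B + invmx B = A + invmx A by rewrite !SU2_CH // trE.
have : (B - A) *m (B - invmx A) = 0.
  have iA : invmx A = B + invmx B - A by rewrite E addrC addKr.
  rewrite mulmxBl !mulmxBr (mulmxV Au) iA mulmxBr mulmxDr SU2_mulmxV // AB.
  by rewrite !opprB opprD !addrA subrK [X in X - _]addrAC subrr add0r subrr.
move=> /(quat_integral (quatB (SU2_quat sB) (SU2_quat sA))) [|] /eqP; rewrite subr_eq0 => /eqP e.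
  by left.
by right; rewrite e mulVmx.
Qed.

(** From $(A-1)(A+1)=0$ among quaternions, $A=\pm1$. *)
Lemma SU2_sq1 A : in_SU2 A -> A *m A = 1%:M -> forall B, A *m B = B *m A.
Proof.
move=> sA A2 B.
have : (A - 1%:M) *m (A + 1%:M) = 0.
  by rewrite mulmxBl !mulmxDr A2 !mul1mx !mulmx1 opprD addrA addrK subrr.
move=> /(quat_integral (quatB (SU2_quat sA) (SU2_quat SU2_1))) [|] /eqP.
  by rewrite subr_eq0 => /eqP ->; rewrite mul1mx mulmx1.
by rewrite addr_eq0 => /eqP ->; rewrite mulNmx mulmxN mul1mx mulmx1.
Qed.

Lemma SU2_mul A B : in_SU2 A -> in_SU2 B -> in_SU2 (A *m B).
Proof.
move=> [a da] [b db]; split; last by rewrite det_mulmx da db mulr1.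
by apply: mul_unitarymx.
Qed.

(** By [SU2_commuting_conj], every [n] lies in one of two subgroups: that where $r(nM)=r(n)$ and
    that where $r(n(M+1))=1$. A group is not the union of two proper subgroups, so one of them is
    everything. In the first case [T] commutes with all [r n]; in the second $r(n)^2=r(nN(M+1))=1$,
    so [r n] is central. *)
Lemma SU2_solvable_abelian (r : 'rV[int]_2 -> M2) T (M N : 'M[int]_2) :
  (forall n, in_SU2 (r n)) -> (forall n m, r (n + m) = r n *m r m) ->
  in_SU2 T -> (forall n, T *m r n = r (n *m M) *m T) ->
  N *m (M + 1%:M) = 2%:M -> forall n, T *m r n = r n *m T.
Proof.
move=> rU rD TU TM NM.
have rC n m : r n *m r m = r m *m r n by rewrite -!rD addrC.
have r0 : r 0 = 1%:M.
  have := rD 0 0; rewrite addr0 => /(congr1 (mulmx (invmx (r 0)))).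
  by rewrite mulmxA SU2_mulVmx // mul1mx.
have dich n : r (n *m M) = r n \/ r (n *m (M + 1%:M)) = 1%:M.
  have [|h|h] := SU2_commuting_conj (rU n) (rU (n *m M)) TU (TM n).
  - exact: rC.
  - by left.
  - by right; rewrite mulmxDr mulmx1 rD.
have [[n0 h0]|all] := pselect (exists n0, r (n0 *m M) <> r n0); last first.
  move=> n; rewrite TM; congr (_ *m _); apply: contrapT => h; apply: all.
  by exists n.
have e0 : r (n0 *m (M + 1%:M)) = 1%:M by have [] := dich n0.
have key n : r (n *m (M + 1%:M)) = 1%:M.
  have [h|//] := dich n; have [h'|h'] := dich (n + n0).
    case: h0; move: h'; rewrite mulmxDl !rD h.
    by move=> /(congr1 (mulmx (invmx (r n)))); rewrite !mulmxA SU2_mulVmx // !mul1mx.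
  by move: h'; rewrite mulmxDl rD e0 mulmx1.
move=> n; apply/esym; apply: (SU2_sq1 (rU n)); rewrite -rD.
have -> : n + n = (n *m N) *m (M + 1%:M).
  by rewrite -mulmxA NM -scalemx1 -scalemxAr mulmx1 scaler_nat mulr2n.
exact: key.
Qed.

End SU2Algebra.

(** * Binary dihedral representations *)

Section Dihedral.
Variable R : realType.
Local Notation C x := (real_complex R x).

Definition rotmx (t : R) : 'M[R[i]]_2 :=
  \matrix_(i, j) (if i == j then (if i == 0 then (cos t +i* sin t)%C else (cos t -i* sin t)%C) else 0).

Definition flipmx : 'M[R[i]]_2 := \matrix_(i, j) (if i == j then 0 else if i == 0 then -1 else 1).

Lemma rotmxD s t : rotmx (s + t) = rotmx s *m rotmx t.
Proof.
apply: mx2_eqP; rewrite mulmx2E !mxE /= ?mulr0 ?mul0r ?addr0 ?add0r // cosD sinD; simpc;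
by congr (_ +i* _)%C; ring.
Qed.

Lemma rotmx0 : rotmx 0 = 1%:M.
Proof. by apply: mx2_eqP; rewrite !mxE /= ?cos0 ?sin0 ?oppr0. Qed.

Lemma flip_rot t : flipmx *m rotmx t = rotmx (- t) *m flipmx.
Proof.
apply: mx2_eqP; rewrite !mulmx2E !mxE /= cosN sinN ?opprK; simpc; rewrite ?mulr0 ?mul0r ?addr0 ?add0r //.
Qed.

Lemma flip_sq : flipmx *m flipmx = rotmx pi.
Proof.
by apply: mx2_eqP; rewrite mulmx2E !mxE /= ?cospi ?sinpi; simpc; rewrite ?oppr0.
Qed.

Lemma rotmx_SU2 t : in_SU2 (rotmx t).
Proof.
have c2 := cos2Dsin2 t.
split; last first.
  rewrite det_mx2 !mxE /= mulr0 subr0; simpc; rewrite -?expr2.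
  by apply/eqP; rewrite eq_complex /= -?expr2 ?c2; apply/andP; split; apply/eqP; [rewrite -c2|]; ring.
apply/unitarymxP; apply: mx2_eqP; rewrite mulmx2E !mxE /= ?conjC0 ?mulr0 ?mul0r ?addr0 ?add0r //; simpc;
by apply/eqP; rewrite eq_complex /=; apply/andP; split; apply/eqP; rewrite -?c2; ring.
Qed.

Lemma flipmx_SU2 : in_SU2 flipmx.
Proof.
split; last by rewrite det_mx2 !mxE /= mul0r sub0r mulr1 opprK.
by apply/unitarymxP; apply: mx2_eqP;
  rewrite mulmx2E !mxE /= ?rmorphN ?rmorph0 ?rmorph1 ?mulr0 ?mul0r ?addr0 ?add0r ?mulrNN ?mulr1.
Qed.

Lemma rotmx_2pi (k : int) t : rotmx (t + 2 * pi * k%:~R) = rotmx t.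
Proof.
have e (n : nat) : rotmx (2 * pi * n%:R) = 1%:M.
  have -> : 2 * pi * n%:R = 0 + (pi : R) *+ 2 *+ n.
    by rewrite add0r mulr_natl mulr_natr.
  rewrite -rotmx0; apply: mx2_eqP;
  by rewrite !mxE //= (periodicn (@cosD2pi R)) (periodicn (@sinD2pi R)).
rewrite rotmxD; case: k => n; first by rewrite -pmulrn e mulmx1.
rewrite NegzE mulrNz mulrN -pmulrn.
have := rotmxD (2 * pi * n.+1%:R) (- (2 * pi * n.+1%:R)).
by rewrite subrr rotmx0 e mul1mx => <-; rewrite mulmx1.
Qed.

(** The representation sends [g] to the rotation by [th g], followed by a flip if [s g]. Moving a
    flip past a rotation inverts the angle, and two flips make the rotation by $\pi$: this is the
    cocycle condition on [th], modulo $2\pi$. A rotation commutes with the flip only if the sine of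
    its angle vanishes. *)
Lemma dihedral_nonabelian (X : Type) (G : set (X -> X)) (s : (X -> X) -> bool)
    (th : (X -> X) -> R) g0 g1 :
  (forall g h, G g -> G h -> s (g \o h) = s g (+) s h) ->
  (forall g h, G g -> G h -> exists k : int, th (g \o h) =
     th g + (-1) ^+ s g * th h + (pi : R) * (s g && s h)%:R + 2 * (pi : R) * k%:~R) ->
  G g0 -> G g1 -> s g0 = false -> s g1 -> sin (th g0) != 0 ->
  exists2 r : (X -> X) -> 'M[R[i]]_2, SU2_hom G r & r g0 *m r g1 <> r g1 *m r g0.
Proof.
move=> sD thD G0 G1 s0 s1 sin0.
pose J b : 'M[R[i]]_2 := if b then flipmx else 1%:M.
exists (fun g => rotmx (th g) *m J (s g)); [split|].
- move=> g Gg; apply: SU2_mul; first exact: rotmx_SU2.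
  by rewrite /J; case: (s g); [exact: flipmx_SU2|exact: SU2_1].
- move=> g h Gg Gh; have [k ->] := thD _ _ Gg Gh.
  rewrite rotmx_2pi sD // !mulmxA /J; case: (s g); case: (s h) => /=;
    rewrite ?expr0 ?expr1 ?mul1r ?mulN1r ?mulr1 ?mulr0 ?addr0 ?mulmx1 //.
  + rewrite -(mulmxA _ flipmx) flip_rot !mulmxA -[RHS]mulmxA flip_sq.
    by rewrite -!rotmxD.
  + by rewrite -(mulmxA _ flipmx) flip_rot !mulmxA -!rotmxD.
  + by rewrite -rotmxD.
  + by rewrite -rotmxD.
- rewrite s0 s1 /J mulmx1 !mulmxA -[X in _ = X]mulmxA flip_rot !mulmxA -!rotmxD.
  move=> /(congr1 (mulmx^~ (invmx flipmx))); rewrite -!mulmxA SU2_mulmxV; last exact: flipmx_SU2.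
  rewrite !mulmx1 addrC !rotmxD => /(congr1 (mulmx (invmx (rotmx (th g1))))).
  rewrite !mulmxA SU2_mulVmx; last exact: rotmx_SU2.
  rewrite !mul1mx => /matrixP/(_ 0 0); rewrite !mxE /= sinN => -[] _ /eqP.
  by rewrite -subr_eq0 opprK -mulr2n mulrn_eq0 /= (negPf sin0).
Qed.

End Dihedral.

(** * Coverings of the torus and of mapping tori *)

Lemma addr_continuous (R : realType) (W : normedModType R) (c : W) :
  continuous (fun v => v + c).
Proof. by move=> v; apply: cvgD; [exact: cvg_id|exact: cvg_cst]. Qed.

Section QuotientLemmas.
Variables (T : topologicalType) (r : T -> T -> Prop).

Lemma quotient_proj_eq x y :
  quotient_proj r x = quotient_proj r y <-> clos_refl_sym_trans T r x y.
Proof.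
split=> h; first by apply/asboolP/(@eqmodP _ (generated_equiv r)).
by apply/(@eqmodP _ (generated_equiv r))/asboolP.
Qed.

Lemma quotient_proj_surj y : exists x, quotient_proj r x = y.
Proof. by exists (repr y); rewrite /quotient_proj reprK. Qed.

Lemma quotient_proj_open (U : set (quotient_space r)) :
  open U <-> open (quotient_proj r @^-1` U).
Proof. by []. Qed.

Lemma quotient_proj_continuous : continuous (quotient_proj r).
Proof. by apply/continuousP => U. Qed.

End QuotientLemmas.

Lemma homeo_sym (T U : topologicalType) : homeomorphic T U -> homeomorphic U T.
Proof. by move=> [f [g [a b c d]]]; exists g, f. Qed.

Lemma homeo_trans (T U V : topologicalType) :
  homeomorphic T U -> homeomorphic U V -> homeomorphic T V.
Proof.
move=> [f [g [cf cg fg gf]]] [f2 [g2 [cf2 cg2 fg2 gf2]]].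
exists (f2 \o f), (g \o g2); split.
- by move=> x; apply: continuous_comp; [exact: cf|exact: cf2].
- by move=> x; apply: continuous_comp; [exact: cg2|exact: cg].
- by move=> x /=; rewrite fg2 fg.
- by move=> x /=; rewrite gf gf2.
Qed.

Section GcoverBuild.
Variables (X Y : topologicalType) (G : set (X -> X)) (p : X -> Y).

Lemma gcover_quot :
  G id -> (forall f g, G f -> G g -> G (f \o g)) ->
  (forall f, G f -> exists2 g, G g & cancel f g /\ cancel g f) ->
  (forall f, G f -> continuous f) ->
  (forall U, open U <-> open (p @^-1` U)) ->
  (forall y, exists x, p x = y) ->
  (forall x x', p x = p x' <-> exists2 g, G g & x' = g x) ->
  (forall x : X, exists2 W : set X, nbhs x W &
      forall g a, G g -> W a -> W (g a) -> g = id) ->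
  gcover G p.
Proof.
move=> Gid Gc Gi Gcts po ps pe pf; split => //.
  by apply/continuousP => U /po.
move=> U oU; apply/po.
have -> : p @^-1` (p @` U) = \bigcup_(g in G) (g @^-1` U).
  rewrite eqEsubset; split=> x /=.
    by move=> [u Uu /esym/pe [g Gg gE]]; exists g => //=; rewrite -gE.
  by move=> [g Gg Ugx]; exists (g x) => //; apply/esym/pe; exists g.
by apply: bigcup_open => g Gg; apply: open_comp => // x _; exact: Gcts.
Qed.

Hypothesis gc : gcover G p.

Lemma gc_quot (U : set Y) : open U <-> open (p @^-1` U).
Proof.
split=> [oU|oU]; first by apply: open_comp => // x _; exact: (gc_pcts gc).
have -> : U = p @` (p @^-1` U).
  rewrite eqEsubset; split=> [y Uy|y [x Ux <-] //].
  by have [x xy] := gc_surj gc y; exists x => //=; rewrite xy.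
exact: (gc_open gc).
Qed.

Lemma gc_factor (Z : topologicalType) (h : Y -> Z) : continuous (h \o p) -> continuous h.
Proof.
move=> /continuousP c; apply/continuousP => U oU; apply/gc_quot.
exact: c.
Qed.

Lemma gcover_homeo (Z : topologicalType) (h : Y -> Z) (k : Z -> Y) :
  continuous h -> continuous k -> cancel h k -> cancel k h -> gcover G (h \o p).
Proof.
move=> ch ck hk kh; split; try by case: gc.
- by move=> x; apply: continuous_comp; [exact: (gc_pcts gc)|exact: ch].
- move=> U oU.
  have -> : (h \o p) @` U = k @^-1` (p @` U).
    rewrite eqEsubset; split=> [z [x Ux <-]|z [x Ux xz]] /=.
      by rewrite hk; exists x.
    by exists x => //=; rewrite xz kh.
  by apply: open_comp; [move=> x _; exact: ck|exact: (gc_open gc)].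
- by move=> z; have [x xk] := gc_surj gc (k z); exists x; rewrite /= xk kh.
- move=> x x' /=; split=> [/(can_inj hk)/(gc_eq gc)//|/(gc_eq gc) -> //].
Qed.

Lemma gcover_conj (X' : topologicalType) (F : X' -> X) (F' : X -> X') :
  continuous F -> continuous F' -> cancel F F' -> cancel F' F ->
  gcover [set g' | exists2 g, G g & g' = F' \o g \o F] (p \o F).
Proof.
move=> cF cF' FK F'K; split.
- by exists id; [exact: (gc_id gc)|apply/funext => x /=; rewrite FK].
- move=> _ _ [g Gg ->] [h Gh ->]; exists (g \o h); first exact: (gc_comp gc).
  by apply/funext => x /=; rewrite F'K.
- move=> _ [g Gg ->]; have [h Gh [gK hK]] := gc_inv gc Gg.
  exists (F' \o h \o F); first by exists h.
  by split=> x /=; rewrite F'K ?gK ?hK FK.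
- move=> _ [g Gg ->] x; apply: continuous_comp; first exact: cF.
  by apply: continuous_comp; [exact: (gc_cts gc)|exact: cF'].
- by move=> x; apply: continuous_comp; [exact: cF|exact: (gc_pcts gc)].
- move=> U oU; have -> : (p \o F) @` U = p @` (F' @^-1` U).
    rewrite eqEsubset; split=> [z [x Ux <-]|z [x Ux xz]] /=.
      by exists (F x) => //=; rewrite FK.
    by exists (F' x) => //=; rewrite F'K.
  by apply: (gc_open gc); apply: open_comp => // x _; exact: cF'.
- by move=> y; have [x xy] := gc_surj gc y; exists (F' x); rewrite /= F'K.
- move=> x x' /=; split=> [/(gc_eq gc) [g Gg gE]|[_ [g Gg ->] ->]].
    by exists (F' \o g \o F); [exists g|rewrite /= -gE FK].
  by apply/(gc_eq gc); exists g => //=; rewrite F'K.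
- move=> x; have [W Wx WG] := gc_free gc (F x).
  exists (F @^-1` W); first exact: cF.
  move=> _ a [g Gg ->] /= Wa Wga; rewrite F'K in Wga.
  by rewrite (WG g (F a)) //; apply/funext => z /=; rewrite FK.
Qed.

End GcoverBuild.

Lemma gcover_homeomorphic (X X' Y Y' : topologicalType) G G' (p : X -> Y) (p' : X' -> Y')
    (F : X -> X') (F' : X' -> X) :
  gcover G p -> gcover G' p' ->
  continuous F -> continuous F' -> cancel F F' -> cancel F' F ->
  (forall x y, p x = p y <-> p' (F x) = p' (F y)) -> homeomorphic Y Y'.
Proof.
move=> gc gc' cF cF' FK F'K e.
have /choice [s sP] := gc_surj gc; have /choice [s' s'P] := gc_surj gc'.
have fE x : p' (F (s (p x))) = p' (F x) by apply/e; rewrite sP.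
have gE x : p (F' (s' (p' x))) = p (F' x) by apply/e; rewrite !F'K s'P.
exists (fun y => p' (F (s y))), (fun y => p (F' (s' y))); split.
- apply: (gc_factor gc); rewrite (_ : _ \o _ = p' \o F); last by apply/funext => x /=.
  by move=> x; apply: continuous_comp; [exact: cF|exact: (gc_pcts gc')].
- apply: (gc_factor gc'); rewrite (_ : _ \o _ = p \o F'); last by apply/funext => x /=.
  by move=> x; apply: continuous_comp; [exact: cF'|exact: (gc_pcts gc)].
- by move=> y; rewrite gE FK sP.
- by move=> y; rewrite fE F'K s'P.
Qed.

Section Zpow.
Variables (T : Type) (f f' : T -> T).
Hypotheses (fK : cancel f f') (f'K : cancel f' f).

Definition zpow (k : int) : T -> T :=
  match k with Posz n => iter n f | Negz n => iter n.+1 f' end.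

Lemma zpow_succ k x : zpow (k + 1) x = f (zpow k x).
Proof.
case: k => [n|[|n]]; first by rewrite -PoszD addn1.
  by rewrite NegzE addNr /= f'K.
by rewrite (_ : Negz n.+1 + 1 = Negz n) /= ?f'K //; lia.
Qed.

Lemma zpow_pred k x : zpow (k - 1) x = f' (zpow k x).
Proof. by rewrite -{2}[k](subrK 1) zpow_succ fK. Qed.

Lemma int_step_ind (P : int -> Prop) : P 0 -> (forall k, P k -> P (k + 1)) ->
  (forall k, P k -> P (k - 1)) -> forall k, P k.
Proof.
move=> P0 Ps Pp; elim/int_ind => // n h; first by rewrite intS addrC; exact: Ps.
by rewrite intS opprD addrC; exact: Pp.
Qed.

Lemma zpowD k l x : zpow (k + l) x = zpow k (zpow l x).
Proof.
elim/int_step_ind: k => [|k IH|k IH]; first by rewrite add0r.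
  by rewrite addrAC !zpow_succ IH.
by rewrite addrAC !zpow_pred IH.
Qed.

Lemma zpowNK k x : zpow (- k) (zpow k x) = x.
Proof. by rewrite -zpowD addNr. Qed.

Lemma zpowKN k x : zpow k (zpow (- k) x) = x.
Proof. by rewrite -zpowD subrr. Qed.

End Zpow.

Lemma zpow_continuous (T : topologicalType) (f f' : T -> T) k :
  continuous f -> continuous f' -> continuous (zpow f f' k).
Proof.
move=> cf cf'.
have it (h : T -> T) n : continuous h -> continuous (iter n h).
  move=> ch; elim: n => [|n IH] x; first exact: cvg_id.
  by apply: (@continuous_comp _ _ _ (iter n h) h); [exact: IH|exact: ch].
by case: k => n; exact: it.
Qed.

Section Lattice.
Variable R : realType.
Local Notation lat := (map_mx (intr : int -> R)).
Local Notation V := 'rV[R]_2.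
Local Notation q := (@torus_proj R).

Definition ltrans (n : 'rV[int]_2) : V -> V := fun v => v + lat n.

Lemma latD (n m : 'rV[int]_2) : lat (n + m) = lat n + lat m.
Proof. by apply/matrixP => i j; rewrite !mxE intrD. Qed.

Lemma latN (n : 'rV[int]_2) : lat (- n) = - lat n.
Proof. by apply/matrixP => i j; rewrite !mxE intrN. Qed.

Lemma lat_mul (n : 'rV[int]_2) (A : 'M[int]_2) : lat (n *m A) = lat n *m lat A.
Proof. by rewrite map_mxM. Qed.

Lemma lat0 : lat (0 : 'rV[int]_2) = 0.
Proof. by apply/matrixP => i j; rewrite !mxE. Qed.

Lemma lat_inj : injective (lat : 'rV[int]_2 -> V).
Proof.
by move=> n m /matrixP e; apply/matrixP => i j; have := e i j; rewrite !mxE => /intr_inj.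
Qed.

Lemma lat_small (n : 'rV[int]_2) (v : V) :
  (forall i, `|v 0 i + lat n 0 i - v 0 i| < 1) -> n = 0.
Proof.
move=> h; apply/matrixP => i j; rewrite (ord1 i) mxE; have := h j.
rewrite addrAC subrr add0r mxE -intr_norm -[1]/(1%:~R) ltr_int => h2.
by apply/eqP; rewrite -normr_eq0; lia.
Qed.

Lemma torus_proj_eq v w : q v = q w <-> exists n, w = v + lat n.
Proof.
split=> [/quotient_proj_eq|[n ->]]; last first.
  by apply/quotient_proj_eq; apply: rst_step; exists n.
elim=> {v w} [v w [n ->]|v|v w _ [n ->]|u v w _ [n ->] _ [m ->]].
- by exists n.
- by exists 0; rewrite lat0 addr0.
- by exists (- n); rewrite latN addrK.
- by exists (n + m); rewrite latD addrA.
Qed.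

Lemma ltrans_continuous n : continuous (ltrans n).
Proof. exact: (@addr_continuous R V (lat n)). Qed.

Lemma mx_ballE n (v w : 'rV[R]_n) e i : ball v e w -> `|v 0 i - w 0 i| < e.
Proof. by move=> h; have := h.2 0 i; rewrite /ball /= /ball_. Qed.

Lemma torus_gcover : gcover (range ltrans) q.
Proof.
apply: gcover_quot.
- by exists 0 => //; apply/funext => v; rewrite /ltrans lat0 addr0.
- move=> _ _ [n _ <-] [m _ <-]; exists (m + n) => //.
  by apply/funext => v; rewrite /ltrans /= latD addrA.
- move=> _ [n _ <-]; exists (ltrans (- n)); first by exists (- n).
  by split=> v; rewrite /ltrans latN ?addrK ?subrK.
- by move=> _ [n _ <-]; exact: ltrans_continuous.
- by move=> U; exact: quotient_proj_open.
- exact: quotient_proj_surj.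
- move=> v w; rewrite torus_proj_eq; split=> [[n ->]|[_ [n _ <-] ->]].
    by exists (ltrans n) => //; exists n.
  by exists n.
(* Two points of a ball of radius $1/2$ differ by less than 1 in each coordinate, and a nonzero
   lattice vector does not. *)
- move=> v; exists (ball v (2^-1)); first by apply: nbhsx_ballx; rewrite invr_gt0.
  move=> _ a [n _ <-] h1 h2; suff -> : n = 0.
    by apply/funext => x; rewrite /ltrans lat0 addr0.
  apply: (@lat_small n a) => i.
  have := mx_ballE i h1; have := mx_ballE i h2.
  rewrite /ltrans [(a + _) 0 i]mxE.
  set x := v 0 i; set y := a 0 i; set z := lat n 0 i.
  rewrite !ltr_norml => /andP[? ?] /andP[? ?]; apply/andP; split; lra.
Qed.

End Lattice.

Section MappingTorusCover.
Variable R : realType.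
Local Notation lat := (map_mx (intr : int -> R)).
Local Notation V := 'rV[R]_2.
Local Notation q := (@torus_proj R).
Variables (f f' : V -> V) (A A' : 'M[int]_2) (phi phi' : torus R -> torus R).

(** Lifts of a homeomorphism of the torus and of its inverse to the plane. [A] multiplies row
    vectors on the right, so it is the transpose of the matrix that represents [phi]. *)
Record torus_lift : Prop := TorusLift {
  tl_cts : continuous f;
  tl_cts' : continuous f';
  tl_K : cancel f f';
  tl_K' : cancel f' f;
  tl_lat : forall v n, f (v + lat n) = f v + lat (n *m A);
  tl_lat' : forall v n, f' (v + lat n) = f' v + lat (n *m A');
  tl_A : A *m A' = 1%:M;
  tl_A' : A' *m A = 1%:M;
  tl_phi : forall v, q (f v) = phi (q v);
  tl_phi' : forall v, q (f' v) = phi' (q v) }.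

Hypothesis tl : torus_lift.
Local Notation XX := (V * R^o)%type.

(** The group is $\mathbb Z^2\rtimes_A\mathbb Z$. The height drops by [k] because $(x,t+1)$ is glued
    to $(\phi(x),t)$. *)
Definition mt_deck (nk : 'rV[int]_2 * int) : XX -> XX :=
  fun x => (zpow f f' nk.2 x.1 + lat nk.1, x.2 - nk.2%:~R).

Definition mt_proj (x : XX) : mapping_torus phi :=
  quotient_proj (mapping_torus_rel phi) (q x.1, x.2 : R).

Let zA := zpow (mulmx^~ A : 'rV[int]_2 -> 'rV[int]_2) (mulmx^~ A').

Let AK : cancel (mulmx^~ A : 'rV[int]_2 -> 'rV[int]_2) (mulmx^~ A').
Proof. by move=> n; rewrite -mulmxA tl_A // mulmx1. Qed.

Let A'K : cancel (mulmx^~ A' : 'rV[int]_2 -> 'rV[int]_2) (mulmx^~ A).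
Proof. by move=> n; rewrite -mulmxA tl_A' // mulmx1. Qed.

Lemma zpow_lat k v n : zpow f f' k (v + lat n) = zpow f f' k v + lat (zA k n).
Proof.
have [K K'] := (tl_K tl, tl_K' tl).
elim/int_step_ind: k => [//|k IH|k IH]; rewrite /zA.
  by rewrite !zpow_succ // IH tl_lat.
by rewrite !zpow_pred // IH tl_lat'.
Qed.

Lemma mt_deckD n k m l :
  mt_deck (n, k) \o mt_deck (m, l) = mt_deck (n + zA k m, k + l).
Proof.
have [K K'] := (tl_K tl, tl_K' tl).
apply/funext => -[v s]; rewrite /mt_deck /=; congr pair.
  by rewrite zpow_lat zpowD // latD addrA addrAC.
by rewrite intrD opprD addrA addrAC.
Qed.

Lemma mt_deck_id : mt_deck (0, 0) = id.
Proof. by apply/funext => -[v s]; rewrite /mt_deck /= lat0 addr0 subr0. Qed.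

Let phiK : cancel phi phi'.
Proof.
move=> x; have [v <-] := gc_surj (torus_gcover R) x.
by rewrite -(tl_phi tl) -(tl_phi' tl) (tl_K tl).
Qed.

Let phi'K : cancel phi' phi.
Proof.
move=> x; have [v <-] := gc_surj (torus_gcover R) x.
by rewrite -(tl_phi' tl) -(tl_phi tl) (tl_K' tl).
Qed.

Lemma zpow_phi k v : q (zpow f f' k v) = zpow phi phi' k (q v).
Proof.
have [K K'] := (tl_K tl, tl_K' tl).
elim/int_step_ind: k => [//|k IH|k IH].
  by rewrite !zpow_succ // (tl_phi tl) IH.
by rewrite !zpow_pred // (tl_phi' tl) IH.
Qed.

Lemma mt_relP (a b : torus R * R) :
  clos_refl_sym_trans _ (mapping_torus_rel phi) a b <->
  exists k : int, b = (zpow phi phi' k a.1, a.2 - k%:~R).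
Proof.
split.
- elim=> {a b} [[x s] [y t] [/= -> ->]|[x s]|[x s] [y t] _ [k [-> ->]]|
      [x s] [y t] [z u] _ [k [-> ->]] _ [l [-> ->]]].
  + by exists 1; rewrite /= addrK.
  + by exists 0; rewrite subr0.
  + by exists (- k); rewrite /= zpowNK // mulrNz opprK subrK.
  + by exists (l + k); rewrite /= zpowD // intrD opprD addrA addrAC.
- case: a => x s [k ->] /=; elim/int_step_ind: k => [|k IH|k IH].
  + by rewrite subr0; exact: rst_refl.
  + apply: (rst_trans _ _ _ _ _ IH); apply: rst_step; split => /=.
      by rewrite intrD opprD addrA subrK.
    by rewrite zpow_succ.
  + apply: (rst_trans _ _ _ _ _ IH); apply: rst_sym; apply: rst_step; split => /=.
      by rewrite intrD opprD opprK addrA.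
    by rewrite zpow_pred // phi'K.
Qed.

Lemma mt_proj_eq x y : mt_proj x = mt_proj y <-> exists nk, y = mt_deck nk x.
Proof.
rewrite /mt_proj quotient_proj_eq mt_relP; case: x y => [v s] [w t] /=; split.
  move=> [k [e ->]]; move: e; rewrite -zpow_phi => /esym/torus_proj_eq [n ->].
  by exists (n, k).
move=> [[n k] [-> ->]]; exists k; rewrite -zpow_phi; congr pair.
by apply/esym/torus_proj_eq; exists n.
Qed.

Lemma mt_gcover : gcover (range mt_deck) mt_proj.
Proof.
have [K K'] := (tl_K tl, tl_K' tl).
have cq := gc_pcts (torus_gcover R).
pose qi (x : XX) : torus R * R := (q x.1, x.2).
have cqi : continuous qi.
  apply: cvg_pairT => z; last exact: cvg_snd.
  by apply: continuous_comp; [exact: cvg_fst|exact: cq].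
apply: gcover_quot.
- by exists (0, 0) => //; exact: mt_deck_id.
- move=> _ _ [[n k] _ <-] [[m l] _ <-]; exists (n + zA k m, k + l) => //.
  by rewrite mt_deckD.
- move=> _ [[n k] _ <-]; exists (mt_deck (- zA (- k) n, - k)).
    by exists (- zA (- k) n, - k).
  have zAN j m : zA j (- m) = - zA j m.
    by rewrite /zA; elim/int_step_ind: j => [//|j IH|j IH];
      rewrite ?zpow_succ ?zpow_pred // IH mulNmx.
  split=> x.
    by rewrite -[LHS]/((_ \o _) x) mt_deckD addNr addNr mt_deck_id.
  by rewrite -[LHS]/((_ \o _) x) mt_deckD zAN /zA zpowKN // !subrr mt_deck_id.
- move=> _ [[n k] _ <-]; apply: cvg_pairT => z.
    apply: cvgD; last exact: cvg_cst.
    apply: (@continuous_comp _ _ _ fst (zpow f f' k)); first exact: cvg_fst.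
    by apply: zpow_continuous; [exact: (tl_cts tl)|exact: (tl_cts' tl)].
  by apply: cvgB; [exact: cvg_snd|exact: cvg_cst].
- move=> U; rewrite quotient_proj_open; split=> oU.
    rewrite (_ : _ @^-1` _ = qi @^-1` (quotient_proj (mapping_torus_rel phi) @^-1` U)) //.
    by apply: open_comp => // x _; exact: cqi.
  (* The product of the open map [torus_proj] with the identity is open, so a product neighbourhood
     upstairs descends to one in the torus times the line. *)
  rewrite openE => -[x s] /= Us; have [v vx] := gc_surj (torus_gcover R) x.
  have : nbhs (v, s : R^o) (mt_proj @^-1` U).
    by apply: open_nbhs_nbhs; split => //; rewrite /= /mt_proj /= vx.
  move=> [[/= P Q] [Pv Qs] PQ]; exists (q @` P, Q).
    split => //=; rewrite -vx; have := gc_nbhs (torus_gcover R) Pv; exact.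
  by move=> [x' s'] /= [[v' Pv' <-] Qs']; exact: (PQ (v', s')).
- move=> y; have [[x s] <-] := quotient_proj_surj y.
  by have [v <-] := gc_surj (torus_gcover R) x; exists (v, s).
- move=> x y; rewrite mt_proj_eq; split=> [[nk ->]|[_ [nk _ <-] ->]].
    by exists (mt_deck nk) => //; exists nk.
  by exists nk.
- move=> [v s]; exists (ball v (2^-1) `*` ball s (2^-1)).
    by exists (ball v 2^-1, ball s 2^-1) => //; split; apply: nbhsx_ballx; rewrite invr_gt0.
  move=> _ [w t] [[n k] _ <-] [/= h1 h2] [/= h3 h4].
  have k0 : k = 0.
    have : `|k%:~R| < (1 : R).
      move: h2 h4; rewrite /ball /= !ltr_norml => /andP[? ?] /andP[? ?]; apply/andP; split; lra.
    by rewrite -intr_norm -[1]/(1%:~R) ltr_int => h; apply/eqP; rewrite -normr_eq0; lia.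
  rewrite k0 /= in h3 *; suff -> : n = 0 by exact: mt_deck_id.
  apply: (@lat_small R n w) => i.
  have := mx_ballE i h1; have := mx_ballE i h3.
  rewrite [(w + _) 0 i]mxE.
  set x := v 0 i; set y := w 0 i; set z := lat n 0 i.
  rewrite !ltr_norml => /andP[? ?] /andP[? ?]; apply/andP; split; lra.
Qed.

End MappingTorusCover.

(** * SU(2)-representations of mapping tori *)

Section MappingTorusReps.
Variable R : realType.
Local Notation lat := (map_mx (intr : int -> R)).
Local Notation V := 'rV[R]_2.
Local Notation XX := (V * R^o)%type.
Variables (f f' : V -> V) (A A' : 'M[int]_2) (phi phi' : torus R -> torus R).
Hypothesis tl : torus_lift f f' A A' phi phi'.
Local Notation deck := (mt_deck f f').
Local Notation zA := (zpow (mulmx^~ A : 'rV[int]_2 -> 'rV[int]_2) (mulmx^~ A')).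

Let AK : cancel (mulmx^~ A : 'rV[int]_2 -> 'rV[int]_2) (mulmx^~ A').
Proof. by move=> n; rewrite -mulmxA (tl_A tl) mulmx1. Qed.

Let A'K : cancel (mulmx^~ A' : 'rV[int]_2 -> 'rV[int]_2) (mulmx^~ A).
Proof. by move=> n; rewrite -mulmxA (tl_A' tl) mulmx1. Qed.

Lemma mt_deck_split n k : deck (n, k) = deck (n, 0) \o deck (0, k).
Proof. by rewrite (mt_deckD tl) /= addr0 add0r. Qed.

Lemma mt_deck_conj n : deck (0, 1) \o deck (n, 0) = deck (n *m A, 0) \o deck (0, 1).
Proof. by rewrite !(mt_deckD tl) /= !(addr0, add0r). Qed.

Section Hom.
Variable r : (XX -> XX) -> 'M[R[i]]_2.
Hypothesis rhom : SU2_hom (range deck) r.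
Let rg n : in_SU2 (r (deck n)). Proof. by apply: rhom.1; exists n. Qed.
Let rM n m : r (deck n \o deck m) = r (deck n) *m r (deck m).
Proof. by apply: rhom.2; [exists n|exists m]. Qed.

Lemma mt_hom_mul n m : r (deck (n, 0)) *m r (deck (m, 0)) = r (deck (n + m, 0)).
Proof. by rewrite -rM (mt_deckD tl) /= addr0. Qed.

Lemma mt_hom_comm B :
  (forall n, B *m r (deck (n, 0)) = r (deck (n, 0)) *m B) ->
  B *m r (deck (0, 1)) = r (deck (0, 1)) *m B ->
  forall nk, B *m r (deck nk) = r (deck nk) *m B.
Proof.
move=> Bn BT [n k]; rewrite mt_deck_split rM mulmxA Bn -!mulmxA; congr (_ *m _).
have step j : r (deck (0, j + 1)) = r (deck (0, 1)) *m r (deck (0, j)).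
  by rewrite -rM (mt_deckD tl) /= mul0mx add0r addrC.
elim/int_step_ind: k => [|k IH|k IH]; first exact: Bn.
  by rewrite step mulmxA BT -!mulmxA IH.
have := step (k - 1); rewrite subrK => E.
have U : r (deck (0, 1)) \in unitmx by rewrite unitmxE (rg _).2 unitr1.
apply: (can_inj (mulKmx U)); rewrite [LHS]mulmxA -BT -mulmxA -E IH E.
by rewrite -!mulmxA.
Qed.

Lemma mt_hom_abelian N : N *m (A + 1%:M) = 2%:M ->
  forall n m, r (deck n) *m r (deck m) = r (deck m) *m r (deck n).
Proof.
move=> NA.
have TC n : r (deck (0, 1)) *m r (deck (n, 0)) = r (deck (n, 0)) *m r (deck (0, 1)).
  apply: (@SU2_solvable_abelian _ (fun n => r (deck (n, 0))) (r (deck (0, 1))) A N) => //.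
  - by move=> a b; rewrite mt_hom_mul.
  - by move=> a; rewrite -!rM mt_deck_conj.
have TT nk : r (deck (0, 1)) *m r (deck nk) = r (deck nk) *m r (deck (0, 1)).
  exact: mt_hom_comm.
have nn m nk : r (deck (m, 0)) *m r (deck nk) = r (deck nk) *m r (deck (m, 0)).
  by apply: mt_hom_comm => // n; rewrite !mt_hom_mul addrC.
by move=> n m; apply: mt_hom_comm => // a; rewrite nn.
Qed.

End Hom.

Lemma mt_SU2_abelian N : N *m (A + 1%:M) = 2%:M -> SU2_abelian R (mapping_torus phi).
Proof.
move=> NA; apply/(SU2_abelianP (mt_gcover tl)) => r rhom _ _ [n _ <-] [m _ <-].
exact: (mt_hom_abelian rhom NA).
Qed.

Lemma mt_deck_inj : injective deck.
Proof.
move=> [n k] [m l] /(congr1 (fun g => g (0, 0))); rewrite /mt_deck /= => -[e1 e2].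
have kl : k = l by move: e2; rewrite !sub0r => /oppr_inj /intr_inj.
by move: e1; rewrite kl => /addrI /lat_inj ->.
Qed.

Lemma mt_dec : exists dec : (XX -> XX) -> 'rV[int]_2 * int, forall nk, dec (deck nk) = nk.
Proof.
have /choice [dec decP] : forall g : XX -> XX, exists nk, range deck g -> g = deck nk.
  move=> g; have [[nk _ e]|n] := pselect (range deck g); first by exists nk.
  by exists (0, 0).
by exists dec => nk; apply: mt_deck_inj; rewrite -decP //; exists nk.
Qed.

End MappingTorusReps.

Lemma sin_int_pi (R : realType) (k : int) : sin (pi * k%:~R) = 0 :> R.
Proof.
elim/int_step_ind: k => [|k IH|k IH]; first by rewrite mulr0 sin0.
  by rewrite intrD mulrDr mulr1 sinDpi IH oppr0.
by apply: oppr_inj; rewrite -sinDpi oppr0 -{2}[pi]mulr1 -mulrDr intrB subrK.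
Qed.

Lemma sin_pi_int (R : realType) (x : R) : sin (pi * x) = 0 -> exists k : int, x = k%:~R.
Proof.
move=> s0; exists (Num.floor x).
pose y := x - (Num.floor x)%:~R.
have y0 : 0 <= y by rewrite subr_ge0 floor_le_tmp.
have y1 : y < 1 by rewrite ltrBlDl -intrD1 floorD1_gt.
have sy : sin (pi * y) = 0 by rewrite mulrBr sinB s0 sin_int_pi mul0r mulr0 subr0.
apply/eqP; rewrite -subr_eq0 -/y; apply: contraT => yn.
have : 0 < sin (pi * y).
  apply: sin_gt0_pi; apply/andP; split.
    by rewrite mulr_gt0 ?pi_gt0 // lt_def yn.
  by rewrite -[ltRHS]mulr1 ltr_pM2l ?pi_gt0.
by rewrite sy ltxx.
Qed.

Definition oddi (k : int) : bool := (k %% 2)%Z == 1.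

Lemma oddiD k l : oddi (k + l) = oddi k (+) oddi l.
Proof.
rewrite /oddi; have := divz_eq k 2; have := divz_eq l 2; have := divz_eq (k + l) 2.
have := modz_ge0 k (isT : (2 : int) != 0); have := ltz_pmod k (isT : 0 < (2 : int)).
have := modz_ge0 l (isT : (2 : int) != 0); have := ltz_pmod l (isT : 0 < (2 : int)).
have := modz_ge0 (k + l) (isT : (2 : int) != 0); have := ltz_pmod (k + l) (isT : 0 < (2 : int)).
set a := (k %% 2)%Z; set b := (l %% 2)%Z; set c := ((k + l) %% 2)%Z.
by have [?|?] := eqVneq a 1; have [?|?] := eqVneq b 1; have [?|?] := eqVneq c 1 => //=; lia.
Qed.

Lemma halfiD k l : ((k + l) %/ 2)%Z = (k %/ 2)%Z + (l %/ 2)%Z + (oddi k && oddi l).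
Proof.
rewrite /oddi; have := divz_eq k 2; have := divz_eq l 2; have := divz_eq (k + l) 2.
have := modz_ge0 k (isT : (2 : int) != 0); have := ltz_pmod k (isT : 0 < (2 : int)).
have := modz_ge0 l (isT : (2 : int) != 0); have := ltz_pmod l (isT : 0 < (2 : int)).
have := modz_ge0 (k + l) (isT : (2 : int) != 0); have := ltz_pmod (k + l) (isT : 0 < (2 : int)).
set a := (k %% 2)%Z; set b := (l %% 2)%Z; set c := ((k + l) %% 2)%Z.
by have [?|?] := eqVneq a 1; have [?|?] := eqVneq b 1 => /=; lia.
Qed.

Section MappingTorusReps2.
Variable R : realType.
Local Notation lat := (map_mx (intr : int -> R)).
Local Notation V := 'rV[R]_2.
Local Notation XX := (V * R^o)%type.
Variables (f f' : V -> V) (A A' : 'M[int]_2) (phi phi' : torus R -> torus R).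
Hypothesis tl : torus_lift f f' A A' phi phi'.
Local Notation deck := (mt_deck f f').
Local Notation zA := (zpow (mulmx^~ A : 'rV[int]_2 -> 'rV[int]_2) (mulmx^~ A')).

Let AK : cancel (mulmx^~ A : 'rV[int]_2 -> 'rV[int]_2) (mulmx^~ A').
Proof. by move=> n; rewrite -mulmxA (tl_A tl) mulmx1. Qed.

Let A'K : cancel (mulmx^~ A' : 'rV[int]_2 -> 'rV[int]_2) (mulmx^~ A).
Proof. by move=> n; rewrite -mulmxA (tl_A' tl) mulmx1. Qed.

(** The sign $-1$, [e] being true, serves the dihedral representations of [mt_not_abelian]; the sign
    1 serves the invariant characters of [mt_rank2]. *)
Lemma zpow_char (ell : 'rV[int]_2 -> R) (e : bool) :
  (forall n, exists j : int, ell (n *m A) = (-1) ^+ e * ell n + j%:~R) ->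
  forall k n, exists j : int, ell (zA k n) = (-1) ^+ (e && oddi k) * ell n + j%:~R.
Proof.
move=> h; elim/int_step_ind => [|k IH|k IH] n.
- by exists 0; rewrite andbF expr0 mul1r addr0.
- rewrite zpow_succ //; have [j ->] := h (zA k n); have [i ->] := IH n.
  exists ((-1) ^+ e * i + j); rewrite oddiD intrD intrM rmorphXn /= intrN.
  by case: (e); case: (oddi k); rewrite /= ?expr1 ?expr0; ring.
- rewrite zpow_pred //; have := h (zA k n *m A'); rewrite A'K => -[j].
  have [i ->] := IH n => E.
  exists ((-1) ^+ e * (i - j)).
  have -> : ell (zA k n *m A') = (-1) ^+ e * ((-1) ^+ (e && oddi k) * ell n + i%:~R - j%:~R).
    by rewrite E addrK mulrA -exprD addnn -mul2n exprM sqrrN !expr1n mul1r.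
  rewrite oddiD intrM rmorphXn /= intrN intrB.
  by case: (e); case: (oddi k); rewrite /= ?expr1 ?expr0; ring.
Qed.

(** Modulo 1, [ell] is a character inverted by [A]. It gives a dihedral representation with
    rotations by [2 * pi * ell n] on the lattice and a flip for the generator of $\mathbb Z$.
    Commutation forces the sine of the angle of [n0] to vanish. *)
Lemma mt_not_abelian (ell : 'rV[int]_2 -> R) n0 :
  (forall n m, ell (n + m) = ell n + ell m) ->
  (forall n, exists j : int, ell (n *m A) + ell n = j%:~R) ->
  SU2_abelian R (mapping_torus phi) -> exists j : int, 2 * ell n0 = j%:~R.
Proof.
move=> ellD ellA ab; apply: sin_pi_int; rewrite mulrA [pi * 2]mulrC.
apply/eqP; apply: contraT => sn; have [dec decE] := mt_dec f f'.
pose s (g : XX -> XX) := oddi (dec g).2.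
(* The $k$-th power of the flip is the rotation by $\pi\lfloor k/2\rfloor$, followed by a flip if
   $k$ is odd. *)
pose th (g : XX -> XX) := 2 * pi * ell (dec g).1 + pi * ((dec g).2 %/ 2)%Z%:~R.
have h2 : forall n, exists j : int, ell (n *m A) = (-1) ^+ true * ell n + j%:~R.
  by move=> n; have [j e] := ellA n; exists j; rewrite -e expr1; ring.
have [|||||||r rh nc] := @dihedral_nonabelian R XX (range deck) s th (deck (n0, 0)) (deck (0, 1)).
- move=> _ _ [[n k] _ <-] [[m l] _ <-].
  by rewrite /s (mt_deckD tl) !decE /= oddiD.
- move=> _ _ [[n k] _ <-] [[m l] _ <-]; rewrite /th /s (mt_deckD tl) !decE /=.
  rewrite ellD; have [j ->] := zpow_char h2 k m; rewrite /= halfiD.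
  exists (j + (l %/ 2)%Z * oddi k); rewrite !intrD intrM.
  by case: (oddi k); case: (oddi l); rewrite /= ?expr1 ?expr0; ring.
- by exists (n0, 0).
- by exists (0, 1).
- by rewrite /s decE.
- by rewrite /s decE.
- by rewrite /th decE /= div0z mulr0 addr0.
case: nc; have /(SU2_abelianP (mt_gcover tl)) abr := ab.
by apply: abr; [|exists (n0, 0)|exists (0, 1)].
Qed.

(** The coordinates of $n(A+1)^{-1}$ are inverted by [A] modulo 1, since applying them to $n(A+1)$
    gives the coordinates of [n]. So their doubles are integers, and $2(A+1)^{-1}$ is the required
    matrix. *)
Lemma mt_abelian_coker : \det (A + 1%:M) != 0 -> SU2_abelian R (mapping_torus phi) ->
  exists N : 'M[int]_2, N *m (A + 1%:M) = 2%:M.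
Proof.
move=> dn ab; pose B : 'M[R]_2 := invmx (lat (A + 1%:M)).
have Bu : lat (A + 1%:M) \in unitmx.
  by rewrite unitmxE det_map_mx unitfE intr_eq0.
have key (n : 'rV[int]_2) j : exists i : int, 2 * (lat n *m B) 0 j = i%:~R.
  apply: (@mt_not_abelian (fun n => (lat n *m B) 0 j)) => //.
    by move=> a b; rewrite latD mulmxDl mxE.
  move=> m; exists (m 0 j); transitivity ((lat (m *m (A + 1%:M)) *m B) 0 j).
    by rewrite mulmxDr mulmx1 latD mulmxDl [RHS]mxE.
  by rewrite lat_mul mulmxK // mxE.
have /choice [N NE] : forall ij : 'I_2 * 'I_2, exists z : int, 2 * B ij.1 ij.2 = z%:~R.
  move=> [i j] /=; have [z] := key (delta_mx 0 i) j.
  by rewrite map_delta_mx -rowE mxE; exists z.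
pose NN : 'M[int]_2 := \matrix_(i, j) N (i, j).
exists NN; have : lat (NN *m (A + 1%:M)) = lat 2%:M.
  rewrite map_mxM (_ : lat NN = 2 *: B); last first.
    by apply/matrixP => i j; rewrite !mxE -NE.
  by rewrite -scalemxAl mulVmx // map_scalar_mx scalemx1.
by move=> /matrixP e; apply/matrixP => i j; have := e i j; rewrite !mxE => /intr_inj.
Qed.

End MappingTorusReps2.

(** Whether [H_1(Y; Z/p)] has rank at least 2, for [p] an odd prime and an
    [SU(2)]-abelian [Y]. *)
Definition rep_rank2 (R : realType) (Y : topologicalType) (p : nat) : Prop :=
  exists y (rho1 rho2 : (R -> Y) -> 'M[R[i]]_2) c d,
  [/\ SU2_representation y rho1, SU2_representation y rho2, is_loop y c /\ is_loop y d,
      (forall e, is_loop y e -> rho1 e ^+ p = 1%:M /\ rho2 e ^+ p = 1%:M) &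
      [/\ rho1 c <> 1%:M, rho2 c = 1%:M & rho2 d <> 1%:M]].

Lemma within_comp (T U W : topologicalType) (A : set T) (f : T -> U) (g : U -> W) :
  {within A, continuous f} -> continuous g -> {within A, continuous (g \o f)}.
Proof.
move=> cf cg x; have := @continuous_comp (subspace A) U W f g x (cf x) (cg (f x)).
exact.
Qed.

Lemma rep_rank2_homeo (R : realType) (Y Z : topologicalType) p :
  homeomorphic Y Z -> rep_rank2 R Y p -> rep_rank2 R Z p.
Proof.
move=> [h [k [ch ck hk kh]]] [y [rho1 [rho2 [c [d [rep1 rep2 [lc ld] ex [n1 n2 n3]]]]]]].
have loopk e : is_loop (h y) e -> is_loop y (k \o e).
  by move=> [ce e0 e1]; split; [exact: within_comp|rewrite /= e0 hk|rewrite /= e1 hk].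
have looph e : is_loop y e -> is_loop (h y) (h \o e).
  by move=> [ce e0 e1]; split; [exact: within_comp|rewrite /= e0|rewrite /= e1].
have rep rho : SU2_representation y rho ->
    SU2_representation (h y) (fun e => rho (k \o e) : 'M[R[i]]_2).
  move=> [a b m]; split.
  - by move=> e /loopk /a.
  - move=> e e' /loopk le /loopk le' [H [cH H0 H1 He]]; apply: b => //.
    exists (k \o H); split.
    + exact: within_comp.
    + by move=> t /H0 /= ->.
    + by move=> t /H1 /= ->.
    + by move=> t /He [/= -> ->]; rewrite hk.
  - move=> e e' /loopk le /loopk le'; rewrite -m //; congr rho.
    by apply/funext => t; rewrite /= /loop_concat; case: ifP.
have kK e : k \o (h \o e) = e :> (R -> Y) by apply/funext => t /=; rewrite hk.
exists (h y), (fun e => rho1 (k \o e)), (fun e => rho2 (k \o e)), (h \o c), (h \o d).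
split; [exact: rep|exact: rep|by split; exact: looph| |by rewrite !kK].
by move=> e /loopk /ex.
Qed.

(** * Detecting the $p$-rank of the first homology *)

Section Rank.
Variable R : realType.
Local Notation M2 := 'M[R[i]]_2.

Section IntHom.
Variable tau : int -> M2.
Hypothesis tU : forall k, in_SU2 (tau k).
Hypothesis tD : forall k l, tau (k + l) = tau k *m tau l.

Lemma int_hom0 : tau 0 = 1%:M.
Proof.
have := tD 0 0; rewrite addr0 => /(congr1 (mulmx (invmx (tau 0)))).
by rewrite mulmxA SU2_mulVmx // mul1mx.
Qed.

Lemma int_homX (k : int) (n : nat) : tau (k * n%:Z) = tau k ^+ n.
Proof.
elim: n => [|n IH]; first by rewrite mulr0 int_hom0 expr0.
by rewrite -(addn1 n) PoszD mulrDr mulr1 tD IH addn1 exprSr.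
Qed.

Lemma int_hom_coprime (p : nat) (d : int) :
  (forall k, tau k ^+ p = 1%:M) -> coprimez d p -> tau d = 1%:M ->
  forall k, tau k = 1%:M.
Proof.
move=> tp cop td.
have tN k l : tau (k - l) = tau k *m invmx (tau l).
  have U : tau l \in unitmx by rewrite unitmxE (tU l).2 unitr1.
  by apply: (can_inj (mulmxK U)); rewrite mulmxKV // -tD subrK.
have t1 k u : tau k = 1%:M -> tau (u * k) = 1%:M.
  move=> tk; elim/int_step_ind: u => [|u IH|u IH]; first by rewrite mul0r int_hom0.
    by rewrite mulrDl mul1r tD IH tk mulmx1.
  by rewrite mulrBl mul1r tN IH tk invmx1 mulmx1.
move=> k; rewrite -[k]mulr1; apply: (t1).
have [u [v]] := Bezoutz d p; move: cop; rewrite /coprimez => /eqP -> <-.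
by rewrite tD (t1 d) // mul1mx int_homX tp.
Qed.

End IntHom.

Lemma rotmxX (t : R) n : rotmx t ^+ n = rotmx (t * n%:R).
Proof.
elim: n => [|n IH]; first by rewrite expr0 mulr0 rotmx0.
transitivity (rotmx (t * n%:R) *m rotmx t); first by rewrite exprSr IH.
by rewrite -rotmxD -(natr1 n) mulrDr mulr1.
Qed.

Lemma rotmx_neq1 (p : nat) : (2 < p)%N -> rotmx (2 * pi / p%:R) <> 1%:M :> M2.
Proof.
move=> p2 /matrixP/(_ 0 0); rewrite !mxE /= => -[_ s0].
have [k] : exists k : int, 2 / p%:R = k%:~R :> R.
  by apply: sin_pi_int; rewrite mulrA [pi * 2]mulrC.
have p0 : 0 < p%:R :> R by rewrite ltr0n; lia.
move=> e; have k0 : 0 < (k%:~R : R) by rewrite -e divr_gt0.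
have k1 : (k%:~R : R) < 1 by rewrite -e ltr_pdivrMr // mul1r ltr_nat.
by move: k0 k1; rewrite ltr0z -[1]/(1%:~R) ltr_int; lia.
Qed.

Local Notation lat := (map_mx (intr : int -> R)).
Local Notation V := 'rV[R]_2.
Local Notation XX := (V * R^o)%type.
Variables (f f' : V -> V) (A A' : 'M[int]_2) (phi phi' : torus R -> torus R).
Hypothesis tl : torus_lift f f' A A' phi phi'.
Local Notation deck := (mt_deck f f').

(** Modulo [p], the column [u] is fixed by [A], so $n\mapsto nu/p$ is an [A]-invariant character of
    the lattice and extends to the whole group. The second character is $k/p$ on the quotient
    $\mathbb Z$. The loops are the translation by [n0] and the generator of $\mathbb Z$. *)
Lemma mt_rank2 (p : nat) (u u' : 'cV[int]_2) (n0 : 'rV[int]_2) : (2 < p)%N ->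
  (A - 1%:M) *m u = p%:Z *: u' -> (n0 *m u) 0 0 = 1 -> rep_rank2 R (mapping_torus phi) p.
Proof.
move=> p2 Au n0u; have [dec decE] := mt_dec f f'.
pose ell (n : 'rV[int]_2) : R := ((n *m u) 0 0)%:~R / p%:R.
have pn : p%:R != 0 :> R by rewrite pnatr_eq0; lia.
have ellD n m : ell (n + m) = ell n + ell m by rewrite /ell mulmxDl mxE intrD mulrDl.
have h2 : forall n, exists j : int, ell (n *m A) = (-1) ^+ false * ell n + j%:~R.
  move=> n; exists ((n *m u') 0 0); rewrite expr0 mul1r.
  have -> : A = A - 1%:M + 1%:M by rewrite subrK.
  rewrite mulmxDr mulmx1 ellD addrC; congr (_ + _).
  by rewrite /ell -mulmxA Au -scalemxAr mxE intrM mulrC mulKf.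
pose r1 (g : XX -> XX) := rotmx (2 * pi * ell (dec g).1).
pose r2 (g : XX -> XX) : M2 := rotmx (2 * (pi : R) / p%:R * (dec g).2%:~R).
have h1 : SU2_hom (range deck) r1.
  split; first by move=> *; exact: rotmx_SU2.
  move=> _ _ [[n k] _ <-] [[m l] _ <-]; rewrite /r1 (mt_deckD tl) !decE /= -rotmxD.
  rewrite ellD; have [j ->] := zpow_char tl h2 k m; rewrite /= expr0 mul1r.
  by rewrite addrA mulrDr rotmx_2pi mulrDr.
have h3 : SU2_hom (range deck) r2.
  split; first by move=> *; exact: rotmx_SU2.
  move=> _ _ [[n k] _ <-] [[m l] _ <-]; rewrite /r2 (mt_deckD tl) !decE /= -rotmxD.
  by rewrite intrD mulrDr.
have gc := mt_gcover tl.
have [rho1 rep1 E1] := hom_to_rep gc 0 h1.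
have [rho2 rep2 E2] := hom_to_rep gc 0 h3.
have D n : range deck (deck n) by exists n.
have Hc := hol_line (mt_proj phi) 0 (D (n0, 0)); have Hd := hol_line (mt_proj phi) 0 (D (0, 1)).
exists (mt_proj phi 0), rho1, rho2; do 2 eexists; split => //.
- by split; [exact: (hol_loop gc (D _) Hc)|exact: (hol_loop gc (D _) Hd)].
- move=> e le; have [_ [[n k] _ <-] He] := hol_ex gc le.
  rewrite (E1 _ _ (D _) He) (E2 _ _ (D _) He) /r1 /r2 decE /= !rotmxX.
  split; rewrite -rotmx0.
    by rewrite -(rotmx_2pi ((n *m u) 0 0) 0) add0r /ell -!mulrA mulVf // mulr1.
  rewrite -(rotmx_2pi k 0) add0r -!mulrA; congr rotmx; congr (_ * (_ * _)).
  by rewrite mulrA mulrAC mulVf // mul1r.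
rewrite (E1 _ _ (D _) Hc) (E2 _ _ (D _) Hc) (E2 _ _ (D _) Hd) /r1 /r2 !decE /=.
split.
- by rewrite /ell n0u mul1r; exact: rotmx_neq1.
- by rewrite mulr0 rotmx0.
- by rewrite mulr1; exact: rotmx_neq1.
Qed.

(** The images are abelian by $N'(A+1)=2$, so a representation takes equal values at [n] and
    [n *m A], hence is trivial on $dn=nN(A-1)$. Being of exponent [p] prime to [d], it is trivial on
    the lattice and factors through $\mathbb Z$. There [rho2] kills [c] but not everything, so [p]
    divides the height of [c], and [rho1] kills [c] too. *)
Lemma mt_not_rank2 (p : nat) (d : int) (N N' : 'M[int]_2) : prime p ->
  N *m (A - 1%:M) = d%:M -> coprimez d p -> N' *m (A + 1%:M) = 2%:M ->
  ~ rep_rank2 R (mapping_torus phi) p.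
Proof.
move=> pp NA cop NA' [y [rho1 [rho2 [c [e [rep1 rep2 [lc le] ex [n1 n2 n3]]]]]]].
have gc := mt_gcover tl; have [x0 xy] := gc_surj gc y.
rewrite -xy in rep1 rep2 lc le ex.
have D n : range deck (deck n) by exists n.
have [r1 h1 E1] := rep_to_hom gc rep1; have [r2 h2 E2] := rep_to_hom gc rep2.
have rX r rho : (forall c g, range deck g -> Hol (mt_proj phi) x0 c g -> rho c = r g) ->
   (forall e, is_loop (mt_proj phi x0) e -> rho e ^+ p = 1%:M) ->
   forall n, r (deck n) ^+ p = 1%:M :> M2.
  move=> Er ep n; have Hn := hol_line (mt_proj phi) x0 (D n).
  by rewrite -(Er _ _ (D n) Hn); apply: ep; exact: (hol_loop gc (D n) Hn).
have X1 := rX _ _ E1 (fun e le => (ex e le).1).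
have X2 := rX _ _ E2 (fun e le => (ex e le).2).
have triv r : SU2_hom (range deck) r -> (forall n, r (deck n) ^+ p = 1%:M :> M2) ->
    forall n k, r (deck (n, k)) = r (deck (0, k)).
  move=> rh rp n k; rewrite (mt_deck_split tl) rh.2 //.
  suff -> : r (deck (n, 0)) = 1%:M by rewrite mul1mx.
  pose tau (j : int) := r (deck (n *~ j, 0)).
  have := @int_hom_coprime tau _ _ p d _ _ _ 1; rewrite /tau mulr1z; apply => //.
  - by move=> j; exact: rh.1.
  - by move=> j l; rewrite mulrzDr (mt_hom_mul tl rh).
  have inv m : r (deck (m *m A, 0)) = r (deck (m, 0)).
    have := mt_hom_abelian tl rh NA' (0, 1) (m, 0).
    rewrite -rh.2 // (mt_deck_conj tl) rh.2 //.
    have U : r (deck (0, 1)) \in unitmx by rewrite unitmxE (rh.1 _ (D _)).2 unitr1.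
    exact: (can_inj (mulmxK U)).
  have -> : n *~ d = n *m N *m A - n *m N.
    by rewrite -mulmxA -{2}[N]mulmx1 -mulmxBr -mulmxBr NA mul_mx_scalar -{2}[d]intz scaler_int.
  have := mt_hom_mul tl rh (n *m N *m A - n *m N) (n *m N).
  rewrite subrK inv.
  have U : r (deck (n *m N, 0)) \in unitmx by rewrite unitmxE (rh.1 _ (D _)).2 unitr1.
  by rewrite -{2}[r (deck (n *m N, 0))]mul1mx => /(can_inj (mulmxK U)).
have [_ [[n k] _ <-] Hc] := hol_ex gc lc.
have [_ [[m l] _ <-] He] := hol_ex gc le.
have tD r : SU2_hom (range deck) r ->
    forall i j, r (deck (0, i + j)) = r (deck (0, i)) *m r (deck (0, j)) :> M2.
  move=> rh i j; rewrite -rh.2 // (mt_deckD tl) /=; congr (r (deck (_, _))).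
  suff -> : zpow (mulmx^~ A : 'rV[int]_2 -> 'rV[int]_2) (mulmx^~ A') i 0 = 0 by rewrite addr0.
  elim/int_step_ind: i => [//|i IH|i IH].
    by rewrite zpow_succ ?IH ?mul0mx // => ?; rewrite -mulmxA ?(tl_A tl) ?(tl_A' tl) mulmx1.
  by rewrite zpow_pred ?IH ?mul0mx // => ?; rewrite -mulmxA ?(tl_A tl) ?(tl_A' tl) mulmx1.
move: n1 n2 n3; rewrite (E1 _ _ (D _) Hc) (E2 _ _ (D _) Hc) (E2 _ _ (D _) He).
rewrite !(triv _ h1) ?(triv _ h2) // => n1 n2 n3.
have [kp|kp] := boolP (coprimez k p).
  apply: n3; apply: (@int_hom_coprime (fun j => r2 (deck (0, j))) _ _ p k) => //.
  - by move=> ?; exact: h2.1.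
  - exact: tD.
have /dvdzP [j kE] : (p %| k)%Z.
  by move: kp; rewrite /coprimez /gcdz -[_ == 1 :> int]/(coprime _ _) coprime_sym prime_coprime // negbK.
apply: n1; rewrite kE (@int_homX (fun j => r1 (deck (0, j)))) //.
- by move=> ?; exact: h1.1.
- exact: tD.
Qed.

End Rank.

(** * Conjugacy of integer matrices *)

Lemma rV_continuous (R : realType) (T : topologicalType) n (f : T -> 'rV[R]_n) :
  (forall j, continuous (fun x => f x 0 j)) -> continuous f.
Proof.
move=> cf x; apply/cvg_ballP => e e0.
have : \forall y \near x, forall j, ball (f x 0 j) e (f y 0 j).
  by apply: filter_forall => j; exact: (cf j x _ (nbhsx_ballx _ _ e0)).
apply: filterS => y h; split=> // i j; rewrite (ord1 i); exact: h.
Qed.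

Lemma coord_cts (R : realType) n (j : 'I_n) : continuous (fun v : 'rV[R]_n => v 0 j).
Proof. exact: coord_continuous. Qed.

Lemma sum_cts (R : realType) (T : topologicalType) (I : Type) (r : seq I) (f : I -> T -> R) :
  (forall i, continuous (f i)) -> continuous (fun x => \sum_(i <- r) f i x).
Proof.
move=> cf; elim: r => [|i r IH] x.
  by rewrite (_ : (fun x => _) = cst 0); [exact: cvg_cst|apply/funext => y; rewrite big_nil].
rewrite (_ : (fun x => _) = (fun y => f i y + \sum_(i <- r) f i y)); last first.
  by apply/funext => y; rewrite big_cons.
by apply: cvgD; [exact: cf|exact: IH].
Qed.

Lemma mulr_cst_cts (R : realType) (T : topologicalType) (f : T -> R) c :
  continuous f -> continuous (fun x => f x * c).
Proof. by move=> cf x; apply: cvgM; [exact: cf|exact: cvg_cst]. Qed.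

Lemma mulmxr_continuous (R : realType) n m (B : 'M[R]_(n, m)) :
  continuous (fun v : 'rV[R]_n => v *m B).
Proof.
apply: rV_continuous => j.
rewrite (_ : (fun x => _) = (fun x : 'rV[R]_n => \sum_k x 0 k * B k j)); last first.
  by apply/funext => x; rewrite mxE.
by apply: sum_cts => k; apply: mulr_cst_cts; exact: coord_cts.
Qed.

(** * Mapping tori of linear maps *)

Section Linear.
Variable R : realType.
Local Notation lat := (map_mx (intr : int -> R)).
Local Notation V := 'rV[R]_2.

Definition linV (M : 'M[int]_2) (v : V) : V := v *m (lat M)^T.

Lemma linV_continuous M : continuous (linV M).
Proof. exact: mulmxr_continuous. Qed.

Lemma linVM M N v : linV M (linV N v) = linV (M *m N) v.
Proof. by rewrite /linV map_mxM trmx_mul mulmxA. Qed.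

Lemma linV1 v : linV 1%:M v = v.
Proof. by rewrite /linV map_mx1 trmx1 mulmx1. Qed.

Lemma linV_lat M v n : linV M (v + lat n) = linV M v + lat (n *m M^T).
Proof. by rewrite /linV mulmxDl lat_mul map_trmx. Qed.

Lemma linear_torus_mapE M v : torus_proj (linV M v) = linear_torus_map M (torus_proj v).
Proof.
apply/torus_proj_eq.
have /torus_proj_eq [n e] : torus_proj v = torus_proj (repr (torus_proj v)).
  by rewrite [RHS]reprK.
by exists (n *m M^T); rewrite -linV_lat -e.
Qed.

Lemma linear_torus_lift M M' : M *m M' = 1%:M ->
  torus_lift (linV M) (linV M') M^T M'^T (linear_torus_map M) (linear_torus_map M').
Proof.
move=> MM'; have M'M := mulmx1C MM'.
split; try exact: linV_continuous; try exact: linV_lat; try exact: linear_torus_mapE.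
- by move=> v; rewrite linVM M'M linV1.
- by move=> v; rewrite linVM MM' linV1.
- by rewrite -trmx_mul M'M trmx1.
- by rewrite -trmx_mul MM' trmx1.
Qed.

Lemma zpow_conj (T U : Type) (f f' : T -> T) (g g' : U -> U) (h : T -> U) k x :
  (forall x, h (f x) = g (h x)) -> (forall x, h (f' x) = g' (h x)) ->
  h (zpow f f' k x) = zpow g g' k (h x).
Proof.
move=> e e'; have it (a : T -> T) (b : U -> U) n : (forall x, h (a x) = b (h x)) ->
    h (iter n a x) = iter n b (h x).
  by move=> ab; elim: n => //= n IH; rewrite ab IH.
by case: k => n; exact: it.
Qed.

Lemma mt_linear_conj M M' P P' : M *m M' = 1%:M -> P *m P' = 1%:M ->
  homeomorphic (mapping_torus (@linear_torus_map R M))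
               (mapping_torus (@linear_torus_map R (P *m M *m P'))).
Proof.
move=> MM' PP'; have P'P := mulmx1C PP'.
pose N := P *m M *m P'; pose N' := P *m M' *m P'.
have NN' : N *m N' = 1%:M.
  by rewrite /N /N' -!mulmxA (mulmxA P' P) P'P mul1mx (mulmxA M) MM' mul1mx.
have tM := linear_torus_lift MM'; have tN := linear_torus_lift NN'.
pose F (Q : 'M[int]_2) (x : V * R^o) := (linV Q x.1, x.2).
have cF Q : continuous (F Q).
  apply: cvg_pairT => z; last exact: cvg_snd.
  by apply: (@continuous_comp _ _ _ fst (linV Q)); [exact: cvg_fst|exact: linV_continuous].
have FK Q Q' : Q' *m Q = 1%:M -> cancel (F Q) (F Q').
  by move=> e [v s]; rewrite /F /= linVM e linV1.
have half Q A A' B B' : Q *m A = B *m Q -> Q *m A' = B' *m Q ->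
    forall nk x, exists nk', F Q (mt_deck (linV A) (linV A') nk x) =
      mt_deck (linV B) (linV B') nk' (F Q x).
  move=> e e' [n k] [v s]; exists (n *m Q^T, k); rewrite /F /mt_deck /= linV_lat.
  congr pair; congr (_ + _).
  by apply: (@zpow_conj _ _ _ _ _ _ (linV Q)) => w; rewrite !linVM ?e ?e'.
apply: (gcover_homeomorphic (mt_gcover tM) (mt_gcover tN) (cF P) (cF P')).
- exact: FK.
- exact: FK.
move=> x y; rewrite (mt_proj_eq tM) (mt_proj_eq tN); split=> -[nk e].
  rewrite e; apply: half.
    by rewrite /N -mulmxA P'P mulmx1.
  by rewrite /N' -mulmxA P'P mulmx1.
have := @half P' N N' M M' _ _ nk (F P x).
rewrite -e !(FK P P') //; apply.
  by rewrite /N !mulmxA P'P mul1mx.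
by rewrite /N' !mulmxA P'P mul1mx.
Qed.

End Linear.

Section Conjugacy.
Implicit Types X Y P Q : 'M[int]_2.

Lemma GL2Z_conjP X Y : GL2Z_conjugate X Y <-> exists P Q, P *m Q = 1%:M /\ Y = P *m X *m Q.
Proof.
split=> [[P Pu ->]|[P [Q [PQ ->]]]]; first by exists P, (invmx P); rewrite mulmxV.
have Pu : P \in unitmx by have [] := mulmx1_unit PQ.
exists P => //; congr (_ *m _).
by apply: (can_inj (mulKmx Pu)); rewrite PQ mulmxV.
Qed.

Lemma GL2Z_conj_sym X Y : GL2Z_conjugate X Y -> GL2Z_conjugate Y X.
Proof.
move=> /GL2Z_conjP [P [Q [PQ ->]]]; apply/GL2Z_conjP; exists Q, P; split.
  exact: mulmx1C.
have QP := mulmx1C PQ.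
by rewrite !mulmxA QP mul1mx -mulmxA QP mulmx1.
Qed.

Lemma GL2Z_conj_trans X Y Z :
  GL2Z_conjugate X Y -> GL2Z_conjugate Y Z -> GL2Z_conjugate X Z.
Proof.
move=> /GL2Z_conjP [P [Q [PQ ->]]] /GL2Z_conjP [P2 [Q2 [PQ2 ->]]].
apply/GL2Z_conjP; exists (P2 *m P), (Q *m Q2); split; last by rewrite !mulmxA.
by rewrite mulmxA -(mulmxA P2) PQ mulmx1.
Qed.

Lemma mx2E (a b c d : int) : (mx2 a b c d 0 0 = a) * (mx2 a b c d 0 1 = b) *
  (mx2 a b c d 1 0 = c) * (mx2 a b c d 1 1 = d).
Proof. by rewrite !mxE. Qed.

Lemma mx2_eta X : X = mx2 (X 0 0) (X 0 1) (X 1 0) (X 1 1).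
Proof. by apply: mx2_eqP; rewrite mx2E. Qed.

Lemma mulmx2 a b c d a' b' c' d' : mx2 a b c d *m mx2 a' b' c' d' =
  mx2 (a * a' + b * c') (a * b' + b * d') (c * a' + d * c') (c * b' + d * d').
Proof. by apply: mx2_eqP; rewrite mulmx2E !mx2E. Qed.

Lemma mx2_1 : 1%:M = mx2 1 0 0 1.
Proof. by apply: mx2_eqP; rewrite mx2E !mxE. Qed.

Definition trans2 X := X 0 0 + X 1 1.

Lemma conj_shift a b c d k : GL2Z_conjugate (mx2 a b c d)
  (mx2 (a + k * c) (b + k * d - k * (a + k * c)) c (d - k * c)).
Proof.
apply/GL2Z_conjP; exists (mx2 1 k 0 1), (mx2 1 (- k) 0 1).
by rewrite !mulmx2 mx2_1; split; congr mx2; ring.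
Qed.

Lemma conj_swap a b c d : GL2Z_conjugate (mx2 a b c d) (mx2 d c b a).
Proof.
apply/GL2Z_conjP; exists (mx2 0 1 1 0), (mx2 0 1 1 0).
by rewrite !mulmx2 mx2_1; split; congr mx2; ring.
Qed.

Lemma conj_sign a b c d : GL2Z_conjugate (mx2 a b c d) (mx2 a (- b) (- c) d).
Proof.
apply/GL2Z_conjP; exists (mx2 1 0 0 (-1)), (mx2 1 0 0 (-1)).
by rewrite !mulmx2 mx2_1; split; congr mx2; ring.
Qed.

(** Reduction theory of indefinite binary quadratic forms: the form of a matrix of
    discriminant less than 16 represents 1 or -1. *)
Lemma conj_companion (t e : int) X : trans2 X = t -> \det X = e ->
  0 < t ^+ 2 - 4 * e < 16 -> (forall z : int, z * z <> t ^+ 2 - 4 * e) ->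
  GL2Z_conjugate X (mx2 t (- e) 1 0).
Proof.
move=> tX dX /andP[D0 D16] nsq.
have one (a b c d : int) : a + d = t -> a * d - b * c = e -> `|c| = 1 ->
    GL2Z_conjugate (mx2 a b c d) (mx2 t (- e) 1 0).
  have pos (a' b' d' : int) : a' + d' = t -> a' * d' - b' = e ->
      GL2Z_conjugate (mx2 a' b' 1 d') (mx2 t (- e) 1 0).
    move=> h1 h2; have := conj_shift a' b' 1 d' d'.
    by rewrite -h1 -h2; congr (GL2Z_conjugate _ (mx2 _ _ _ _)); ring.
  move=> h1 h2 c1; have [c0|c0] := leP 0 c.
    have -> : c = 1 by lia.
    by apply: pos; lia.
  apply: (GL2Z_conj_trans (conj_sign a b c d)).
  have -> : - c = 1 by lia.
  by apply: pos; lia.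
suff H : forall (m : nat) (a b c d : int), (`|c| <= m)%N -> a + d = t -> a * d - b * c = e ->
    GL2Z_conjugate (mx2 a b c d) (mx2 t (- e) 1 0).
  have := H (absz (X 1 0)) (X 0 0) (X 0 1) (X 1 0) (X 1 1); rewrite -mx2_eta; apply => //.
  by rewrite -dX det_mx2.
elim=> [|m IH] a b c d cm h1 h2.
  case: (nsq (a - d)); rewrite -h1 -h2; have -> : c = 0 by lia.
  by ring.
have Deq : (d - a) * (d - a) + 4 * (b * c) = t ^+ 2 - 4 * e by rewrite -h1 -h2; ring.
have c0 : c != 0 by apply/eqP => c0; apply: (nsq (d - a)); rewrite -Deq c0; ring.
have [c1|c1] := eqVneq `|c| 1; first exact: one.
(* A shear changes the difference $d-a$ by multiples of $2c$, so it can be made at most $|c|$ in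
   absolute value. *)
have [k kP] : exists k : int, `|d - a - 2 * k * c| <= `|c|.
  pose s : int := ((d - a + `|c|) %/ (2 * `|c|))%Z.
  exists (if 0 <= c then s else - s).
  have := divz_eq (d - a + `|c|) (2 * `|c|).
  have := modz_ge0 (d - a + `|c|) (_ : 2 * `|c| != 0).
  have := @ltz_pmod (d - a + `|c|) (2 * `|c|).
  rewrite -/s; set r := (_ %% _)%Z => r2 r1 E.
  have {}r1 : 0 <= r by apply: r1; lia.
  have {}r2 : r < 2 * `|c| by apply: r2; lia.
  have -> : 2 * (if 0 <= c then s else - s) * c = s * (2 * `|c|).
    have [h|h] := leP 0 c; first by rewrite ger0_norm //; ring.
    by rewrite ltr0_norm //; ring.
  move: r1 r2 E; set q := s * _; lia.
pose b' := b + k * d - k * (a + k * c).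
have Deq' : (d - a - 2 * k * c) * (d - a - 2 * k * c) + 4 * (b' * c) = t ^+ 2 - 4 * e.
  by rewrite -Deq /b'; ring.
apply: (GL2Z_conj_trans (conj_shift a b c d k)).
apply: (GL2Z_conj_trans (conj_swap _ _ _ _)).
apply: IH.
(* With $u^2+4b'c=D$, $|u|\le|c|$ and $|c|\ge2$, suppose $|b'|\ge|c|$. If $b'c>0$ then $D\ge16$; if
   $b'c<0$ then $D\le c^2-4c^2<0$. Hence the swap decreases the lower left entry. *)
- rewrite -/b'; move: Deq' kP D0 D16; set u := d - a - _; set D := _ - _ => Deq' kP D0 D16.
  have uu : `|u| * `|u| = u * u by rewrite -normrM ger0_norm // -expr2 sqr_ge0.
  have bc : `|b' * c| = `|b'| * `|c| by rewrite normrM.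
  have U2 : `|u| * `|u| <= `|c| * `|c| by apply: ler_pM.
  have C2 : 2 * 2 <= `|c| * `|c| by apply: ler_pM => //; clear -c0 c1; lia.
  suff : `|b'| < `|c| by clear -cm; lia.
  rewrite ltNge; apply/negP => cb.
  have CB : `|c| * `|c| <= `|b'| * `|c| by apply: ler_pM.
  have u0 : 0 <= u * u by rewrite -expr2 sqr_ge0.
  move: u0 uu bc U2 C2 CB Deq'; clear -D0 D16.
  move: (`|u| * `|u|) (`|c| * `|c|) (`|b'| * `|c|) (b' * c) (u * u) => x1 x2 x3 x4 x5.
  lia.
- by rewrite -h1; ring.
- by rewrite -h2; ring.
Qed.

(** Taking determinants in $N(M+1)=2$ shows that $\mathrm{tr}\,M+2$ divides 4. With
    $(\mathrm{tr}\,M)^2>4$ this leaves the traces $-3$, $-4$ and $-6$. The first two have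
    discriminants 5 and 12, within reach of [conj_companion]. *)
Lemma abelian_monodromy (M N : 'M[int]_2) : \det M = 1 -> 4 < trans2 M ^+ 2 ->
  N *m (M + 1%:M) = 2%:M -> exists i : 'I_3, GL2Z_conjugate M (monodromy i).
Proof.
move=> dM tM NM.
have dE : \det (M + 1%:M) = trans2 M + 2.
  by move: dM; rewrite !det_mx2 !mxE /= /trans2 => dM; lia.
have dN : \det N * (trans2 M + 2) = 4.
  by rewrite -dE -det_mulmx NM det_scalar.
have tr : trans2 M = -3 \/ trans2 M = -4 \/ trans2 M = -6.
  have : `|trans2 M + 2| <= 4.
    have : `|\det N| * `|trans2 M + 2| = 4 by rewrite -normrM dN.
    have : 1 <= `|\det N| by rewrite -gtz0_ge1 normr_gt0; apply/eqP => n0; move: dN; rewrite n0 mul0r.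
    have := normr_ge0 (trans2 M + 2).
    move: (`|\det N|) (`|trans2 M + 2|) => u v v0 u1 uv; nia.
  move: tM dN; set t := trans2 M; set n := \det N => tM dN tb.
  have : t = -3 \/ t = -4 \/ t = -5 \/ t = -6 by nia.
  by move=> [->|[->|[t5|->]]]; auto; exfalso; move: dN; rewrite t5; lia.
have nsq5 (z : int) : z * z <> 5 by have : `|z| <= 2 \/ 3 <= `|z|; [lia|nia].
have nsq12 (z : int) : z * z <> 12 by have : `|z| <= 3 \/ 4 <= `|z|; [lia|nia].
have nsq8 (z : int) : z * z <> 8 by have : `|z| <= 2 \/ 3 <= `|z|; [lia|nia].
case: tr => [t3|[t4|t6]].
- exists ord0; have := @conj_companion (-3) 1 M t3 dM; apply => //.
- exists (Ordinal (isT : (1 < 3)%N)).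
  have h : GL2Z_conjugate M (mx2 (-4) (-1) 1 0) by apply: conj_companion.
  apply: (GL2Z_conj_trans h); apply: GL2Z_conj_sym; apply: conj_companion => //.
    by rewrite /trans2 /= !mx2E.
  by rewrite det_mx2 /= !mx2E.
- exists ord_max.
  (* For trace $-6$ the discriminant 32 is too large. But here $\det N=-1$, so $M+1=2Z$ with
     $Z=N^{-1}$ integral, of trace $-2$ and determinant $-1$; its discriminant is 8. Conjugating [Z]
     conjugates [M]. *)
  pose Y := \adj N.
  have dN1 : \det N = -1 by move: dN; rewrite t6; lia.
  have YN : Y *m N = - 1%:M by rewrite mul_adj_mx dN1; apply/matrixP => i j; rewrite !mxE mulNrn.
  pose Z := - Y.
  have ME : M = Z *+ 2 - 1%:M.
    have : Y *m (N *m (M + 1%:M)) = Y *+ 2 by rewrite NM mul_mx_scalar scaler_nat.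
    rewrite mulmxA YN mulNmx mul1mx => /eqP; rewrite eqr_oppLR => /eqP /(congr1 (fun X => X - 1%:M)).
    by rewrite addrK /Z mulNrn.
  have tZ : trans2 Z = -2.
    by move: t6; rewrite ME /trans2 !mxE /=; lia.
  have dZ : \det Z = -1.
    have : \det (Y *m N) = 1 by rewrite YN det_mx2 !mxE /=.
    by rewrite det_mulmx dN1 /Z det_mx2 !mxE => <-; rewrite det_mx2 !mxE; ring.
  have h (W : 'M[int]_2) : trans2 W = -2 -> \det W = -1 -> GL2Z_conjugate W (mx2 (-2) 1 1 0).
    by move=> h1 h2; have := @conj_companion (-2) (-1) W h1 h2; apply.
  have : GL2Z_conjugate Z (mx2 (-1) 2 1 (-1)).
    apply: (GL2Z_conj_trans (h _ tZ dZ)); apply: GL2Z_conj_sym; apply: h.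
      by rewrite /trans2 !mx2E.
    by rewrite det_mx2 !mx2E.
  move=> /GL2Z_conjP [P [Q [PQ E]]]; apply/GL2Z_conjP; exists P, Q; split => //.
  rewrite ME mulmxBr mulmxBl mulmx1 PQ -scaler_nat -scalemxAr -scalemxAl -E.
  by apply: mx2_eqP; rewrite /= !(mxE, mx2E).
Qed.

End Conjugacy.

(** * Lifts of torus diffeomorphisms to the plane *)

Section LiftDiffeo.
Variable R : realType.
Local Notation lat := (map_mx (intr : int -> R)).
Local Notation V := 'rV[R]_2.
Local Notation q := (@torus_proj R).
Let gc := torus_gcover R.

Lemma torus_lift_translate (f1 f2 : R -> V) m :
  (forall t, 0 <= t <= 1 -> {for t, continuous f1}) ->
  (forall t, 0 <= t <= 1 -> {for t, continuous f2}) ->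
  (forall t, 0 <= t <= 1 -> q (f1 t) = q (f2 t)) ->
  f1 0 = f2 0 + lat m -> forall t, 0 <= t <= 1 -> f1 t = f2 t + lat m.
Proof.
move=> c1 c2 e e0.
apply: (lift_path_unique gc (f2 := fun t => f2 t + lat m)); last exact: e0.
- exact: c1.
- move=> t t01; apply: (@continuous_comp _ _ _ f2 (ltrans m)); first exact: c2.
  exact: ltrans_continuous.
by move=> t t01; rewrite e //; apply/torus_proj_eq; exists m.
Qed.

(** Lift the free homotopy to the plane. The displacement between its sides $t=0$ and $t=1$ is a
    lattice vector, constant in [s]. It is [f (lat n) - f 0] at one end of the homotopy and the
    class [n *m M^T] at the other. *)
Lemma represented_shift (phi : torus R -> torus R) (f : V -> V) M n :
  continuous f -> (forall v, q (f v) = phi (q v)) -> represented_by phi M ->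
  f (lat n) = f 0 + lat (n *m M^T).
Proof.
move=> cf fE /(_ n) [H [cH H0 H1 Hs]].
pose r (z : R * R) := (clamp z.1, clamp z.2).
have cr : continuous r.
  apply: cvg_pairT => z; (apply: continuous_comp; [|exact: clamp_continuous]).
    exact: cvg_fst.
  exact: cvg_snd.
have cF : continuous (H \o r).
  by apply: within_retract cH cr _ => z; split => /=; rewrite in_itv /= clamp01.
have i0 : 0 <= (0 : R) <= 1 by rewrite lexx ler01.
have i1 : 0 <= (1 : R) <= 1 by rewrite lexx ler01.
have I t : 0 <= t <= 1 -> (`[0, 1]%classic : set R) t by rewrite /= in_itv.
have [x0 px0] := gc_surj gc ((H \o r) 0).
have [g [cg pg _]] : exists g : (R^o * R^o)%type -> V,
    [/\ continuous g, forall v, q (g v) = (H \o r) v & g 0 = x0].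
  exact: (lift_exists gc).
have pgE s t : 0 <= s <= 1 -> 0 <= t <= 1 -> q (g (s, t)) = H (s, t).
  by move=> s01 t01; rewrite pg /= /r /= !clampE.
have path (a b : R -> R^o) : continuous a -> continuous b ->
    forall t : R, 0 <= t <= 1 -> {for t, continuous (fun t => g (a t, b t))}.
  move=> ca cb t _; apply: (@continuous_comp _ _ _ (fun t => (a t, b t)) g); last exact: cg.
  exact: (cvg_pairT ca cb).
have cid : continuous (fun t : R => t : R^o) by move=> t; exact: cvg_id.
have ccst (k : R) : continuous (fun t : R => k : R^o) by move=> t; exact: cvg_cst.
have cl (w : V) : forall t : R, 0 <= t <= 1 -> {for t, continuous (fun t : R => t *: w)}.
  by move=> t _; apply: cvgZ; [exact: cvg_id|exact: cvg_cst].
have /torus_proj_eq [m0 E0] : q (g (0, 0)) = q (g (0, 1)).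
  by rewrite !pgE // Hs // I.
have /torus_proj_eq [j Ej] : q (g (0, 0)) = q (f 0).
  by rewrite pgE // H0 ?I // fE /= /torus_loop scale0r.
have e0 : f (lat n) = g (0, 1) + lat j.
  rewrite -[lat n]scale1r.
  apply: (torus_lift_translate (f1 := fun t => f (t *: lat n)) (f2 := fun t => g (0, t))); last exact: i1.
  - by move=> t t01; apply: (@continuous_comp R V V (fun t : R => t *: lat n) f t); [exact: cl|exact: cf].
  - exact: path.
  - by move=> t t01; rewrite fE pgE // H0 // I.
  - by rewrite scale0r Ej.
have e1 : g (1, 1) = g (1, 0) + lat m0.
  apply: (torus_lift_translate (f1 := fun s => g (s, 1)) (f2 := fun s => g (s, 0))); last exact: i1.
  - exact: path.
  - exact: path.
  - by move=> s s01; rewrite !pgE //; have -> := Hs s (I _ s01).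
  - exact: E0.
have /torus_proj_eq [l El] : q 0 = q (g (1, 0)).
  by rewrite pgE // H1 ?I // /torus_loop scale0r.
have e2 : g (1, 1) = lat (n *m M^T) + lat l.
  rewrite -[lat (n *m M^T)]scale1r.
  apply: (torus_lift_translate (f1 := fun t => g (1, t)) (f2 := fun t => t *: lat (n *m M^T))); last exact: i1.
  - exact: path.
  - exact: cl.
  - by move=> t t01; rewrite pgE // H1 // I.
  - by rewrite scale0r El.
have m0E : lat m0 = lat (n *m M^T).
  by move: e1; rewrite e2 El add0r addrC => /addrI.
by rewrite e0 Ej E0 -m0E addrAC.
Qed.

Lemma torus_lift_exists (phi : torus R -> torus R) M M' :
  torus_diffeo phi -> represented_by phi M -> M *m M' = 1%:M ->
  exists f f' phi', torus_lift f f' M^T M'^T phi phi'.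
Proof.
move=> [phi' [pK p'K [cphi _] [cphi' _]]] rep MM'.
have M'M := mulmx1C MM'.
have cq := gc_pcts gc.
have lift (psi : torus R -> torus R) : continuous psi ->
    exists f, continuous f /\ forall v, q (f v) = psi (q v).
  move=> cpsi; have [x0 px0] := gc_surj gc (psi (q 0)).
  have [f [cf fE _]] : exists f : V -> V,
      [/\ continuous f, forall v, q (f v) = (psi \o q) v & f 0 = x0].
    apply: (lift_exists gc) => // v.
    by apply: continuous_comp; [exact: cq|exact: cpsi].
  by exists f.
have [f [cf fE]] := lift _ cphi; have [h [ch hE]] := lift _ cphi'.
(* An arbitrary lift of the inverse is inverse to [f] only up to a lattice translation. The vector
   [j] corrects it at one point, hence everywhere by uniqueness of lifts. *)
have /torus_proj_eq [j Ej] : q (h (f 0)) = q 0 by rewrite hE fE pK.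
pose f' v := h v + lat j.
have cf' : continuous f'.
  by move=> v; apply: (@continuous_comp _ _ _ h (ltrans j)); [exact: ch|exact: ltrans_continuous].
have f'E v : q (f' v) = phi' (q v) by rewrite -hE; apply/esym/torus_proj_eq; exists j.
have cc (a b : V -> V) : continuous a -> continuous b -> continuous (a \o b).
  by move=> ca cb v; apply: continuous_comp; [exact: cb|exact: ca].
have fK : cancel f f'.
  move=> v; have : f' \o f = id; last by move=> /(congr1 (fun g => g v)).
  apply: (lift_unique gc (a := 0)).
  - exact: cc.
  - by move=> w; exact: cvg_id.
  - by move=> w /=; rewrite f'E fE pK.
  - by rewrite /= /f' -Ej.
have f'K : cancel f' f.
  move=> v; have : f \o f' = id; last by move=> /(congr1 (fun g => g v)).
  apply: (lift_unique gc (a := f 0)).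
  - exact: cc.
  - by move=> w; exact: cvg_id.
  - by move=> w /=; rewrite fE f'E p'K.
  - by rewrite /= fK.
have fl v n : f (v + lat n) = f v + lat (n *m M^T).
  have : f \o ltrans n = ltrans (n *m M^T) \o f; last by move=> /(congr1 (fun g => g v)).
  apply: (lift_unique gc (a := 0)).
  - by apply: cc; [exact: cf|exact: ltrans_continuous].
  - by apply: cc; [exact: ltrans_continuous|exact: cf].
  - move=> w /=; transitivity (phi (q w)); last by rewrite -fE; apply/torus_proj_eq; exists (n *m M^T).
    by rewrite fE; congr phi; apply/esym/torus_proj_eq; exists n.
  - by rewrite /ltrans /= add0r (represented_shift _ cf fE rep).
exists f, f', phi'; split => //.
- move=> v n; apply: (can_inj fK); rewrite fl !f'K -mulmxA -trmx_mul.
  by rewrite MM' trmx1 mulmx1.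
- by rewrite -trmx_mul M'M trmx1.
- by rewrite -trmx_mul MM' trmx1.
Qed.

End LiftDiffeo.

(** * The three monodromies *)

Section Monodromies.
Variable R : realType.

Lemma SU2_abelian_homeo (X : normedModType R) (Y Z : topologicalType) G (p : X -> Y) :
  gcover G p -> homeomorphic Y Z -> SU2_abelian R Y <-> SU2_abelian R Z.
Proof.
move=> gc [h [k [ch ck hk kh]]].
by rewrite (SU2_abelianP gc) (SU2_abelianP (gcover_homeo gc ch ck hk kh)).
Qed.

(** The matrices $2(M+1)^{-1}$, whose integrality makes the mapping tori $SU(2)$-abelian. *)
Definition half_coker (i : 'I_3) : 'M[int]_2 :=
  nth 0 [:: mx2 (-2) (-2) 2 4; mx2 0 1 2 2; mx2 1 2 1 1] i.

Lemma ord3_ind (P : 'I_3 -> Prop) :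
  P ord0 -> P (Ordinal (isT : (1 < 3)%N)) -> P ord_max -> forall i, P i.
Proof.
by move=> P0 P1 P2 [[|[|[|//]]] h]; [move: P0|move: P1|move: P2]; congr P; exact: val_inj.
Qed.

Lemma half_cokerP i : (monodromy i + 1%:M) *m half_coker i = 2%:M.
Proof.
have e a b c d : mx2 a b c d + 1%:M = mx2 (a + 1) b c (d + 1).
  by apply: mx2_eqP; rewrite !mxE /= ?addr0.
have e2 : 2%:M = mx2 2 0 0 2 by apply: mx2_eqP; rewrite !mxE.
by move: i; apply: ord3_ind; rewrite /monodromy /half_coker /= e mulmx2 e2; congr mx2.
Qed.

Lemma conj_half_coker M i : GL2Z_conjugate M (monodromy i) ->
  exists N : 'M[int]_2, N *m (M^T + 1%:M) = 2%:M.
Proof.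
move=> /GL2Z_conj_sym /GL2Z_conjP [P [Q [PQ ->]]].
exists (P *m half_coker i *m Q)^T.
have -> : (P *m monodromy i *m Q)^T + 1%:M = (P *m (monodromy i + 1%:M) *m Q)^T.
  by rewrite mulmxDr mulmxDl mulmx1 PQ linearD /= trmx1.
have QP := mulmx1C PQ.
rewrite -trmx_mul -!mulmxA (mulmxA Q P) QP mul1mx (mulmxA (_ + _)) half_cokerP.
by rewrite mul_scalar_mx -scalemxAr PQ linearZ /= trmx1 scalemx1.
Qed.

Lemma monodromy_inv i : exists M', monodromy i *m M' = 1%:M.
Proof.
move: i; apply: ord3_ind; rewrite mx2_1.
- by exists (mx2 0 1 (-1) (-3)); rewrite mulmx2; congr mx2.
- by exists (mx2 (-1) (-1) (-2) (-3)); rewrite mulmx2; congr mx2.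
- by exists (mx2 (-3) (-4) (-2) (-3)); rewrite mulmx2; congr mx2.
Qed.

Lemma det1_inv (M : 'M[int]_2) : \det M = 1 -> exists M', M *m M' = 1%:M.
Proof. by move=> d; exists (\adj M); rewrite mul_mx_adj d. Qed.

Lemma diffeo_SU2_abelian (phi : torus R -> torus R) M i :
  torus_diffeo phi -> represented_by phi M -> \det M = 1 ->
  GL2Z_conjugate M (monodromy i) ->
  exists f f' phi' A A', torus_lift f f' A A' phi phi' /\ SU2_abelian R (mapping_torus phi).
Proof.
move=> dphi rep dM /conj_half_coker [N NM]; have [M' MM'] := det1_inv dM.
have [f [f' [phi' tl]]] := torus_lift_exists dphi rep MM'.
by exists f, f', phi', M^T, M'^T; split => //; exact: (mt_SU2_abelian tl NM).
Qed.

Lemma monodromy_SU2_abelian i :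
  SU2_abelian R (mapping_torus (@linear_torus_map R (monodromy i))).
Proof.
have [M' MM'] := monodromy_inv i.
have [|N NM] := @conj_half_coker (monodromy i) i.
  by apply/GL2Z_conjP; exists 1%:M, 1%:M; rewrite !mulmx1 mul1mx.
exact: (mt_SU2_abelian (linear_torus_lift R MM') NM).
Qed.

(** The determinants of $M-1$ are 5, 6 and 8. So the first manifold is singled out by the prime 5
    and the second by the prime 3. *)
Lemma monodromy_homeo_inj i j :
  homeomorphic (mapping_torus (@linear_torus_map R (monodromy i)))
               (mapping_torus (@linear_torus_map R (monodromy j))) -> i = j.
Proof.
have pos (k : 'I_3) (p : nat) (u u' : 'cV[int]_2) (n0 : 'rV[int]_2) : (2 < p)%N ->
    ((monodromy k)^T - 1%:M) *m u = p%:Z *: u' -> (n0 *m u) 0 0 = 1 ->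
    rep_rank2 R (mapping_torus (@linear_torus_map R (monodromy k))) p.
  by have [M' MM'] := monodromy_inv k; exact: (mt_rank2 (linear_torus_lift R MM')).
have neg (k : 'I_3) (p : nat) : prime p -> coprimez (\det ((monodromy k)^T - 1%:M)) p ->
    ~ rep_rank2 R (mapping_torus (@linear_torus_map R (monodromy k))) p.
  move=> pp cop; have [M' MM'] := monodromy_inv k.
  have [|N NM] := @conj_half_coker (monodromy k) k.
    by apply/GL2Z_conjP; exists 1%:M, 1%:M; rewrite !mulmx1 mul1mx.
  apply: (mt_not_rank2 (linear_torus_lift R MM') pp _ cop NM).
  exact: mul_adj_mx.
pose c2 (a b : int) : 'cV[int]_2 := \col_i (if i == 0 then a else b).
pose r2 (a b : int) : 'rV[int]_2 := \row_i (if i == 0 then a else b).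
have row_col (a b c d : int) : (r2 a b *m c2 c d) 0 0 = a * c + b * d.
  by rewrite mxE !big_ord_recl big_ord0 addr0 !mxE.
have mx_col (a b c d x y : int) X : X = mx2 a b c d -> X *m c2 x y = c2 (a * x + b * y) (c * x + d * y).
  by move=> ->; apply/matrixP => i' j'; rewrite !mxE !big_ord_recl big_ord0 addr0 !mxE;
    case: i' => [[|[|//]] h].
have tE a b c d : (mx2 a b c d)^T - 1%:M = mx2 (a - 1) c b (d - 1).
  by apply: mx2_eqP; rewrite !mxE /= ?subr0.
have sc (k x y : int) : k *: c2 x y = c2 (k * x) (k * y).
  by apply/matrixP => i' j'; rewrite !mxE; case: ifP.
(* In this and the next step, the first column spans the kernel of $M^T-1$ modulo the prime, the
   second is its image divided by the prime, and the row is chosen to pair to 1 with the first. *)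
have P5 : rep_rank2 R (mapping_torus (@linear_torus_map R (monodromy ord0))) 5.
  apply: (@pos _ _ (c2 1 (-1)) (c2 (-1) 0) (r2 1 0)); [by []| |by rewrite row_col].
  by rewrite (mx_col _ _ _ _ _ _ _ (tE _ _ _ _)) sc; congr c2.
have P3 : rep_rank2 R (mapping_torus (@linear_torus_map R (monodromy (Ordinal (isT : (1 < 3)%N))))) 3.
  apply: (@pos _ _ (c2 2 1) (c2 (-2) 0) (r2 0 1)); [by []| |by rewrite row_col].
  by rewrite (mx_col _ _ _ _ _ _ _ (tE _ _ _ _)) sc; congr c2.
have N5 k : k != ord0 -> ~ rep_rank2 R (mapping_torus (@linear_torus_map R (monodromy k))) 5.
  by move: k; apply: ord3_ind => // _; apply: neg; rewrite // tE det_mx2 !mx2E.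
have N3 k : val k != 1%N -> ~ rep_rank2 R (mapping_torus (@linear_torus_map R (monodromy k))) 3.
  by move: k; apply: ord3_ind => // _; apply: neg; rewrite // tE det_mx2 !mx2E.
move=> h; have h' := homeo_sym h.
have h5 := rep_rank2_homeo h; have h5' := rep_rank2_homeo h'.
have [i0|i0] := eqVneq i ord0.
  have [j0|/N5 j0] := eqVneq j ord0; first by rewrite i0 j0.
  by case: j0; apply: h5; rewrite i0.
have [j0|j0] := eqVneq j ord0; first by case: (N5 _ i0); apply: h5'; rewrite j0.
have E k : val k = 1%N -> k = Ordinal (isT : (1 < 3)%N) by move=> e; exact: val_inj.
have [i1|i1] := eqVneq (val i) 1%N.
  have [j1|/N3 j1] := eqVneq (val j) 1%N; first by rewrite (E i) // (E j).
  by case: j1; apply: h5; rewrite (E i).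
have [j1|j1] := eqVneq (val j) 1%N; first by case: (N3 _ i1); apply: h5'; rewrite (E j).
have F k : k != ord0 -> val k != 1%N -> k = ord_max :> 'I_3.
  by move: k; apply: ord3_ind.
by rewrite (F i) // (F j).
Qed.

End Monodromies.

(** * Isotopic monodromies *)

Lemma quotient_space_homeo (T U : topologicalType) (r : T -> T -> Prop) (s : U -> U -> Prop)
    (f : T -> U) (g : U -> T) :
  continuous f -> continuous g -> cancel f g -> cancel g f ->
  (forall a b, r a b -> s (f a) (f b)) -> (forall a b, s a b -> r (g a) (g b)) ->
  homeomorphic (quotient_space r) (quotient_space s).
Proof.
move=> cf cg fK gK rs sr.
have half (T1 U1 : topologicalType) (r1 : T1 -> T1 -> Prop) (s1 : U1 -> U1 -> Prop) (h : T1 -> U1) :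
    continuous h -> (forall a b, r1 a b -> s1 (h a) (h b)) ->
    exists2 k : quotient_space r1 -> quotient_space s1, continuous k &
      forall a, k (quotient_proj r1 a) = quotient_proj s1 (h a).
  move=> ch hrs; have /choice [sec secP] := @quotient_proj_surj T1 r1.
  pose k y := quotient_proj s1 (h (sec y)).
  have kE a : k (quotient_proj r1 a) = quotient_proj s1 (h a).
    have /quotient_proj_eq := secP (quotient_proj r1 a).
    rewrite /k; set b := sec _; move=> E; apply/quotient_proj_eq.
    elim: E => [u v uv|u|u v _ IH|u v w _ IH1 _ IH2].
    - by apply: rst_step; exact: hrs.
    - exact: rst_refl.
    - exact: rst_sym.
    - exact: rst_trans IH1 IH2.
  exists k => //; apply/continuousP => O oO; apply/quotient_proj_open.
  rewrite (_ : _ @^-1` _ = (quotient_proj s1 \o h) @^-1` O); last first.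
    by apply/funext => a /=; rewrite kE.
  apply: open_comp => // x _; apply: continuous_comp; first exact: ch.
  exact: quotient_proj_continuous.
have [F cF FE] := half _ _ r s f cf rs; have [K cK KE] := half _ _ s r g cg sr.
exists F, K; split => //.
  by move=> y; have [a <-] := quotient_proj_surj y; rewrite FE KE fK.
by move=> y; have [a <-] := quotient_proj_surj y; rewrite KE FE gK.
Qed.

(** A point outside a neighbourhood of the solution [x] of $h(t_0,x)=y_0$ does not solve the
    equation, and by the Hausdorff property neither do its neighbours for $(t,y)$ near $(t_0,y_0)$.
    Compactness makes this uniform over the complement. *)
Lemma fiber_inverse_continuous (R : realType) (T : topologicalType) (h k : R * T -> T) :
  hausdorff_space T -> compact [set: T] -> continuous h ->
  (forall t x, k (t, h (t, x)) = x) -> (forall t x, h (t, k (t, x)) = x) -> continuous k.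
Proof.
move=> hT cT ch kh hk [t0 y0] U /=; rewrite nbhsE => -[B [oB Bx] BU].
have cB : compact (~` B) by apply: (subclosed_compact _ cT) => //; exact: open_closedC.
have /compact_near_coveringP/(_ (R * T)%type (nbhs (t0, y0)) (fun z x => h (z.1, x) <> z.2) _) H := cB.
have : \forall z \near (t0, y0), ~` B `<=` (fun x => h (z.1, x) <> z.2).
  apply: H => x nBx.
  have hx : h (t0, x) <> y0 by move=> e; apply: nBx; rewrite -(kh t0 x) e.
  have := hT; rewrite open_hausdorff => /(_ _ _ (introN eqP hx)) [[P Q] /= [Px Qy] [oP oQ /eqP PQ]].
  have n1 : nbhs (t0, x) (h @^-1` P).
    by apply: ch; apply: open_nbhs_nbhs; split => //; rewrite inE in Px.
  case: n1 => -[A1 A2] /= [n1 n2] AP.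
  exists (A2, A1 `*` Q).
    split => //=; exists (A1, Q) => //; split => //=.
    by apply: open_nbhs_nbhs; split => //; rewrite inE in Qy.
  move=> [x' [t' y']] /= [A2x [A1t Qy']] E.
  have : (P `&` Q) y' by split => //; rewrite -E; exact: (AP (t', x')).
  by rewrite PQ.
apply: filterS => -[t y] /= E; apply: BU; apply: contrapT => nB.
by have := E _ nB; rewrite hk.
Qed.

Section TorusTopology.
Variable R : realType.
Local Notation lat := (map_mx (intr : int -> R)).
Local Notation V := 'rV[R]_2.
Local Notation q := (@torus_proj R).

Lemma floor_dist (x : R) : (forall k : int, x != k%:~R) ->
  exists2 e, 0 < e & forall k : int, e <= `|x - k%:~R|.
Proof.
move=> nx; set n := Num.floor x.
have n0 : n%:~R < x by rewrite lt_def nx floor_le_tmp.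
have n1 : x < n%:~R + 1 by rewrite -intrD1 floorD1_gt.
exists (Num.min (x - n%:~R) (n%:~R + 1 - x)); first by rewrite lt_min !subr_gt0 n0.
move=> k; rewrite ge_min; have [kn|kn] := leP k n.
  have : k%:~R <= n%:~R :> R by rewrite ler_int.
  by move=> h; rewrite ger0_norm; [apply/orP; left|]; lra.
have : n%:~R + 1 <= k%:~R :> R by rewrite -intrD1 ler_int lezD1.
by move=> h; rewrite ler0_norm; [apply/orP; right|]; lra.
Qed.

Lemma torus_hausdorff : hausdorff_space (torus R).
Proof.
move=> x y; have [v <-] := gc_surj (torus_gcover R) x.
have [w <-] := gc_surj (torus_gcover R) y => cl; apply: contrapT => nvw.
have [i ni] : exists i, forall k : int, w 0 i - v 0 i != k%:~R.
  apply: contrapT => /forallNP all; apply: nvw; apply/torus_proj_eq.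
  have /choice [n nE] : forall i, exists k : int, w 0 i - v 0 i = k%:~R.
    by move=> i; have /existsNP [k /negP/negPn/eqP kE] := all i; exists k.
  exists (\row_i n i); apply/rowP => i; rewrite !mxE -nE addrC subrK //.
have [e e0 eP] := floor_dist ni.
have e2 : 0 < e / 2 by rewrite divr_gt0.
have nb (u : V) : nbhs (q u) (q @` ball u (e / 2)).
  by have := gc_nbhs (torus_gcover R) (nbhsx_ballx u _ e2); exact.
have [z [[a av az] [b bw bz]]] := cl _ _ (nb v) (nb w).
have /torus_proj_eq [n E] : q a = q b by rewrite az bz.
have := mx_ballE i av; have := mx_ballE i bw; have := eP (n 0 i).
rewrite E [(a + _) 0 i]mxE [(lat n) 0 i]mxE.
set x1 := w 0 i; set x2 := v 0 i; set x3 := a 0 i; set x4 := _%:~R.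
move=> h1; rewrite !ltr_norml => /andP[h2 h3] /andP[h4 h5].
have : `|x1 - x2 - x4| < e by rewrite ltr_norml; apply/andP; split; lra.
by rewrite ltNge h1.
Qed.

Lemma torus_compact : compact [set: torus R].
Proof.
pose box : set V := [set v | forall i, `[0, 1]%classic (v 0 i)].
have cbox : compact box by apply: (@rV_compact R 2 (fun=> `[0, 1]%classic)) => _; exact: segment_compact.
have -> : [set: torus R] = q @` box.
  rewrite eqEsubset; split => // x _; have [v <-] := gc_surj (torus_gcover R) x.
  exists (\row_i (v 0 i - (Num.floor (v 0 i))%:~R)).
    by move=> i; rewrite mxE /= in_itv /= subr_ge0 floor_le_tmp lerBlDl -intrD1 ltW ?floorD1_gt.
  apply/torus_proj_eq; exists (\row_i Num.floor (v 0 i)).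
  by apply/rowP => i; rewrite !mxE subrK.
apply: continuous_compact => //; apply: continuous_subspaceT.
exact: (gc_pcts (torus_gcover R)).
Qed.

End TorusTopology.

(** * Suspending an isotopy *)

Section Family.
Variables (R : realType) (T : topologicalType).

(** A path [k] of homeomorphisms from the identity to $\phi^{-1}\psi$ is spread over $T\times\mathbb
    R$: at a height in $[n,n+1)$ the map is $\phi^{-n}k_{t-n}\psi^n$. It intertwines the gluing maps
    of the two mapping tori, and the values of [k] at 0 and 1 make consecutive pieces match. *)
Definition suspension_map (phi phi' psi psi' : T -> T) (k : R * T -> T) (z : T * R) : T * R :=
  let n := Num.floor z.2 in
  (zpow phi phi' (- n) (k (z.2 - n%:~R, zpow psi psi' n z.1)), z.2).

Variables (phi phi' psi psi' : T -> T) (k : R * T -> T).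
Hypotheses (phiK : cancel phi phi') (phi'K : cancel phi' phi).
Hypotheses (psiK : cancel psi psi') (psi'K : cancel psi' psi).
Hypotheses (cphi : continuous phi) (cphi' : continuous phi').
Hypotheses (cpsi : continuous psi) (cpsi' : continuous psi').
Hypothesis ck : continuous k.
Hypothesis k0 : forall t x, t <= 0 -> k (t, x) = x.
Hypothesis k1 : forall t x, 1 <= t -> k (t, x) = phi' (psi x).

Lemma suspension_map_continuous : continuous (suspension_map phi phi' psi psi' k).
Proof.
move=> [x0 t0]; set n := Num.floor t0.
(* One formula for both sides of the height [n]. Above it the outer [k] has reached $\phi^{-1}\psi$,
   below it the inner [k] is still the identity. *)
pose F (z : T * R) := (zpow phi phi' (1 - n)
  (k (z.2 - n%:~R + 1, psi' (k (z.2 - n%:~R, zpow psi psi' n z.1)))), z.2).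
have tn : n%:~R <= t0 < n%:~R + 1 by rewrite floor_le_tmp -intrD1 floorD1_gt.
have E : \forall z \near (x0, t0), F z = suspension_map phi phi' psi psi' k z.
  exists (setT, ball (n%:~R : R) 1) => /=.
    split; first exact: filterT.
    apply: open_nbhs_nbhs; split; first exact: ball_open.
    by rewrite -ball_normE /ball_ /= ltr_norml; move: tn => /andP[? ?]; apply/andP; split; lra.
  move=> [x t] /= [_]; rewrite -ball_normE /ball_ /= ltr_norml => /andP[h1 h2].
  rewrite /F /suspension_map /=; congr pair; have [tn'|tn'] := leP n%:~R t.
    have -> : Num.floor t = n.
      by apply: floor_def; rewrite tn' intrD /=; lra.
    rewrite (k1 (t := _ + 1)); last by lra.
    by rewrite psi'K addrC zpowD // [zpow _ _ 1 _]/= phi'K.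
  have -> : Num.floor t = n - 1.
    by apply: floor_def; rewrite subrK intrB tn' andbT; lra.
  rewrite (k0 (t := t - n%:~R)); last by lra.
  rewrite opprB zpow_pred // intrB; congr (zpow _ _ _ (k (_, _))); ring.
apply: near_continuous E _.
have c1 (c : R) : continuous (fun z : T * R => z.2 - n%:~R + c).
  move=> z; apply: cvgD; last exact: cvg_cst.
  by apply: cvgB; [exact: cvg_snd|exact: cvg_cst].
have c2 : continuous (fun z : T * R => k (z.2 - n%:~R, zpow psi psi' n z.1)).
  move=> z; apply: (@continuous_comp _ _ _ (fun z : T * R => (z.2 - n%:~R, zpow psi psi' n z.1)) k);
    last exact: ck.
  apply: cvg_pairT => {}z.
    by have := c1 0 z; rewrite (_ : (fun _ => _ + 0) = (fun z => z.2 - n%:~R)) //;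
      apply/funext => ?; rewrite addr0.
  apply: (@continuous_comp _ _ _ fst); first exact: cvg_fst.
  exact: zpow_continuous.
apply: cvg_pairT => z; last exact: cvg_snd.
apply: (@continuous_comp _ _ _ _ (zpow phi phi' (1 - n))); last exact: zpow_continuous.
apply: (@continuous_comp _ _ _ (fun z : T * R => (z.2 - n%:~R + 1,
  psi' (k (z.2 - n%:~R, zpow psi psi' n z.1)))) k); last exact: ck.
apply: cvg_pairT; first exact: c1.
by move=> {}z; apply: (@continuous_comp _ _ _ _ psi'); [exact: c2|exact: cpsi'].
Qed.

Lemma suspension_map_rel x t u : t = u + 1 ->
  (suspension_map phi phi' psi psi' k (psi x, u)).1 = phi (suspension_map phi phi' psi psi' k (x, t)).1.
Proof.
move=> ->; rewrite /suspension_map /=.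
have -> : Num.floor (u + 1) = Num.floor u + 1.
  by apply: floor_def; rewrite !intrD !lerD2r !ltrD2r -intrD1 floor_le_tmp floorD1_gt.
set n := Num.floor u; rewrite opprD zpow_pred // phi'K.
rewrite zpowD // [zpow psi psi' 1 x]/=; congr (zpow _ _ _ (k (_, _))).
by rewrite intrD; ring.
Qed.

End Family.

Section Isotopy.
Variable R : realType.

Lemma isotopic_mt (phi psi : torus R -> torus R) :
  isotopic phi psi -> homeomorphic (mapping_torus phi) (mapping_torus psi).
Proof.
move=> [H [cH dH H0 H1]].
have i0 : 0 <= (0 : R) <= 1 by rewrite lexx ler01.
have i1 : 0 <= (1 : R) <= 1 by rewrite lexx ler01.
have inv (f : torus R -> torus R) : torus_diffeo f ->
    exists f', [/\ cancel f f', cancel f' f, continuous f & continuous f'].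
  by move=> [f' [a b [c _] [d _]]]; exists f'.
have [phi' [phiK phi'K cphi cphi']] : exists f',
    [/\ cancel phi f', cancel f' phi, continuous phi & continuous f'].
  by apply: inv; have := dH 0 i0; congr torus_diffeo; apply/funext.
have [psi' [psiK psi'K cpsi cpsi']] : exists f',
    [/\ cancel psi f', cancel f' psi, continuous psi & continuous f'].
  by apply: inv; have := dH 1 i1; congr torus_diffeo; apply/funext.
pose r (z : R * torus R) := (clamp z.1, z.2).
have cr : continuous r.
  apply: cvg_pairT => z; last exact: cvg_snd.
  by apply: continuous_comp; [exact: cvg_fst|exact: clamp_continuous].
have cHr : continuous (H \o r).
  by apply: within_retract cH cr _ => z; split => //=; rewrite in_itv /= clamp01.
have /choice [I IP] : forall t, exists f', cancel (fun x => H (clamp t, x)) f' /\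
    cancel f' (fun x => H (clamp t, x)).
  by move=> t; have [f' [a b _ _]] := inv _ (dH _ (clamp01 t)); exists f'.
pose k (z : R * torus R) := phi' ((H \o r) z).
pose l (z : R * torus R) := I z.1 (phi z.2).
have ck : continuous k by move=> z; apply: continuous_comp; [exact: cHr|exact: cphi'].
(* An isotopy only provides an inverse at each time separately; joint continuity of the inverses
   comes from compactness of the torus. *)
have cI : continuous (fun z : R * torus R => I z.1 z.2).
  apply: (fiber_inverse_continuous (@torus_hausdorff R) (@torus_compact R) cHr).
    by move=> t x /=; rewrite (IP t).1.
  by move=> t x /=; rewrite (IP t).2.
have cl : continuous l.
  move=> z; apply: (@continuous_comp _ _ _ (fun z : R * torus R => (z.1, phi z.2))
    (fun z => I z.1 z.2)); last exact: cI.
  apply: cvg_pairT => {}z; first exact: cvg_fst.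
  by apply: continuous_comp; [exact: cvg_snd|exact: cphi].
have k0 t x : t <= 0 -> k (t, x) = x.
  by move=> t0; rewrite /k /= /r clamp_le0 //= H0 phiK.
have k1 t x : 1 <= t -> k (t, x) = phi' (psi x).
  by move=> t1; rewrite /k /= /r clamp_ge1 //= H1.
have kl t x : k (t, l (t, x)) = x by rewrite /k /l /= /r /= (IP t).2 phiK.
have lk t x : l (t, k (t, x)) = x by rewrite /k /l /= /r /= phi'K (IP t).1.
have l0 t x : t <= 0 -> l (t, x) = x.
  by move=> t0; rewrite -[in LHS](k0 t x t0) lk.
have l1 t x : 1 <= t -> l (t, x) = psi' (phi x).
  by move=> t1; rewrite -[in RHS](kl t x) k1 // phi'K psiK.
apply: homeo_sym.
apply: (@quotient_space_homeo _ _ _ _ (suspension_map phi phi' psi psi' k) (suspension_map psi psi' phi phi' l)).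
- exact: suspension_map_continuous.
- exact: suspension_map_continuous.
- by move=> [x t]; rewrite /suspension_map /= zpowKN // lk zpowNK.
- by move=> [x t]; rewrite /suspension_map /= zpowKN // kl zpowNK.
- move=> [x t] [y u] [/= tu ->]; split => //.
  exact: suspension_map_rel.
- move=> [x t] [y u] [/= tu ->]; split => //.
  exact: suspension_map_rel.
Qed.

Lemma isotopic_conj_mt M N (phi psi : torus R -> torus R) :
  \det M = 1 -> GL2Z_conjugate M N ->
  isotopic phi (linear_torus_map M) -> isotopic psi (linear_torus_map N) ->
  homeomorphic (mapping_torus phi) (mapping_torus psi).
Proof.
move=> dM /GL2Z_conjP [P [Q [PQ ->]]] i1 i2; have [M' MM'] := det1_inv dM.
apply: (homeo_trans (isotopic_mt i1)); apply: homeo_trans (homeo_sym (isotopic_mt i2)).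
exact: mt_linear_conj MM' PQ.
Qed.

End Isotopy.

(** * Isometries of Sol *)

Section LineDerivative.
Variables (R : realType) (V : normedModType R).
Implicit Types (h g : V -> R) (u v : V).

(** The function [g] is the derivative of [h] along [v]. It is phrased through one-variable
    derivatives on all lines in direction [v], to which the product rule and the mean value theorem
    apply directly. *)
Definition pd v h g :=
  forall p (t : R), is_derive t (1 : R) (fun s : R => h (p + s *: v)) (g (p + t *: v)).

Lemma diff_pd h v : (forall x, differentiable h x) -> pd v h ('D_v h).
Proof.
move=> dh p t.
have Dh : derivable h (p + t *: v) v by exact: diff_derivable.
have E (r : R) : r *: 1 + t = r + t by rewrite [_ *: _]mulr1.
have F (r : R) : h (p + (r + t) *: v) = h (r *: v + (p + t *: v)).
  by rewrite scalerDl addrCA.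
have EQ : (fun r : R => r^-1 *: (h (p + (r *: (1 : R) + t) *: v) - h (p + t *: v))) =
    (fun r : R => r^-1 *: (h (r *: v + (p + t *: v)) - h (p + t *: v))).
  by apply/funext => r; rewrite E F.
by apply: DeriveDef; move: Dh; rewrite /derivable /derive EQ.
Qed.

Lemma pd_ext v h g h' g' : pd v h g -> h =1 h' -> g =1 g' -> pd v h' g'.
Proof. by move=> H /funext <- /funext <-. Qed.

Lemma pd_uniq v h g g' : pd v h g -> pd v h g' -> forall p, g p = g' p.
Proof.
move=> H H' p; have := H p 0; have := H' p 0; rewrite !scale0r !addr0 => a b.
by rewrite -(@derive_val _ _ _ _ _ _ _ a) -(@derive_val _ _ _ _ _ _ _ b).
Qed.

Lemma pd_cst v (c : R) : pd v (fun=> c) (fun=> 0).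
Proof. by move=> p t; exact: is_derive_cst. Qed.

Lemma pdD v h g h' g' : pd v h g -> pd v h' g' ->
  pd v (fun p => h p + h' p) (fun p => g p + g' p).
Proof. by move=> H H' p t; have := is_deriveD (H p t) (H' p t). Qed.

Lemma pdM v h g h' g' : pd v h g -> pd v h' g' ->
  pd v (fun p => h p * h' p) (fun p => g p * h' p + h p * g' p).
Proof.
move=> H H' p t; apply: is_derive_eq; first exact: (is_deriveM (H p t) (H' p t)).
by rewrite /GRing.scale /= addrC [h' _ * _]mulrC.
Qed.

Lemma pd_expR v h g (c : R) : pd v h g ->
  pd v (fun p => expR (c * h p)) (fun p => c * g p * expR (c * h p)).
Proof.
move=> H p t.
have cH := pdM (@pd_cst v c) H.
have D := is_derive1_comp (is_derive_expR _) (cH p t).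
have -> : c * g (p + t *: v) * expR (c * h (p + t *: v)) =
    expR (c * h (p + t *: v)) * (0 * h (p + t *: v) + c * g (p + t *: v)).
  by rewrite mul0r add0r mulrC.
exact: D.
Qed.

Lemma pd_sum v n (h g : 'I_n -> V -> R) : (forall i, pd v (h i) (g i)) ->
  pd v (fun p => \sum_i h i p) (fun p => \sum_i g i p).
Proof.
move=> H p t; have := is_derive_sum (fun i => H i p t).
by congr (is_derive _ _ _ _); apply/funext => s; rewrite fct_sumE.
Qed.

Lemma pd_cont v h g p (t : R) : pd v h g -> {for t, continuous (fun s : R => h (p + s *: v))}.
Proof.
by move=> H; apply: differentiable_continuous; apply/derivable1_diffP; exact: ex_derive.
Qed.

Lemma pd_MVT v h g p (t : R) : pd v h g -> 0 < t ->
  exists2 s, 0 < s < t & h (p + t *: v) - h p = g (p + s *: v) * t.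
Proof.
move=> H t0.
have [|c] := @MVT R (fun s => h (p + s *: v)) (fun s => g (p + s *: v)) 0 t t0 (fun x _ => H p x).
  by apply: continuous_in_subspaceT => x _; exact: pd_cont H.
rewrite in_itv /= => c0; rewrite scale0r addr0 subr0 => E.
by exists c.
Qed.

Lemma pd_linear v h p (t c : R) : pd v h (fun=> c) -> h (p + t *: v) = h p + t * c.
Proof.
move=> H; have pos q s : 0 < s -> h (q + s *: v) = h q + s * c.
  by move=> s0; have [x _ /eqP] := pd_MVT q H s0; rewrite subr_eq => /eqP ->; rewrite addrC mulrC.
have [t0|t0|->] := ltrgtP t 0; [|exact: pos|by rewrite scale0r mul0r !addr0].
have t0' : 0 < - t by rewrite oppr_gt0.
by have := pos (p + t *: v) _ t0'; rewrite scaleNr addrK => ->; rewrite mulNr subrK.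
Qed.

Fixpoint Sm (k : nat) h : Prop :=
  continuous h /\
  match k with 0 => True | k'.+1 => forall v, pd v h ('D_v h) /\ Sm k' ('D_v h) end.

Lemma Sm_pd k h v : Sm k.+1 h -> pd v h ('D_v h).
Proof. by move=> [_ /(_ v) []]. Qed.

Lemma Sm_D k h v : Sm k.+1 h -> Sm k ('D_v h).
Proof. by move=> [_ /(_ v) []]. Qed.

(** The mean value theorem in direction [a] for the increment of [h] by [t *: b], then in direction
    [b] for ['D_a h]. *)
Lemma second_difference h a b p (t : R) : Sm 2 h -> 0 < t -> exists s r, [/\ 0 < s < t, 0 < r < t &
   h (p + t *: a + t *: b) - h (p + t *: a) - (h (p + t *: b) - h p) =
   'D_b ('D_a h) (p + s *: a + r *: b) * t * t].
Proof.
move=> S t0; have Ha := Sm_pd a S; have Hb := Sm_pd b (Sm_D a S).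
have H : pd a (fun q => h (q + t *: b) - h q) (fun q => 'D_a h (q + t *: b) - 'D_a h q).
  move=> q s; have h1 := Ha (q + t *: b) s; have h2 := Ha q s.
  have E x : q + x *: a + t *: b = q + t *: b + x *: a by rewrite addrAC.
  rewrite E; under eq_fun do rewrite E.
  by have := is_deriveB h1 h2.
have [s s0 E] := pd_MVT p H t0; have [r r0 E'] := pd_MVT (p + s *: a) Hb t0.
by exists s, r; split; [exact: s0|exact: r0|rewrite -E' -E].
Qed.

Lemma symmetric_difference h u v p (t : R) : Sm 2 h -> 0 < t -> exists s r s' r',
  [/\ 0 < s < t /\ 0 < r < t, 0 < s' < t /\ 0 < r' < t &
   'D_v ('D_u h) (p + s *: u + r *: v) = 'D_u ('D_v h) (p + s' *: v + r' *: u)].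
Proof.
move=> S t0; have tn : t != 0 by rewrite gt_eqF.
have quad (w x y z a b : R) : w - x - (y - z) = a * t * t -> w - y - (x - z) = b * t * t -> a = b.
  by move=> e1 e2; apply: (mulIf tn); apply: (mulIf tn); rewrite -e1 -e2; ring.
have [s [r [s0 r0 E]]] := second_difference u v p S t0.
have [s' [r' [s0' r0' E']]] := second_difference v u p S t0.
exists s, r, s', r'; split; [by split|by split|].
by rewrite (addrAC p (t *: v)) in E'; exact: quad E E'.
Qed.

(** The second difference is symmetric in the two directions, so the two mixed derivatives agree at
    points arbitrarily close to [p]; continuity gives equality at [p]. *)
Lemma schwarz h u v p : Sm 2 h -> 'D_u ('D_v h) p = 'D_v ('D_u h) p.
Proof.
move=> S; apply/eqP; rewrite -subr_eq0; apply: contraT => n0.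
set A := 'D_u ('D_v h); set B := 'D_v ('D_u h).
have cA : continuous A by have [] := Sm_D u (Sm_D v S).
have cB : continuous B by have [] := Sm_D v (Sm_D u S).
pose e := `|A p - B p| / 2; have e0 : 0 < e by rewrite divr_gt0 // normr_gt0.
have /nbhs_ballP [d1 /= d10 h1] : nbhs p (A @^-1` ball (A p) e) by exact: cA _ _ (nbhsx_ballx _ _ e0).
have /nbhs_ballP [d2 /= d20 h2] : nbhs p (B @^-1` ball (B p) e) by exact: cB _ _ (nbhsx_ballx _ _ e0).
pose N := `|u| + `|v| + 1; have N0 : 0 < N by rewrite ltr_wpDl ?addr_ge0.
pose t := Num.min d1 d2 / N; have t0 : 0 < t by rewrite divr_gt0 // lt_min d10.
have small a b s r : `|a| + `|b| + 1 = N -> 0 < s < t -> 0 < r < t ->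
    `|p - (p + s *: a + r *: b)| < Num.min d1 d2.
  move=> ab /andP[s0 s1] /andP[r0 r1]; rewrite -addrA opprD addrA subrr add0r normrN.
  apply: (le_lt_trans (ler_normD _ _)); rewrite !normrZ !gtr0_norm //.
  have -> : Num.min d1 d2 = t * N by rewrite divfK // gt_eqF.
  rewrite -ab mulrDr mulr1; apply: ltr_pwDr => //.
  by rewrite mulrDr lerD // ler_wpM2r // ltW.
have [s [r [s' [r' [[s0 r0] [s0' r0'] E]]]]] := symmetric_difference u v p S t0.
have : B (p + s *: u + r *: v) = A (p + s' *: v + r' *: u) by exact: E.
have hb := small _ _ _ _ (erefl N) s0 r0.
have ha : `|p - (p + s' *: v + r' *: u)| < Num.min d1 d2 by apply: small; [rewrite [`|v| + _]addrC|exact: s0'|exact: r0'].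
move: ha hb; rewrite !lt_min => /andP[ha _] /andP[_ hb].
have := h1 _; rewrite -ball_normE => /(_ _ ha) /=; have := h2 _; rewrite -ball_normE => /(_ _ hb) /=.
rewrite -!ball_normE /ball_ /= => q1 q2 q3; rewrite q3 in q1.
have tri (x y z : R) : `|x - z| < e -> `|y - z| < e -> `|x - y| < e + e.
  move=> hx hy; have -> : x - y = (x - z) - (y - z) by ring.
  by apply: (le_lt_trans (ler_normB _ _)); exact: ltrD.
have := tri _ _ _ q2 q1.
by rewrite -splitr ltxx.
Qed.

End LineDerivative.

(** * Pointwise algebra of Bochner's formula *)

Section SolAlgebra.
Variable R : realFieldType.
Implicit Types (c H h k : 'I_3 -> R) (A : 'I_3 -> 'I_3 -> R) (AA : 'I_3 -> 'I_3 -> 'I_3 -> R).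

Lemma sum3 (f : 'I_3 -> R) : \sum_i f i = f 0 + f 1 + f 2.
Proof.
rewrite !big_ord_recl big_ord0 addr0 addrA.
by congr (f _ + f _ + f _); exact: val_inj.
Qed.

Lemma ord3_all (P : 'I_3 -> Prop) : P 0 -> P 1 -> P 2 -> forall i, P i.
Proof.
by move=> P0 P1 P2 [[|[|[|//]]] e]; [move: P0|move: P1|move: P2]; congr P; exact: val_inj.
Qed.

(** At a fixed point, [H] and [h] are the coefficients of the diagonal metric at the image and at
    the source, [k] inverts [h], and [A a i] is the derivative of the component [a] in direction
    [i]. A left inverse of a square matrix is a right inverse: $A^THA=h$ gives
    $A\,h^{-1}A^T=H^{-1}$. *)
Lemma gram_inverse H h k A : (forall i, k i * h i = 1) -> (forall a, H a != 0) ->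
  (forall i j, \sum_a H a * A a i * A a j = (i == j)%:R * h i) ->
  forall a b, \sum_l k l * A a l * A b l * H a = (a == b)%:R.
Proof.
move=> kh H0 M a b.
pose P : 'M[R]_3 := \matrix_(i, a) (k i * A a i * H a).
pose Q : 'M[R]_3 := \matrix_(a, j) A a j.
have PQ : P *m Q = 1%:M.
  apply/matrixP => i j; rewrite !mxE; under eq_bigr do rewrite !mxE.
  have -> : (i == j)%:R = k i * \sum_a H a * A a i * A a j.
    by rewrite M mulrCA kh mulr1.
  by rewrite mulr_sumr; apply: eq_bigr => x _; ring.
have := mulmx1C PQ => /matrixP/(_ b a); rewrite !mxE eq_sym => <-.
by apply: eq_bigr => l _; rewrite !mxE; ring.
Qed.

(** The Hessian of the height function is half the Lie derivative of the metric along
    its gradient. *)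
Lemma height_hessian c H h k A AA : (forall i, k i * h i = 1) -> k 2 = 1 ->
  (forall i j, \sum_a H a * A a i * A a j = (i == j)%:R * h i) ->
  \sum_l k l * A 2 l * A 2 l = 1 ->
  (forall l i j, \sum_a (c a * A 2 l * H a * A a i * A a j +
      H a * AA a l i * A a j + H a * A a i * AA a l j) = (i == j)%:R * (c i * (l == 2)%:R * h i)) ->
  (forall a i, \sum_l (k l * (AA a i l * A 2 l + A a l * AA 2 i l) -
      (i == 2)%:R * c l * k l * A a l * A 2 l) = 0) ->
  (forall a i j, AA a i j = AA a j i) ->
  forall i j, AA 2 i j *+ 2 = \sum_a c a * H a * A a i * A a j + (i == 2)%:R * c j * A 2 j
    + (j == 2)%:R * c i * A 2 i - (i == j)%:R * c i * h i * A 2 2.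
Proof.
move=> kh k2 M N M' I' sym i j.
pose W i l := k l * (AA 2 i l - (i == 2)%:R * c l * A 2 l).
have S a i0 : \sum_l k l * A 2 l * AA a l i0 = - \sum_l W i0 l * A a l.
  apply/eqP; rewrite -addr_eq0 -big_split /=; apply/eqP; rewrite -[RHS](I' a i0).
  by apply: eq_bigr => l _; rewrite /W (sym a l i0); ring.
have E1 : \sum_l k l * A 2 l * (\sum_a (c a * A 2 l * H a * A a i * A a j +
      H a * AA a l i * A a j + H a * A a i * AA a l j)) =
   (\sum_l k l * A 2 l * A 2 l) * (\sum_a c a * H a * A a i * A a j) +
   \sum_a H a * A a j * (\sum_l k l * A 2 l * AA a l i) +
   \sum_a H a * A a i * (\sum_l k l * A 2 l * AA a l j).
  by rewrite !sum3; ring.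
have E2 i0 j0 : \sum_a H a * A a j0 * (- \sum_l W i0 l * A a l) = - (W i0 j0 * h j0).
  transitivity (- \sum_l W i0 l * (\sum_a H a * A a l * A a j0)).
    by rewrite !sum3; ring.
  congr (- _); rewrite (bigD1 j0) //= M eqxx mul1r big1 ?addr0 // => l lj.
  by rewrite M (negPf lj) mul0r mulr0.
have Wh i0 j0 : W i0 j0 * h j0 = AA 2 i0 j0 - (i0 == 2)%:R * c j0 * A 2 j0.
  by rewrite /W mulrAC kh mul1r.
move: E1; rewrite N mul1r.
under [X in _ = _ + X + _]eq_bigr do rewrite S.
under [X in _ = _ + _ + X]eq_bigr do rewrite S.
rewrite !E2 !Wh (sym 2 j i).
under eq_bigr do rewrite M'.
have -> : \sum_l k l * A 2 l * ((i == j)%:R * (c i * (l == 2)%:R * h i)) =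
    (i == j)%:R * c i * h i * A 2 2.
  by rewrite sum3 /= k2; ring.
by move=> ->; rewrite mulr2n; ring.
Qed.

(** The pullback of the Lie derivative of the metric along $\partial_z$, that is, twice the
    covariant Hessian of the height component of the isometry. The weights [c] are the logarithmic
    derivatives of the metric coefficients in $z$. *)
Definition shape c H A i j := \sum_a c a * H a * A a i * A a j.

Lemma shape_trace c H k A :
  (forall a b, \sum_l k l * A a l * A b l * H a = (a == b)%:R) ->
  \sum_i k i * shape c H A i i = \sum_a c a.
Proof.
move=> I; transitivity (\sum_a c a * \sum_l k l * A a l * A a l * H a).
  by rewrite /shape !sum3; ring.
by apply: eq_bigr => a _; rewrite I eqxx mulr1.
Qed.

Lemma shape_norm c H k A :
  (forall a b, \sum_l k l * A a l * A b l * H a = (a == b)%:R) ->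
  \sum_i \sum_j k i * k j * shape c H A i j ^+ 2 = \sum_a c a ^+ 2.
Proof.
move=> I; transitivity (\sum_a \sum_b c a * c b *
    ((\sum_l k l * A a l * A b l * H a) * (\sum_l k l * A b l * A a l * H b))).
  transitivity (\sum_i \sum_j \sum_a \sum_b c a * c b *
     (k i * A a i * A b i * H a * (k j * A b j * A a j * H b))).
    apply: eq_bigr => i _; apply: eq_bigr => j _; rewrite /shape expr2 mulr_suml mulr_sumr.
    apply: eq_bigr => a _; rewrite mulr_sumr mulr_sumr; apply: eq_bigr => b _; ring.
  under eq_bigr do rewrite exchange_big /=.
  rewrite exchange_big /=; apply: eq_bigr => a _.
  under eq_bigr do rewrite exchange_big /=.
  rewrite exchange_big /=; apply: eq_bigr => b _.
  rewrite mulr_suml mulr_sumr; apply: eq_bigr => i _.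
  by rewrite mulr_sumr mulr_sumr.
apply: eq_bigr => a _; rewrite (bigD1 a) //= !I eqxx !mulr1 big1 ?addr0 ?expr2 // => b ba.
by rewrite !I (negPf ba) mulr0 mulr0.
Qed.

(** Bochner's formula for the height function, whose gradient has norm 1: its
    Ricci term only involves the last component of the gradient. *)
Lemma height_bochner c h k (Z : 'I_3 -> R) (ZZ T : 'I_3 -> 'I_3 -> R)
    (Z3 : 'I_3 -> 'I_3 -> 'I_3 -> R) :
  c 0 = 2 -> c 1 = -2 -> c 2 = 0 -> (forall i, k i * h i = 1) -> k 2 = 1 ->
  \sum_l k l * Z l * Z l = 1 ->
  (forall i j, ZZ i j *+ 2 = T i j + (i == 2)%:R * c j * Z j
    + (j == 2)%:R * c i * Z i - (i == j)%:R * c i * h i * Z 2) ->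
  \sum_i \sum_j k i * k j * T i j ^+ 2 = 8 ->
  (forall i, \sum_l k l * (c l ^+ 2 * (i == 2)%:R * Z l ^+ 2 - 4 * c l * (i == 2)%:R * Z l * ZZ i l
    + 2 * ZZ i l ^+ 2 + 2 * Z l * Z3 i i l) = 0) ->
  (forall l, \sum_i k i * (Z3 l i i - c i * (l == 2)%:R * ZZ i i) = 0) ->
  (forall i l, Z3 i i l = Z3 l i i) -> (forall i j, T i j = T j i) ->
  Z 2 ^+ 2 = 1.
Proof.
move=> c0 c1 c2 kh k2 N S T8 N2 L sym Ts.
(* [X] is the trace of the second derivatives of the squared gradient, which is constant; [Y] is the
   derivative of the Laplacian along the gradient. In [X - 2 * Y] the third derivatives cancel. What
   remains is [B], and evaluating its Hessian terms gives $B=8/2-4Z_2^2$. *)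
pose X := \sum_i k i * \sum_l k l * (c l ^+ 2 * (i == 2)%:R * Z l ^+ 2
    - 4 * c l * (i == 2)%:R * Z l * ZZ i l + 2 * ZZ i l ^+ 2 + 2 * Z l * Z3 i i l).
have N2S : X = 0 by rewrite /X big1 // => i _; rewrite N2 mulr0.
pose Y := \sum_l k l * Z l * \sum_i k i * (Z3 l i i - c i * (l == 2)%:R * ZZ i i).
have LS : Y = 0 by rewrite /Y big1 // => l _; rewrite L mulr0.
pose B := \sum_l k l * c l ^+ 2 * Z l ^+ 2 - 4 * (\sum_l k l * c l * Z l * ZZ 2 l)
   + 2 * (\sum_i \sum_l k i * k l * ZZ i l ^+ 2) + 2 * Z 2 * (\sum_i c i * k i * ZZ i i).
have B0 : B = 0.
  transitivity (X - 2 * Y); last by rewrite N2S LS mulr0 subr0.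
  rewrite /B /X /Y !sum3 /= k2 (sym 0 1) (sym 0 2) (sym 1 0) (sym 1 2) (sym 2 0) (sym 2 1).
  by ring.
have ZE i j : ZZ i j = (T i j + (i == 2)%:R * c j * Z j
    + (j == 2)%:R * c i * Z i - (i == j)%:R * c i * h i * Z 2) / 2.
  by rewrite -S mulr2n; field.
have kn i : k i != 0 by apply/eqP => k0; have := kh i; rewrite k0 mul0r => /esym/eqP; rewrite oner_eq0.
have hE i : h i = (k i)^-1 by apply: (mulfI (kn i)); rewrite kh divff.
have BE : B = 2^-1 * (\sum_i \sum_j k i * k j * T i j ^+ 2) - 4 * Z 2 ^+ 2.
  rewrite /B !sum3 !ZE /= !hE c0 c1 c2 k2 (Ts 2 0) (Ts 2 1).
  by field; rewrite !kn.
by move: BE; rewrite B0 T8 => /eqP; lra.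
Qed.

End SolAlgebra.

Section ComponentDerivative.
Variables (R : realType) (n m : nat).
Implicit Types g : 'rV[R]_n.+1 -> 'rV[R]_m.+1.

Lemma comp_differentiable g x a : differentiable g x -> differentiable (fun p => g p 0 a) x.
Proof.
by move=> dg; apply: (@differentiable_comp _ _ _ _ g (fun N : 'rV[R]_m.+1 => N 0 a)) => //;
  exact: differentiable_coord.
Qed.

Lemma comp_derive g x v a : differentiable g x -> 'D_v (fun p => g p 0 a) x = 'D_v g x 0 a.
Proof.
move=> dg; have D : derivable g x v by exact: diff_derivable.
rewrite {1}/derive; apply: cvg_lim => //.
have C : (fun h : R => h^-1 *: (g (h *: v + x) - g x)) @ 0^' --> 'D_v g x by exact: D.
have := @cvg_comp _ _ _ (fun h : R => h^-1 *: (g (h *: v + x) - g x)) (fun N : 'rV[R]_m.+1 => N 0 a)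
  (0^') (nbhs ('D_v g x)) (nbhs ('D_v g x 0 a)) C (@coord_continuous _ _ _ 0 a _).
apply: cvg_trans; apply: near_eq_cvg; near=> h.
by rewrite /= !mxE.
Unshelve. all: by end_near. Qed.

Lemma Ck_Sm k g a : Ck_on k setT g -> Sm k (fun p => g p 0 a).
Proof.
elim: k g => [|k IH] g /=.
  by move=> cg; split => // x; apply: (@continuous_comp _ _ _ g (fun N : 'rV[R]_m.+1 => N 0 a));
    [exact: cg|exact: coord_continuous].
move=> [dg Dg].
have dg' x : differentiable (fun p => g p 0 a) x by apply: comp_differentiable; exact: dg.
split; first by move=> x; exact: differentiable_continuous.
move=> v; split; first exact: diff_pd.
have -> : 'D_v (fun p => g p 0 a) = (fun p => 'D_v g p 0 a).
  by apply/funext => x; rewrite comp_derive //; exact: dg.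
exact: IH.
Qed.

End ComponentDerivative.

Section SolIsometries.
Variable R : realType.
Local Notation E3 := 'rV[R]_3.
Implicit Types p : E3.

Definition row3 (x y z : R) : E3 := \row_i (if i == 0 then x else if i == 1 then y else z).

Lemma row3E x y z : (row3 x y z 0 0 = x) * (row3 x y z 0 1 = y) * (row3 x y z 0 2 = z).
Proof. by rewrite !mxE. Qed.

Lemma row3_eqP (p q : E3) : p 0 0 = q 0 0 -> p 0 1 = q 0 1 -> p 0 2 = q 0 2 -> p = q.
Proof. by move=> a b c; apply/rowP; apply: ord3_all. Qed.

Definition wt (i : 'I_3) : R := if i == 0 then 2 else if i == 1 then -2 else 0.

Lemma Sol_metricE p u v :
  Sol_metric p u v = \sum_i expR (wt i * p 0 2) * u 0 i * v 0 i.
Proof.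
by rewrite /Sol_metric (sum3 (fun i => expR _ * u 0 i * v 0 i)) /wt /= !mulNr mul0r expR0 mul1r !mulrA.
Qed.

Definition unit3 (i : 'I_3) : E3 := delta_mx 0 i.
Local Notation dd i g := (derive g^~ (unit3 i)).

Lemma pd_height l : pd (unit3 l) (fun p : E3 => p 0 2) (fun=> (l == 2)%:R).
Proof.
move=> p t; have -> : (fun s : R => (p + s *: unit3 l) 0 2) = (fun s : R => p 0 2 + s * (l == 2)%:R).
  by apply/funext => s; rewrite !mxE eqxx /= eq_sym.
have H := is_deriveD (@is_derive_cst R R^o R^o (p 0 2) t 1)
  (is_deriveM (@is_derive_id R R^o t 1) (@is_derive_cst R R^o R^o (l == 2)%:R t 1)).
have -> : (fun s : R => p 0 2 + s * (l == 2)%:R) = cst (p 0 2) + id * cst (l == 2)%:R.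
  by apply/funext.
by apply: (is_derive_eq H); rewrite scaler0 !add0r [_ *: _]mulr1.
Qed.

Section HeightFunction.
Variables (c : 'I_3 -> R) (H h k : 'I_3 -> E3 -> R) (A : 'I_3 -> 'I_3 -> E3 -> R).
Variables AA Z3 : 'I_3 -> 'I_3 -> 'I_3 -> E3 -> R.
Hypotheses (c0 : c 0 = 2) (c1 : c 1 = -2) (c2 : c 2 = 0).
Hypothesis kh : forall i p, k i p * h i p = 1.
Hypothesis k2 : forall p, k 2 p = 1.
Hypothesis H2 : forall p, H 2 p = 1.
Hypothesis Hn : forall a p, H a p != 0.
Hypothesis metric : forall i j p, \sum_a H a p * A a i p * A a j p = (i == j)%:R * h i p.
Hypothesis pdH : forall l a, pd (unit3 l) (H a) (fun p => c a * A 2 l p * H a p).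
Hypothesis pdh : forall l i, pd (unit3 l) (h i) (fun p => c i * (l == 2)%:R * h i p).
Hypothesis pdk : forall l i, pd (unit3 l) (k i) (fun p => - c i * (l == 2)%:R * k i p).
Hypothesis pdA : forall a i l, pd (unit3 l) (A a i) (AA a l i).
Hypothesis pdAA : forall i j l, pd (unit3 l) (AA 2 i j) (Z3 l i j).
Hypothesis sym : forall a i j p, AA a i j p = AA a j i p.
Hypothesis sym3 : forall i l p, Z3 i i l p = Z3 l i i p.

Lemma metric_gram a b p : \sum_l k l p * A a l p * A b l p * H a p = (a == b)%:R.
Proof.
exact: (gram_inverse (h := fun i => h i p) (H := fun a => H a p) (k := fun i => k i p)
  (A := fun a i => A a i p)).
Qed.

Lemma eikonal p : \sum_l k l p * A 2 l p * A 2 l p = 1.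
Proof.
transitivity (\sum_l k l p * A 2 l p * A 2 l p * H 2 p); last by rewrite metric_gram eqxx.
by apply: eq_bigr => l _; rewrite H2 mulr1.
Qed.

Lemma metric_derivative l i j p : \sum_a (c a * A 2 l p * H a p * A a i p * A a j p +
      H a p * AA a l i p * A a j p + H a p * A a i p * AA a l j p) =
  (i == j)%:R * (c i * (l == 2)%:R * h i p).
Proof.
have L := pd_sum (fun a => pdM (pdM (pdH l a) (pdA a i l)) (pdA a j l)).
have RR := pdM (@pd_cst R _ (unit3 l) (i == j)%:R) (pdh l i).
have L' := pd_ext L (metric i j) (fun _ => erefl).
have E := pd_uniq L' RR p; rewrite mul0r add0r in E; rewrite -E.
by apply: eq_bigr => a _; ring.
Qed.

Lemma gram_derivative a i p : \sum_l (k l p * (AA a i l p * A 2 l p + A a l p * AA 2 i l p) -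
      (i == 2)%:R * c l * k l p * A a l p * A 2 l p) = 0.
Proof.
have L := pd_sum (fun l => pdM (pdM (pdk i l) (pdA a l i)) (pdA 2 l i)).
have E q : \sum_l k l q * A a l q * A 2 l q = (2 == a)%:R.
  by rewrite -(metric_gram 2 a q); apply: eq_bigr => l _; rewrite H2; ring.
have L' := pd_ext L E (fun _ => erefl).
rewrite -[RHS](pd_uniq L' (@pd_cst R _ (unit3 i) (2 == a)%:R) p).
by apply: eq_bigr => l _; ring.
Qed.

Lemma hessian_shape i j p : AA 2 i j p *+ 2 = shape c (fun a => H a p) (fun a i => A a i p) i j
   + (i == 2)%:R * c j * A 2 j p + (j == 2)%:R * c i * A 2 i p
   - (i == j)%:R * c i * h i p * A 2 2 p.
Proof.
apply: (height_hessian (k := fun i => k i p) (AA := fun a i j => AA a i j p) (h := fun i => h i p)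
   (H := fun a => H a p) (A := fun a i => A a i p)).
- by move=> *; exact: kh.
- exact: k2.
- by move=> *; exact: metric.
- exact: eikonal.
- by move=> *; exact: metric_derivative.
- by move=> *; exact: gram_derivative.
- by move=> *; exact: sym.
Qed.

(** The trace of the shape is the sum of the weights $2$, $-2$ and $0$; the Christoffel terms cancel
    for the same reason. *)
Lemma height_harmonic p : \sum_i k i p * AA 2 i i p = 0.
Proof.
have tr := shape_trace c (fun a b => metric_gram a b p).
move: tr; rewrite !(sum3 c) c0 c1 c2 => tr.
have : (\sum_i k i p * AA 2 i i p) *+ 2 = 0.
  rewrite -sumrMnl; under eq_bigr do rewrite -mulrnAr hessian_shape.
  move: tr (kh 0 p) (kh 1 p); rewrite !sum3 /= c0 c1 c2.
  move: (shape _ _ _ 0 0) (shape _ _ _ 1 1) (shape _ _ _ 2 2) => s0 s1 s2 tr e0 e1.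
  transitivity (k 0 p * s0 + k 1 p * s1 + k 2 p * s2 - (2 * (k 0 p * h 0 p) - 2 * (k 1 p * h 1 p)) * A 2 2 p).
    by ring.
  by rewrite e0 e1 tr; ring.
by move/eqP; rewrite mulrn_eq0 /= => /eqP.
Qed.

Lemma harmonic_derivative l p :
  \sum_i k i p * (Z3 l i i p - c i * (l == 2)%:R * AA 2 i i p) = 0.
Proof.
have L := pd_sum (fun i => pdM (pdk l i) (pdAA i i l)).
have L' := pd_ext L height_harmonic (fun _ => erefl).
rewrite -[RHS](pd_uniq L' (@pd_cst R _ (unit3 l) 0) p).
by apply: eq_bigr => i _; ring.
Qed.

Lemma eikonal_derivative2 i p : \sum_l k l p * (c l ^+ 2 * (i == 2)%:R * A 2 l p ^+ 2
    - 4 * c l * (i == 2)%:R * A 2 l p * AA 2 i l p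
    + 2 * AA 2 i l p ^+ 2 + 2 * A 2 l p * Z3 i i l p) = 0.
Proof.
have L := pd_sum (fun l => pdD (pdM (pdk i l)
   (pdM (pdM (@pd_cst R _ (unit3 i) 2) (pdA 2 l i)) (pdAA i l i)))
   (pdM (pdM (pdM (@pd_cst R _ (unit3 i) (- ((i == 2)%:R * c l))) (pdk i l)) (pdA 2 l i)) (pdA 2 l i))).
have E q : \sum_l (k l q * (2 * A 2 l q * AA 2 i l q) +
     - ((i == 2)%:R * c l) * k l q * A 2 l q * A 2 l q) = 0.
  by rewrite -[RHS](gram_derivative 2 i q); apply: eq_bigr => l _; ring.
have L' := pd_ext L E (fun _ => erefl).
rewrite -[RHS](pd_uniq L' (@pd_cst R _ (unit3 i) 0) p).
apply: eq_bigr => l _.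
by case: (i == 2); rewrite /= ?mulr1 ?mul1r ?mulr0 ?mul0r; ring.
Qed.

Lemma height_gradient p : A 2 2 p ^+ 2 = 1.
Proof.
apply: (height_bochner (c := c) (h := fun i => h i p) (k := fun i => k i p)
  (Z := fun l => A 2 l p) (ZZ := fun i j => AA 2 i j p)
  (T := shape c (fun a => H a p) (fun a i => A a i p)) (Z3 := fun i j l => Z3 i j l p) c0 c1 c2).
- by move=> *; exact: kh.
- exact: k2.
- exact: eikonal.
- by move=> *; exact: hessian_shape.
- rewrite (shape_norm c (fun a b => metric_gram a b p)) sum3 c0 c1 c2; ring.
- by move=> *; exact: eikonal_derivative2.
- by move=> *; exact: harmonic_derivative.
- by move=> *; exact: sym3.
- by move=> i j; apply: eq_bigr => a _; ring.
Qed.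

End HeightFunction.

End SolIsometries.

(** * The isometries of Sol are explicit affine maps *)

Section SolClassification.
Variable R : realType.
Local Notation E3 := 'rV[R]_3.
Implicit Types p : E3.
Local Notation wt := (@wt R).

Lemma unit3_basis p : p = 0 + p 0 0 *: unit3 R 0 + p 0 1 *: unit3 R 1 + p 0 2 *: unit3 R 2.
Proof.
by apply: row3_eqP; rewrite !mxE /= ?mulr1 ?mulr0 ?addr0 ?add0r.
Qed.

Lemma pd_affine (g : E3 -> R) (d : 'I_3 -> R) : (forall l, pd (unit3 R l) g (fun=> d l)) ->
  forall p, g p = g 0 + p 0 0 * d 0 + p 0 1 * d 1 + p 0 2 * d 2.
Proof.
move=> H p; rewrite {1}[p]unit3_basis (pd_linear _ _ (H 2)) (pd_linear _ _ (H 1)).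
by rewrite (pd_linear _ _ (H 0)).
Qed.

Lemma pd_const (g : E3 -> R) : (forall l, pd (unit3 R l) g (fun=> 0)) -> forall p, g p = g 0.
Proof. by move=> H p; rewrite (pd_affine H) !mulr0 !addr0. Qed.

(** Differentiating $g^2=r$ gives $2g\,\partial_l g=0$ with $g$ nowhere zero. *)
Lemma pd_sq_const (g : E3 -> R) (dg : 'I_3 -> E3 -> R) (r : R) : r != 0 ->
  (forall l, pd (unit3 R l) g (dg l)) -> (forall p, g p ^+ 2 = r) -> forall p, g p = g 0.
Proof.
move=> r0 D E; apply: pd_const => l.
have g0 p : g p != 0 by apply/eqP => e; move: r0; rewrite -(E p) e expr0n eqxx.
apply: (pd_ext (D l)) => // p.
have E' q : g q * g q = r by rewrite -expr2 E.
have := pd_uniq (pd_ext (pdM (D l) (D l)) E' (fun _ => erefl)) (@pd_cst R _ (unit3 R l) r) p.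
rewrite [g p * _]mulrC -mulr2n => /eqP; rewrite mulrn_eq0 /= mulf_eq0 (negPf (g0 p)) orbF.
by move/eqP.
Qed.

Definition solmap (w : bool) (e1 e2 a b c : R) (p : E3) : E3 :=
  if w then row3 (e1 * expR (- c) * p 0 1 + a) (e2 * expR c * p 0 0 + b) (- p 0 2 + c)
  else row3 (e1 * expR (- c) * p 0 0 + a) (e2 * expR c * p 0 1 + b) (p 0 2 + c).

Section Package.
Variable f : E3 -> E3.
Variables (A : 'I_3 -> 'I_3 -> E3 -> R) (AA : 'I_3 -> 'I_3 -> 'I_3 -> E3 -> R).
Local Notation F a := (fun p => f p 0 a).
Hypothesis pdF : forall a i, pd (unit3 R i) (F a) (A a i).
Hypothesis pdA : forall a i l, pd (unit3 R l) (A a i) (AA a l i).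
Hypothesis sym : forall a i j p, AA a i j p = AA a j i p.
Hypothesis metric : forall i j p, \sum_a expR (wt a * f p 0 2) * A a i p * A a j p =
  (i == j)%:R * expR (wt i * p 0 2).
Hypothesis eik : forall p, \sum_l expR (- wt l * p 0 2) * A 2 l p * A 2 l p = 1.
Hypothesis metric' : forall l i j p, \sum_a (wt a * A 2 l p * expR (wt a * f p 0 2) * A a i p * A a j p +
      expR (wt a * f p 0 2) * AA a l i p * A a j p + expR (wt a * f p 0 2) * A a i p * AA a l j p) =
  (i == j)%:R * (wt i * (l == 2)%:R * expR (wt i * p 0 2)).
Hypothesis hg : forall p, A 2 2 p ^+ 2 = 1.

Let w0 : wt 0 = 2. Proof. by []. Qed.
Let w1 : wt 1 = -2. Proof. by []. Qed.
Let w2 : wt 2 = 0. Proof. by []. Qed.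

Let sq2 (x y u v : R) : 0 < u -> 0 < v -> u * x * x + v * y * y = 0 -> x = 0 /\ y = 0.
Proof.
move=> u0 v0 /eqP; rewrite -!mulrA -!expr2 paddr_eq0; try by rewrite mulr_ge0 ?sqr_ge0 ?ltW.
by rewrite !mulf_eq0 (gt_eqF u0) (gt_eqF v0) /= ?sqrf_eq0 ?orbb => /andP[/eqP -> /eqP ->].
Qed.

(** The gradient of the height has norm 1 and its last component already has square 1, so the others
    vanish. The next statement is the same argument for the image of $\partial_z$. *)
Let A20 p : A 2 0 p = 0 /\ A 2 1 p = 0.
Proof.
apply: (sq2 (u := expR (- wt 0 * p 0 2)) (v := expR (- wt 1 * p 0 2))); rewrite ?expR_gt0 //.
by have := eik p; rewrite sum3 w2 oppr0 mul0r expR0 mul1r -expr2 hg; lra.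
Qed.

Let A02 p : A 0 2 p = 0 /\ A 1 2 p = 0.
Proof.
apply: (sq2 (u := expR (wt 0 * f p 0 2)) (v := expR (wt 1 * f p 0 2))); rewrite ?expR_gt0 //.
by have := metric 2 2 p; rewrite sum3 w2 !mul0r expR0 !mul1r -expr2 hg /=; lra.
Qed.

Let AA0 a l i p : (forall q, A a i q = 0) -> AA a l i p = 0.
Proof. by move=> e; have := pd_uniq (pd_ext (pdA a i l) e (fun _ => erefl)) (@pd_cst R _ _ 0) p. Qed.

Let hgt : exists s c, s ^+ 2 = 1 /\ forall p, A 2 2 p = s /\ f p 0 2 = s * p 0 2 + c.
Proof.
exists (A 2 2 0), (f 0 0 2); split => // p.
have cA q : A 2 2 q = A 2 2 0 by apply: (@pd_sq_const _ (fun l => AA 2 l 2) 1); rewrite ?oner_eq0.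
split => //.
pose d (l : 'I_3) := if l == 2 then A 2 2 0 else 0.
have D l : pd (unit3 R l) (F 2) (fun=> d l).
  apply: (pd_ext (pdF 2 l)) => // q; move: l; apply: ord3_all; rewrite /d /=.
  - exact: (A20 q).1.
  - exact: (A20 q).2.
  - exact: cA.
by rewrite (pd_affine D) /d /= !mulr0 !addr0 addrC mulrC.
Qed.

Let diag0 p : expR (2 * f p 0 2) * A 0 0 p ^+ 2 + expR (- (2 * f p 0 2)) * A 1 0 p ^+ 2 = expR (2 * p 0 2).
Proof.
have := metric 0 0 p; rewrite sum3 w0 w1 (A20 p).1 eqxx mulr0 addr0 mul1r mulNr => <-.
by ring.
Qed.

Let diag1 p : expR (2 * f p 0 2) * A 0 1 p ^+ 2 + expR (- (2 * f p 0 2)) * A 1 1 p ^+ 2 = expR (- (2 * p 0 2)).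
Proof.
have := metric 1 1 p; rewrite sum3 w0 w1 (A20 p).2 eqxx mulr0 addr0 mul1r !mulNr => <-.
by ring.
Qed.

Let AAz (i : 'I_3) a p : i != 2 -> AA a 2 i p = 0.
Proof.
move=> i2; rewrite sym.
have [->|a2] := eqVneq a 2.
  by rewrite sym AA0 // => q; move: i i2; apply: ord3_all => //; case: (A20 q).
apply: AA0 => q; move: a a2; apply: ord3_all => //; case: (A02 q) => //.
Qed.

(** Half the $z$-derivative of [diag0]. The second derivatives drop out because, up to symmetry,
    each differentiates an entry that vanishes identically; the opposite weights turn the sum into a
    difference. *)
Let ddiag0 p : A 2 2 p * (expR (2 * f p 0 2) * A 0 0 p ^+ 2 - expR (- (2 * f p 0 2)) * A 1 0 p ^+ 2) = expR (2 * p 0 2).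
Proof.
have := metric' 2 0 0 p; rewrite sum3 !AAz // w0 w1 w2 eqxx /= mul1r mulr1 !mulNr => E.
by apply: (mulfI (_ : (2 : R) != 0)) => //; rewrite -E; ring.
Qed.

Let ddiag1 p : A 2 2 p * (expR (2 * f p 0 2) * A 0 1 p ^+ 2 - expR (- (2 * f p 0 2)) * A 1 1 p ^+ 2) = - expR (- (2 * p 0 2)).
Proof.
have := metric' 2 1 1 p; rewrite sum3 !AAz // w0 w1 w2 eqxx /= mul1r mulr1 !mulNr => E.
by apply: (mulfI (_ : (2 : R) != 0)) => //; rewrite mulrN -E; ring.
Qed.

Let zero_of (u x : R) : 0 < u -> u * x ^+ 2 = 0 -> x = 0.
Proof. by move=> u0 /eqP; rewrite mulf_eq0 gt_eqF //= sqrf_eq0 => /eqP. Qed.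

Let comp_const a i (r : R) : 0 < r -> (forall p, A a i p ^+ 2 = r) -> forall p, A a i p = A a i 0.
Proof. by move=> r0; apply: (@pd_sq_const _ (fun l => AA a l i)) => //; rewrite gt_eqF. Qed.

Let comp_affine a i : (i != 2) -> (forall p, A a i p = A a i 0) -> (forall p, A a (1 - i) p = 0) ->
  a != 2 -> forall p, f p 0 a = A a i 0 * p 0 i + f 0 0 a.
Proof.
move=> i2 ci cj a2 p.
have D l : pd (unit3 R l) (F a) (fun=> if l == i then A a i 0 else 0).
  apply: (pd_ext (pdF a l)) => // q.
  have a22 : A a 2 q = 0 by move: a a2 {ci cj}; apply: ord3_all => //; case: (A02 q).
  have [->|li] := eqVneq l i; first exact: ci.
  have [->|l2] := eqVneq l 2; first exact: a22.
  have -> : l = 1 - i by move: l li l2 {ci cj}; move: i i2; apply: ord3_all => //= _; apply: ord3_all => // _ _; exact: val_inj.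
  exact: cj.
rewrite (pd_affine D); move: i i2 {ci cj D}; apply: ord3_all => //= _;
by rewrite !mulr0 !addr0 addrC mulrC.
Qed.

Let sq_expR (r x c : R) : expR (2 * x) * r ^+ 2 = expR (2 * c) -> r ^+ 2 = expR (2 * (c - x)).
Proof. by move=> E; apply: (mulfI (_ : expR (2 * x) != 0)); rewrite ?gt_eqF ?expR_gt0 // E -expRD; congr expR; ring. Qed.

Let sign_of (r c : R) : r ^+ 2 = expR (2 * c) -> (r * expR (- c)) ^+ 2 = 1 /\ r = r * expR (- c) * expR c.
Proof.
move=> E; split; last by rewrite -mulrA -expRD addNr expR0 mulr1.
by rewrite exprMn E -expRM_natl -expRD mulrN addrC addNr expR0.
Qed.

(** Comparing [diag0] with [ddiag0], and [diag1] with [ddiag1], kills one entry in each of the two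
    horizontal columns; which one depends on the sign of [A 2 2], so the foliations are swapped
    exactly when heights are reversed. The surviving entries have constant squares, hence are
    constant. *)
Lemma package_solmap : exists w e1 e2 a b c, [/\ e1 ^+ 2 = 1, e2 ^+ 2 = 1 & f = solmap w e1 e2 a b c].
Proof.
have [s [c [s1 hc]]] := hgt.
have [es|es] : s = 1 \/ s = -1.
  by move/eqP: s1; rewrite sqrf_eq1 => /orP[/eqP ->|/eqP ->]; [left|right].
- have z10 p : A 1 0 p = 0.
    apply: (@zero_of (expR (- (2 * f p 0 2)))); rewrite ?expR_gt0 //.
    by have := diag0 p; have := ddiag0 p; rewrite (hc p).1 es mul1r; lra.
  have z01 p : A 0 1 p = 0.
    apply: (@zero_of (expR (2 * f p 0 2))); rewrite ?expR_gt0 //.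
    by have := diag1 p; have := ddiag1 p; rewrite (hc p).1 es mul1r; lra.
  have s00 p : A 0 0 p ^+ 2 = expR (2 * (- c)).
    have := diag0 p; rewrite z10 expr0n mulr0 addr0 => /sq_expR ->.
    by rewrite (hc p).2 es; congr expR; ring.
  have s11 p : A 1 1 p ^+ 2 = expR (2 * c).
    have := diag1 p; rewrite z01 expr0n mulr0 add0r -!mulrN => /sq_expR ->.
    by rewrite (hc p).2 es; congr expR; ring.
  have [x1 x2] := sign_of (s00 0); have [y1 y2] := sign_of (s11 0).
  exists false, (A 0 0 0 * expR (- - c)), (A 1 1 0 * expR (- c)), (f 0 0 0), (f 0 0 1), c; split => //.
  apply/funext => p; rewrite /solmap -x2 -y2; apply: row3_eqP; rewrite row3E.
  + by apply: (@comp_affine 0 0) => //; [exact: (comp_const (expR_gt0 _) s00)|rewrite subr0].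
  + by apply: (@comp_affine 1 1) => //; [exact: (comp_const (expR_gt0 _) s11)|rewrite subrr].
  + by rewrite (hc p).2 es mul1r.
- have z00 p : A 0 0 p = 0.
    apply: (@zero_of (expR (2 * f p 0 2))); rewrite ?expR_gt0 //.
    by have := diag0 p; have := ddiag0 p; rewrite (hc p).1 es mulN1r; lra.
  have z11 p : A 1 1 p = 0.
    apply: (@zero_of (expR (- (2 * f p 0 2)))); rewrite ?expR_gt0 //.
    by have := diag1 p; have := ddiag1 p; rewrite (hc p).1 es mulN1r; lra.
  have s10 p : A 1 0 p ^+ 2 = expR (2 * c).
    have := diag0 p; rewrite z00 expr0n mulr0 add0r -!mulrN => /sq_expR ->.
    by rewrite (hc p).2 es; congr expR; ring.
  have s01 p : A 0 1 p ^+ 2 = expR (2 * (- c)).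
    have := diag1 p; rewrite z11 expr0n mulr0 addr0 -!mulrN => /sq_expR ->.
    by rewrite (hc p).2 es; congr expR; ring.
  have [x1 x2] := sign_of (s01 0); have [y1 y2] := sign_of (s10 0).
  exists true, (A 0 1 0 * expR (- - c)), (A 1 0 0 * expR (- c)), (f 0 0 0), (f 0 0 1), c; split => //.
  apply/funext => p; rewrite /solmap -x2 -y2; apply: row3_eqP; rewrite row3E.
  + by apply: (@comp_affine 0 1) => //; [exact: (comp_const (expR_gt0 _) s01)|rewrite subrr].
  + by apply: (@comp_affine 1 0) => //; [exact: (comp_const (expR_gt0 _) s10)|rewrite subr0].
  + by rewrite (hc p).2 es mulN1r.
Qed.

End Package.

Lemma Sol_isometry_solmap (f : E3 -> E3) : Sol_isometry f ->
  exists w e1 e2 a b c, [/\ e1 ^+ 2 = 1, e2 ^+ 2 = 1 & f = solmap w e1 e2 a b c].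
Proof.
move=> [[_ [_ _ fS _]] fiso].
pose A (a i : 'I_3) : E3 -> R := 'D_(unit3 R i) (fun p => f p 0 a).
pose AA (a l i : 'I_3) : E3 -> R := 'D_(unit3 R l) (A a i).
pose Z3 (l i j : 'I_3) : E3 -> R := 'D_(unit3 R l) (AA 2 i j).
have SmF n a : Sm n (fun p => f p 0 a) by exact: Ck_Sm.
have pdF a i : pd (unit3 R i) (fun p => f p 0 a) (A a i) := Sm_pd (unit3 R i) (SmF 1 a).
have SmA n a i : Sm n (A a i) := Sm_D (unit3 R i) (SmF n.+1 a).
have pdA a i l : pd (unit3 R l) (A a i) (AA a l i) := Sm_pd (unit3 R l) (SmA 1 a i).
have SmAA n a l i : Sm n (AA a l i) := Sm_D (unit3 R l) (SmA n.+1 a i).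
have pdAA i j l : pd (unit3 R l) (AA 2 i j) (Z3 l i j) := Sm_pd (unit3 R l) (SmAA 1 2 i j).
have sym a i j p : AA a i j p = AA a j i p := schwarz (unit3 R i) (unit3 R j) p (SmF 2 a).
have sym3 i l p : Z3 i i l p = Z3 l i i p.
  have e : AA 2 i l = AA 2 l i by apply/funext => q; exact: sym.
  transitivity ('D_(unit3 R i) (AA 2 l i) p); first by rewrite /Z3 e.
  exact: (schwarz (unit3 R i) (unit3 R l) p (SmA 2 2 i)).
have metric i j p : \sum_a expR (wt a * f p 0 2) * A a i p * A a j p =
    (i == j)%:R * expR (wt i * p 0 2).
  have dF : differentiable f p by exact: (fS 1).1.
  have := fiso p (unit3 R i) (unit3 R j); rewrite !Sol_metricE.
  have E a l : 'd f p (unit3 R l) 0 a = A a l p by rewrite -deriveE // /A comp_derive.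
  under eq_bigr do rewrite !E.
  move=> ->; rewrite (bigD1 i) //= big1 ?addr0; last first.
    by move=> a ai; rewrite !mxE (negPf ai) /= mulr0 mul0r.
  by rewrite !mxE !eqxx /= mulr1 mulrC.
have kh i p : expR (- wt i * p 0 2) * expR (wt i * p 0 2) = 1.
  by rewrite mulNr expRN mulVf // gt_eqF // expR_gt0.
have e2 (x : R) : expR (wt 2 * x) = 1 by rewrite /wt /= mul0r expR0.
have e2' (p : E3) : expR (- wt 2 * p 0 2) = 1 by rewrite mulNr expRN e2 invr1.
have H0 a p : expR (wt a * f p 0 2) != 0 by rewrite gt_eqF // expR_gt0.
have pdH l a : pd (unit3 R l) (fun p => expR (wt a * f p 0 2))
    (fun p => wt a * A 2 l p * expR (wt a * f p 0 2)) := pd_expR (wt a) (pdF 2 l).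
have pdh l (c : R) : pd (unit3 R l) (fun p => expR (c * p 0 2))
    (fun p => c * (l == 2)%:R * expR (c * p 0 2)) := pd_expR c (@pd_height R l).
move: A AA Z3 SmF pdF SmA pdA SmAA pdAA sym sym3 metric pdH => A AA Z3 _ pdF _ pdA _ pdAA sym sym3 metric pdH.
apply: (package_solmap pdF pdA sym metric).
- exact: (eikonal (k := fun i p => expR (- wt i * p 0 2)) kh (fun p => e2 (f p 0 2)) H0 metric).
- exact: (metric_derivative metric pdH (fun l i => pdh l (wt i)) pdA).
- exact: (@height_gradient R wt _ _ (fun i p => expR (- wt i * p 0 2)) A AA Z3
    erefl erefl erefl kh e2' (fun p => e2 (f p 0 2)) H0 metric pdH (fun l i => pdh l (wt i))
    (fun l i => pdh l (- wt i)) pdA pdAA sym sym3).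
Qed.

End SolClassification.

(** * Cocompact groups of isometries of Sol *)

Lemma finite_min (R : realType) (T : choiceType) (S : set T) (N : T -> R) :
  finite_set S -> S !=set0 -> exists2 x, S x & forall y, S y -> N x <= N y.
Proof.
move=> /finite_seqP [s ->] [x0 /= xs].
elim: s x0 xs => // a s IH x0 _; case: s IH => [|b s] IH.
  by exists a; rewrite ?mem_head // => y /=; rewrite inE => /eqP ->.
have [x xs xm] := IH b (mem_head _ _).
have [le|lt] := leP (N a) (N x).
  exists a; first by rewrite /= mem_head.
  by move=> y /=; rewrite inE => /orP[/eqP -> //|ys]; exact: le_trans le (xm _ ys).
exists x; first by rewrite /= inE xs orbT.
by move=> y /=; rewrite inE => /orP[/eqP ->|ys]; [exact: ltW|exact: xm].
Qed.

Section PlanarAction.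
Variable R : realType.
Local Notation E3 := 'rV[R]_3.
Local Notation V := 'rV[R]_2.

Definition row2 (x y : R) : V := \row_i (if i == 0 then x else y).

Lemma row2E x y : (row2 x y 0 0 = x) * (row2 x y 0 1 = y).
Proof. by rewrite !mxE. Qed.

Lemma row2_eqP (u v : V) : u 0 0 = v 0 0 -> u 0 1 = v 0 1 -> u = v.
Proof.
move=> e0 e1; apply/rowP; case=> -[|[|//]] i.
  by rewrite (_ : Ordinal i = 0) //; exact: val_inj.
by rewrite (_ : Ordinal i = 1) //; exact: val_inj.
Qed.

Definition planar (p : E3) : V := row2 (p 0 0) (p 0 1).
(** The data of an isometry are read off from its values at a few points, which makes them functions
    of the map itself and not of a chosen presentation as a [solmap]. In particular [swp] tests
    whether heights are reversed. *)
Definition hgt (f : E3 -> E3) : R := f 0 0 2.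
Definition swp (f : E3 -> E3) : bool := f (row3 0 0 1) 0 2 < hgt f.
Definition tra (f : E3 -> E3) : V := planar (f 0).
Definition lin (f : E3 -> E3) (v : V) : V := planar (f (row3 (v 0 0) (v 0 1) 0)) - tra f.
Definition pl (f : E3 -> E3) (v : V) : V := lin f v + tra f.

(** The linear part of [solmap w e1 e2 a b c] has determinant [e1 * e2], so equal signs mean that
    orientation is preserved. *)
Definition oriented_sol (f : E3 -> E3) : Prop :=
  exists w e a b c, e ^+ 2 = 1 /\ f = solmap w e e a b c.

Definition scal (w : bool) (e c : R) (v : V) : V :=
  if w then row2 (e * expR (- c) * v 0 1) (e * expR c * v 0 0)
  else row2 (e * expR (- c) * v 0 0) (e * expR c * v 0 1).

Lemma solmapE w e a b c : let f := solmap w e e a b c in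
  (hgt f = c) * (tra f = row2 a b) * (swp f = w) * (forall v, lin f v = scal w e c v).
Proof.
have hE : hgt (solmap w e e a b c) = c.
  by rewrite /hgt /solmap; case: (w); rewrite row3E mxE ?oppr0 add0r.
have tE : tra (solmap w e e a b c) = row2 a b.
  by rewrite /tra /planar /solmap; case: (w); rewrite !row3E !mxE ?mulr0 !add0r.
rewrite /= hE tE; split; first split => //.
  by rewrite /swp hE /solmap; case: (w); rewrite !row3E; apply/idP; lra.
move=> v; rewrite /lin tE /planar /solmap /scal.
by case: (w); rewrite !row3E; apply: row2_eqP; rewrite !mxE /= addrK.
Qed.

Lemma oriented_lin f : oriented_sol f ->
  exists2 e, e ^+ 2 = 1 & forall v, lin f v = scal (swp f) e (hgt f) v.
Proof. by move=> [w [e [a [b [c [ee ->]]]]]]; exists e => // v; rewrite !solmapE. Qed.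

Lemma oriented_apply f p : oriented_sol f -> planar (f p) = pl f (planar p) /\
  f p 0 2 = (-1) ^+ swp f * p 0 2 + hgt f.
Proof.
move=> [w [e [a [b [c [ee ->]]]]]]; rewrite /pl !solmapE /planar /solmap /scal.
by case: w; rewrite !row3E ?expr1 ?expr0 ?mulN1r ?mul1r; split => //;
  apply: row2_eqP; rewrite !mxE.
Qed.

Lemma scalD w e c u v : scal w e c (u + v) = scal w e c u + scal w e c v.
Proof. by rewrite /scal; case: w; apply: row2_eqP; rewrite !mxE /=; ring. Qed.

Lemma linD f u v : oriented_sol f -> lin f (u + v) = lin f u + lin f v.
Proof. by move=> /oriented_lin [e _ h]; rewrite !h scalD. Qed.

Lemma lin0 f : oriented_sol f -> lin f 0 = 0.
Proof. by move=> of_; apply: (addrI (lin f 0)); rewrite -linD // !addr0. Qed.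

Lemma linN f u : oriented_sol f -> lin f (- u) = - lin f u.
Proof. by move=> of_; apply: (addrI (lin f u)); rewrite -linD // !subrr lin0. Qed.

Lemma linZ f (a : R) u : oriented_sol f -> lin f (a *: u) = a *: lin f u.
Proof.
move=> /oriented_lin [e _ h]; rewrite !h /scal.
by case: swp; apply: row2_eqP; rewrite !mxE /=; ring.
Qed.

Lemma lin_swap f v : oriented_sol f -> swp f -> lin f (lin f v) = v.
Proof.
move=> /oriented_lin [e ee h] sf; rewrite !h sf /scal.
have E : expR (- hgt f) * expR (hgt f) = 1 by rewrite -expRD addNr expR0.
apply: row2_eqP; rewrite !row2E.
  by transitivity (e ^+ 2 * (expR (- hgt f) * expR (hgt f)) * v 0 0); [ring|rewrite ee E !mul1r].
by transitivity (e ^+ 2 * (expR (- hgt f) * expR (hgt f)) * v 0 1); [ring|rewrite ee E !mul1r].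
Qed.

Lemma hgt_comp f g : oriented_sol f -> hgt (f \o g) = (-1) ^+ swp f * hgt g + hgt f.
Proof. by move=> /(oriented_apply (g 0)) [_]. Qed.

Lemma swp_comp f g : oriented_sol f -> oriented_sol g -> swp (f \o g) = swp f (+) swp g.
Proof.
move=> of_ og; rewrite [LHS]/swp hgt_comp //= (oriented_apply _ of_).2 (oriented_apply _ og).2.
rewrite row3E ltrD2r; case: (swp f); case: (swp g); rewrite ?expr1 ?expr0 /=; apply/idP; lra.
Qed.

Lemma pl_comp f g v : oriented_sol f -> oriented_sol g -> oriented_sol (f \o g) ->
  pl (f \o g) v = pl f (pl g v).
Proof.
move=> of_ og ofg; have vE : planar (row3 (v 0 0) (v 0 1) 0) = v.
  by apply: row2_eqP; rewrite row2E row3E.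
have := (oriented_apply (row3 (v 0 0) (v 0 1) 0) ofg).1; rewrite vE => <- /=.
by rewrite (oriented_apply _ of_).1 (oriented_apply _ og).1 vE.
Qed.

Lemma tra_pl f : oriented_sol f -> tra f = pl f 0.
Proof. by move=> of_; rewrite /pl lin0 // add0r. Qed.

Lemma tra_comp f g : oriented_sol f -> tra (f \o g) = lin f (tra g) + tra f.
Proof. by move=> of_; rewrite [LHS]/tra /= (oriented_apply _ of_).1. Qed.

Lemma lin_pl f v : lin f v = pl f v - tra f.
Proof. by rewrite /pl addrK. Qed.

Lemma lin_comp f g v : oriented_sol f -> oriented_sol g -> oriented_sol (f \o g) ->
  lin (f \o g) v = lin f (lin g v).
Proof.
move=> of_ og ofg; rewrite [LHS]lin_pl pl_comp // tra_comp // /pl linD //.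
by rewrite -[X in X - _]addrA addrK.
Qed.

Lemma oriented_id : oriented_sol id.
Proof.
exists false, 1, 0, 0, 0; split; first by rewrite expr1n.
by apply/funext => p; rewrite /solmap oppr0 expR0; apply: row3_eqP; rewrite row3E; ring.
Qed.

Lemma hgt_id : hgt id = 0. Proof. by rewrite /hgt mxE. Qed.

Lemma swp_id : swp id = false.
Proof. by rewrite /swp hgt_id row3E ltr10. Qed.

Lemma pl_id v : pl id v = v.
Proof.
by rewrite /pl /lin /tra subrK; apply: row2_eqP; rewrite row2E row3E.
Qed.

End PlanarAction.

Lemma sign_expR_neq1 (R : realType) (e c : R) : e ^+ 2 = 1 -> c != 0 -> e * expR c != 1.
Proof.
move=> ee c0; apply/eqP => E; case/eqP: c0; apply: expR_inj; rewrite expR0.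
have : (e * expR c) ^+ 2 = 1 by rewrite E expr1n.
by rewrite exprMn ee mul1r => /eqP; rewrite sqrp_eq1 ?expR_ge0 // => /eqP.
Qed.

Section SolGroup.
Variable R : realType.
Local Notation E3 := 'rV[R]_3.
Local Notation V := 'rV[R]_2.
Variable G : set (E3 -> E3).

(** [sg_fin] amounts to proper discontinuity and [sg_cob] to cocompactness. *)
Record sol_group : Prop := SolGroup {
  sg_id : G id;
  sg_comp : forall f g, G f -> G g -> G (f \o g);
  sg_inv : forall f, G f -> exists2 g, G g & cancel f g /\ cancel g f;
  sg_oriented : forall f, G f -> oriented_sol f;
  sg_free : acts_freely G;
  sg_fin : forall r : R, finite_set [set g | G g /\ forall j, `|g 0 0 j| <= r];
  sg_cob : exists r : R, forall p, exists2 g, G g & forall j, `|g p 0 j| <= r }.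

Hypothesis sg : sol_group.
Let Gid := sg_id sg.
Let Gc := sg_comp sg.
Let Gi := sg_inv sg.
Let Go := sg_oriented sg.

Definition translations : set V :=
  [set v | exists2 g, G g & [/\ swp g = false, hgt g = 0 & tra g = v]].
Local Notation K := translations.

(** The linear part is a sign. If it were $-1$, then [g] would be a half turn about the midpoint
    between the origin and its image, fixing that point against freeness. *)
Lemma translation_lin g v : G g -> swp g = false -> hgt g = 0 -> lin g v = v.
Proof.
move=> Gg sw h0; have [e ee lE] := oriented_lin (Go Gg).
have lv u : lin g u = e *: u.
  by rewrite lE sw h0 /scal oppr0 expR0 mulr1; apply: row2_eqP; rewrite !mxE.
have /eqP := ee; rewrite sqrf_eq1 => /orP[/eqP e1|/eqP e1]; first by rewrite lv e1 scale1r.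
suff -> : g = id by rewrite lin_pl pl_id tra_pl ?pl_id ?subr0 //; exact: oriented_id.
pose t := 2^-1 *: tra g.
apply: (sg_free sg Gg (p := row3 (t 0 0) (t 0 1) 0)).
have [a b] := oriented_apply (row3 (t 0 0) (t 0 1) 0) (Go Gg).
have tE : planar (row3 (t 0 0) (t 0 1) 0) = t by apply: row2_eqP; rewrite row2E row3E.
have : planar (g (row3 (t 0 0) (t 0 1) 0)) = t.
  rewrite a tE /pl lv e1 scaleN1r; apply/eqP; rewrite addrC subr_eq /t -scalerDl.
  by rewrite (_ : 2^-1 + 2^-1 = 1 :> R) ?scale1r //; lra.
move=> /rowP q; apply: row3_eqP; last by rewrite b sw h0 row3E mulr0 addr0.
  by have := q 0; rewrite row2E row3E.
by have := q 1; rewrite row2E row3E.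
Qed.

Lemma inverse_maps g g' : G g -> G g' -> cancel g g' -> cancel g' g ->
  [/\ swp g' = swp g, hgt g' = - (-1) ^+ swp g * hgt g,
      (forall v, pl g (pl g' v) = v) & (forall v, pl g' (pl g v) = v)].
Proof.
move=> Gg Gg' gK g'K.
have e1 : g \o g' = id by apply/funext.
have e2 : g' \o g = id by apply/funext.
have sE : swp g' = swp g.
  have := swp_id R; rewrite -e1 swp_comp; [|exact: Go..].
  by case: (swp g); case: (swp g').
split => //.
- have := hgt_id R; rewrite -e2 hgt_comp; last exact: Go.
  by rewrite sE => /eqP; rewrite addrC addr_eq0 mulNr => /eqP.
- by move=> v; rewrite -pl_comp ?e1 ?pl_id //; [exact: Go..|exact: oriented_id].
- by move=> v; rewrite -pl_comp ?e2 ?pl_id //; [exact: Go..|exact: oriented_id].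
Qed.

Lemma translation_pl v : K v -> exists2 g, G g &
  [/\ swp g = false, hgt g = 0 & forall u, pl g u = u + v].
Proof. by move=> [g Gg [a b <-]]; exists g => //; split=> // u; rewrite /pl translation_lin. Qed.

Lemma pl_translation v g : G g -> swp g = false -> hgt g = 0 -> (forall u, pl g u = u + v) -> K v.
Proof. by move=> Gg a b e; exists g; rewrite // tra_pl ?e ?add0r //; exact: Go. Qed.

Lemma translation0 : K 0.
Proof. by apply: (pl_translation Gid (swp_id R) (hgt_id R)) => u; rewrite pl_id addr0. Qed.

Lemma translationD u v : K u -> K v -> K (u + v).
Proof.
move=> /translation_pl [f Gf [fs fh fE]] /translation_pl [g Gg [gs gh gE]].
apply: (pl_translation (Gc Gg Gf)).
- by rewrite (swp_comp (Go Gg) (Go Gf)) fs gs.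
- by rewrite (hgt_comp _ (Go Gg)) fh gh mulr0 addr0.
- by move=> w; rewrite (pl_comp _ (Go Gg) (Go Gf)) ?fE ?gE ?addrA //; exact/Go/Gc.
Qed.

Lemma translation_conj g v : G g -> K v -> K (lin g v).
Proof.
move=> Gg /translation_pl [f Gf [fs fh fE]].
have [g' Gg' [gK g'K]] := Gi Gg; have [s' h' p1 p2] := inverse_maps Gg Gg' gK g'K.
have Gfg := Gc Gf Gg'.
apply: (pl_translation (Gc Gg Gfg)).
- by rewrite (swp_comp (Go Gg) (Go Gfg)) (swp_comp (Go Gf) (Go Gg')) fs s' addbb.
- rewrite (hgt_comp _ (Go Gg)) (hgt_comp _ (Go Gf)) fh fs h' addr0.
  by rewrite expr0 mul1r mulNr mulrN mulrA -expr2 sqrr_sign mul1r addNr.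
- move=> w; rewrite (pl_comp _ (Go Gg) (Go Gfg) (Go (Gc Gg Gfg))).
  rewrite (pl_comp _ (Go Gf) (Go Gg') (Go Gfg)) fE {1}/pl linD; last exact: Go.
  by rewrite addrAC -/(pl g _) p1.
Qed.

Lemma translationN v : K v -> K (- v).
Proof.
move=> /translation_pl [f Gf [fs fh fE]].
have [g Gg [gK g'K]] := Gi Gf; have [s' h' p1 p2] := inverse_maps Gf Gg gK g'K.
apply: (pl_translation Gg); rewrite ?s' ?h' ?fh ?mulr0 //.
by move=> u; have := p1 u; rewrite fE => {2}<-; rewrite addrK.
Qed.

Lemma translationZ (k : int) v : K v -> K (k%:~R *: v).
Proof.
move=> Kv; elim/int_step_ind: k => [|k IH|k IH].
- by rewrite scale0r; exact: translation0.
- by rewrite intrD scalerDl scale1r; exact: translationD.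
- by rewrite intrD scalerDl mulrN1z scaleN1r; apply: translationD => //; exact: translationN.
Qed.

Definition sqn (v : V) : R := v 0 0 ^+ 2 + v 0 1 ^+ 2.

(** Only finitely many elements move the origin by a bounded amount. The bound on the coordinates
    uses $|x|\le x^2+1$. *)
Lemma translation_min (P : set V) : P `<=` K -> P !=set0 ->
  exists2 v, P v & forall u, P u -> sqn v <= sqn u.
Proof.
move=> PK [v0 Pv0].
pose S := [set g | G g /\ [/\ swp g = false, hgt g = 0, P (tra g) & sqn (tra g) <= sqn v0]].
have finS : finite_set S.
  apply: sub_finite_set (sg_fin sg (sqn v0 + 1)) => g [Gg [_ h0 _ le]]; split => //.
  have bd (x y s : R) : x ^+ 2 + y ^+ 2 <= s -> `|x| <= s + 1 /\ `|y| <= s + 1.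
    by move=> h; rewrite !ler_norml; split; apply/andP; split; nra.
  move: le; rewrite /sqn /tra /planar !row2E => /bd [a b].
  apply: ord3_all => //; rewrite -/(hgt g) h0 normr0.
  by apply: addr_ge0 => //; apply: addr_ge0; exact: sqr_ge0.
have [g1 Gg1 [a b c]] := PK _ Pv0.
have [|g [Gg [_ h0 Pg le]] gm] := finite_min (sqn \o @tra R) finS.
  by exists g1; split => //; rewrite c.
exists (tra g) => // u Pu; have [g2 Gg2 [a2 b2 c2]] := PK _ Pu.
have [le2|lt] := leP (sqn u) (sqn v0); last exact: le_trans le (ltW lt).
by rewrite -c2; apply: gm; split => //; rewrite c2.
Qed.

(** Otherwise all swaps have the same height shift as one swap [s], since the product of two of them
    preserves heights. Orbits then meet at most two heights, and a point high enough cannot be moved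
    into the compact region. *)
Lemma height_nonzero : exists2 t, G t & swp t = false /\ hgt t != 0.
Proof.
apply: contrapT => h.
have h0 g : G g -> swp g = false -> hgt g = 0.
  by move=> Gg sw; apply: contrapT => /eqP n; apply: h; exists g.
have [r rP] := sg_cob sg.
have r0 : 0 <= r by have [g _ /(_ 0)] := rP 0; exact: le_trans.
have [[s [Gs ss]]|ns] := pselect (exists s, G s /\ swp s).
- have [g Gg /(_ 2)] := rP (row3 0 0 (r + `|hgt s| + 1)).
  rewrite (oriented_apply _ (Go Gg)).2 row3E; case sg_: (swp g); last first.
    rewrite (h0 g) // addr0 expr0 mul1r ger0_norm; have := normr_ge0 (hgt s); lra.
  have := h0 _ (Gc Gg Gs); rewrite swp_comp ?sg_ ?ss; [|exact: Go..].
  move=> /(_ erefl); rewrite hgt_comp ?sg_; last exact: Go.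
  rewrite expr1 !mulN1r => e.
  have -> : hgt g = hgt s by lra.
  rewrite ler_norml => /andP[]; have := ler_norm (hgt s); lra.
- have [g Gg /(_ 2)] := rP (row3 0 0 (r + 1)).
  have sw : swp g = false by apply/negP => sw; apply: ns; exists g.
  rewrite (oriented_apply _ (Go Gg)).2 row3E sw h0 // addr0 mul1r ger0_norm; lra.
Qed.

Lemma height_pos : exists2 t, G t & swp t = false /\ 0 < hgt t.
Proof.
have [t Gt [sw]] := height_nonzero; rewrite neq_lt => /orP[lt|]; last by exists t.
have [t' Gt' [tK t'K]] := Gi Gt; have [s' h' _ _] := inverse_maps Gt Gt' tK t'K.
by exists t' => //; rewrite s' h' sw mulNr mul1r oppr_gt0.
Qed.

Lemma height_neg : exists2 t, G t & swp t = false /\ hgt t < 0.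
Proof.
have [t Gt [sw lt]] := height_pos.
have [t' Gt' [tK t'K]] := Gi Gt; have [s' h' _ _] := inverse_maps Gt Gt' tK t'K.
by exists t' => //; rewrite s' h' sw mulNr mul1r oppr_lt0.
Qed.

Lemma lin_coord g v : G g -> swp g = false -> exists2 e, e ^+ 2 = 1 &
  lin g v 0 0 = e * expR (- hgt g) * v 0 0 /\ lin g v 0 1 = e * expR (hgt g) * v 0 1.
Proof.
by move=> Gg sw; have [e ee lE] := oriented_lin (Go Gg); exists e; rewrite // lE sw /scal !row2E.
Qed.

(** Among translations along a coordinate axis take a shortest one. Conjugation by an element whose
    height has the appropriate sign preserves the axis and shortens it. *)
Lemma translation_coord v : K v -> v != 0 -> v 0 0 != 0 /\ v 0 1 != 0.
Proof.
move=> Kv v0; apply: contrapT => bad.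
pose P := [set u | K u /\ u != 0 /\ (u 0 0 = 0 \/ u 0 1 = 0)].
have [|u [Ku [u0 uz]] um] := @translation_min P (fun u h => h.1).
  exists v; split => //; split => //; apply: contrapT => h; apply: bad.
  by split; apply/eqP => z; apply: h; [left|right].
have small (c : R) : c < 0 -> 0 < expR c < 1 by move=> c0; rewrite expR_gt0 expR_lt1.
have shrink (e a x : R) : e ^+ 2 = 1 -> 0 < a < 1 -> (e * a * x) ^+ 2 < x ^+ 2 \/ x = 0.
  move=> ee /andP[a0 a1]; have [->|x0] := eqVneq x 0; [by right|left].
  rewrite !exprMn ee mul1r gtr_pMl; last by rewrite lt0r sqrf_eq0 x0 sqr_ge0.
  by rewrite expr_lt1 // ltW.
have contra g : G g -> P (lin g u) -> sqn (lin g u) < sqn u -> False.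
  by move=> Gg Pg; rewrite ltNge um.
have nz g : G g -> lin g u != 0.
  move=> Gg; have [g' Gg' [gK g'K]] := Gi Gg.
  apply/eqP => z; move/eqP: u0; apply.
  have e2 : g' \o g = id by apply/funext.
  have := lin_comp u (Go Gg') (Go Gg); rewrite e2 z lin0; last exact: Go.
  by move=> <-; [rewrite lin_pl pl_id tra_pl ?pl_id ?subr0 //|]; exact: oriented_id.
case: uz => uz.
- have [t Gt [sw lt]] := height_neg; have [e ee [c0 c1]] := lin_coord u Gt sw.
  apply: (contra t Gt).
    split; [exact: translation_conj|split; [exact: nz|left]].
    by rewrite c0 uz mulr0.
  rewrite /sqn c0 c1 uz !mulr0 expr0n !add0r; case: (shrink e _ (u 0 1) ee (small _ lt)) => // z.
  by case/eqP: u0; apply: row2_eqP; rewrite ?uz ?z mxE.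
- have [t Gt [sw lt]] := height_pos; have [e ee [c0 c1]] := lin_coord u Gt sw.
  apply: (contra t Gt).
    split; [exact: translation_conj|split; [exact: nz|right]].
    by rewrite c1 uz mulr0.
  have lt' : - hgt t < 0 by rewrite oppr_lt0.
  rewrite /sqn c0 c1 uz !mulr0 expr0n !addr0; case: (shrink e _ (u 0 0) ee (small _ lt')) => // z.
  by case/eqP: u0; apply: row2_eqP; rewrite ?uz ?z mxE.
Qed.

Lemma fixed_point_uniq g u v : G g -> swp g = false -> hgt g != 0 ->
  pl g u = u -> pl g v = v -> u = v.
Proof.
move=> Gg sw h0 eu ev.
have e : lin g (u - v) = u - v.
  by rewrite linD ?linN ?lin_pl ?eu ?ev; [rewrite opprB addrA subrK|exact: Go..].
have [x xx [c0 c1]] := lin_coord (u - v) Gg sw; rewrite e in c0 c1.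
have E c := @sign_expR_neq1 R x c xx.
have z c (y : R) : c != 0 -> y = x * expR c * y -> y = 0.
  move=> /E n /eqP; rewrite eq_sym -subr_eq0 -{2}[y]mul1r -mulrBl mulf_eq0 subr_eq0 (negPf n).
  by move=> /eqP.
apply/eqP; rewrite -subr_eq0; apply/eqP/row2_eqP; rewrite [RHS]mxE.
  by apply: z c0; rewrite oppr_eq0.
exact: z c1.
Qed.

Lemma fixed_point g : G g -> swp g = false -> hgt g != 0 -> exists o, pl g o = o.
Proof.
move=> Gg sw h0; have [e ee lE] := oriented_lin (Go Gg).
have E c : c != 0 -> 1 - e * expR c != 0.
  by move=> c0; rewrite subr_eq0 eq_sym sign_expR_neq1.
have E1 := E _ h0; have E2 : 1 - e * expR (- hgt g) != 0 by apply: E; rewrite oppr_eq0.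
exists (row2 (tra g 0 0 / (1 - e * expR (- hgt g))) (tra g 0 1 / (1 - e * expR (hgt g)))).
by rewrite /pl lE sw /scal; apply: row2_eqP; rewrite !mxE /=; field.
Qed.

End SolGroup.

(** * The lattice of translations and the group of heights *)

Section SolLattice.
Variable R : realType.
Local Notation E3 := 'rV[R]_3.
Local Notation V := 'rV[R]_2.
Variable G : set (E3 -> E3).
Hypothesis sg : sol_group G.
Let Gid := sg_id sg.
Let Gc := sg_comp sg.
Let Gi := sg_inv sg.
Let Go := sg_oriented sg.
Local Notation K := (translations G).

(** The conjugate $gtg^{-1}$ has the height of $t$ or of $t^{-1}$. As there are no translations, the
    two act alike on the plane, so the conjugate fixes [o]. It also fixes the image of [o] under
    [g], and its fixed point is unique. *)
Lemma common_fixed_point o t : K `<=` [set 0] -> G t -> swp t = false -> hgt t != 0 ->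
  pl t o = o -> forall g, G g -> pl g o = o.
Proof.
move=> K0 Gt ts th to g Gg; have [g' Gg' [gK g'K]] := Gi Gg.
have [t' Gt' [tK t'K]] := Gi Gt.
have [gs' gh' gp1 gp2] := inverse_maps sg Gg Gg' gK g'K.
have [ts' th' tp1 tp2] := inverse_maps sg Gt Gt' tK t'K.
have triv k v : G k -> swp k = false -> hgt k = 0 -> pl k v = v.
  move=> Gk ks kh; rewrite /pl (translation_lin sg) // (K0 (tra k)) ?addr0 //.
  by exists k.
have Gtg := Gc Gt Gg'; have Gh := Gc Gg Gtg.
set h := g \o (t \o g') in Gh.
have hs : swp h = false.
  by rewrite (swp_comp (Go Gg) (Go Gtg)) (swp_comp (Go Gt) (Go Gg')) ts gs' addbb.
have hh : hgt h = (-1) ^+ swp g * hgt t.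
  rewrite (hgt_comp _ (Go Gg)) (hgt_comp _ (Go Gt)) ts gh' expr0 mul1r mulrDr mulNr mulrN mulrA.
  by rewrite -expr2 sqrr_sign mul1r addrAC addNr add0r.
have hE v : pl h v = pl g (pl t (pl g' v)).
  by rewrite (pl_comp _ (Go Gg) (Go Gtg) (Go Gh)) (pl_comp _ (Go Gt) (Go Gg') (Go Gtg)).
have to' : pl t' o = o by rewrite -{1}to tp2.
have ho : pl h o = o.
  case gs : (swp g); rewrite gs in hh.
    have := triv (h \o t) o (Gc Gh Gt); rewrite (swp_comp (Go Gh) (Go Gt)) hs ts => /(_ erefl).
    rewrite (hgt_comp _ (Go Gh)) hs hh expr0 mul1r expr1 mulN1r subrr => /(_ erefl).
    by rewrite (pl_comp _ (Go Gh) (Go Gt) (Go (Gc Gh Gt))) to.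
  have := triv (h \o t') o (Gc Gh Gt'); rewrite (swp_comp (Go Gh) (Go Gt')) hs ts' ts => /(_ erefl).
  rewrite (hgt_comp _ (Go Gh)) hs hh th' ts expr0 !mul1r mulN1r addNr => /(_ erefl).
  by rewrite (pl_comp _ (Go Gh) (Go Gt') (Go (Gc Gh Gt'))) to'.
apply: (fixed_point_uniq sg Gh hs) => //; last by rewrite hE gp2 to.
by rewrite hh mulf_neq0 // signr_eq0.
Qed.

(** Without translations the whole group fixes a point [o] of the plane and preserves $|xy|$ in
    coordinates centred there. Orbits with $|xy|$ large then avoid the compact region. *)
Lemma translation_exists : exists2 v, K v & v != 0.
Proof.
apply: contrapT => h.
have K0 : K `<=` [set 0].
  by move=> v Kv /=; apply: contrapT => /eqP v0; apply: h; exists v.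
have [t Gt [ts th]] := height_nonzero sg; have [ o oE] := fixed_point sg Gt ts th.
have fixo := common_fixed_point K0 Gt ts th oE.
(* For a point of the compact region, both coordinates relative to [o] are smaller than [m] in
   absolute value, so their product cannot be $\pm m^2$. *)
have [r rP] := sg_cob sg; pose m := `|r| + `|o 0 0| + `|o 0 1| + 1.
have [g Gg gm] := rP (row3 (o 0 0 + m) (o 0 1 + m) 0).
have [gp _] := oriented_apply (row3 (o 0 0 + m) (o 0 1 + m) 0) (Go Gg).
have pE : planar (row3 (o 0 0 + m) (o 0 1 + m) 0) = row2 m m + o.
  by apply: row2_eqP; rewrite !mxE /= addrC.
have lE' : planar (g (row3 (o 0 0 + m) (o 0 1 + m) 0)) = lin g (row2 m m) + o.
  rewrite gp pE /pl linD; last exact: Go.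
  by rewrite -addrA -/(pl g o) fixo.
have m0 : 0 < m by rewrite /m ltr_pwDr // !addr_ge0.
have [e ee lE] := oriented_lin (Go Gg).
have prod : `|lin g (row2 m m) 0 0 * lin g (row2 m m) 0 1| = m * m.
  rewrite lE /scal.
  have E : expR (- hgt g) * expR (hgt g) = 1 by rewrite -expRD addNr expR0.
  have -> : (if swp g then row2 (e * expR (- hgt g) * row2 m m 0 1) (e * expR (hgt g) * row2 m m 0 0)
    else row2 (e * expR (- hgt g) * row2 m m 0 0) (e * expR (hgt g) * row2 m m 0 1)) =
    row2 (e * expR (- hgt g) * m) (e * expR (hgt g) * m) by case: (swp g); rewrite !row2E.
  rewrite !row2E (_ : _ * _ * _ = e ^+ 2 * (expR (- hgt g) * expR (hgt g)) * (m * m)); last by ring.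
  by rewrite ee E !mul1r gtr0_norm // mulr_gt0.
have bd (j : 'I_2) : `|lin g (row2 m m) 0 j| <= `|r| + `|o 0 j|.
  have -> : lin g (row2 m m) 0 j = planar (g (row3 (o 0 0 + m) (o 0 1 + m) 0)) 0 j - o 0 j.
    by rewrite lE' [(_ + o) 0 j]mxE addrK.
  apply: le_trans (ler_normB _ _) _; apply: lerD => //.
  apply: le_trans (ler_norm r); rewrite /planar mxE; case: ifP => _; exact: gm.
have := ler_pM _ _ (bd 0) (bd 1); rewrite -normrM prod => /(_ (normr_ge0 _) (normr_ge0 _)).
rewrite leNgt => /negP; apply; apply: ltr_pM; rewrite ?addr_ge0 //.
  by rewrite /m; have := normr_ge0 (o 0 1); lra.
by rewrite /m; have := normr_ge0 (o 0 0); lra.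
Qed.

Definition det2 (u v : V) : R := u 0 0 * v 0 1 - u 0 1 * v 0 0.

Lemma det2_coord u v x : det2 u v != 0 ->
  x = (det2 x v / det2 u v) *: u + (det2 u x / det2 u v) *: v.
Proof. by rewrite /det2 => d0; apply: row2_eqP; rewrite !mxE; field. Qed.

Lemma det2_eq0 u v : u != 0 -> det2 u v = 0 -> exists a : R, v = a *: u.
Proof.
rewrite /det2 => u0 d0; have [z|nz] := eqVneq (u 0 0) 0.
  have nz : u 0 1 != 0.
    by apply: contra_neq u0 => z1; apply: row2_eqP; rewrite ?z ?z1 mxE.
  exists (v 0 1 / u 0 1); apply: row2_eqP; rewrite mxE ?divfK // z mulr0.
  move: d0; rewrite z mul0r sub0r => /eqP; rewrite oppr_eq0 mulf_eq0 (negPf nz) => /eqP ->.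
  by [].
exists (v 0 0 / u 0 0); apply: row2_eqP; rewrite mxE ?divfK //.
have -> : v 0 1 = (u 0 0 * v 0 1 - u 0 1 * v 0 0 + u 0 1 * v 0 0) / u 0 0 by field.
by rewrite d0 add0r; field.
Qed.

Lemma nearest_int (x : R) : exists k : int, `|x - k%:~R| <= 2^-1.
Proof.
exists (Num.floor (x + 2^-1)); have := floor_le_tmp (x + 2^-1).
have := floorD1_gt (x + 2^-1); rewrite intrD => b a.
rewrite ler_norml; apply/andP; split; lra.
Qed.

Lemma sqnZ (a : R) (v : V) : sqn (a *: v) = a ^+ 2 * sqn v.
Proof. by rewrite /sqn !mxE; ring. Qed.

Lemma sqn_gt0 (v : V) : v != 0 -> 0 < sqn v.
Proof.
move=> v0; rewrite lt0r /sqn addr_ge0 ?sqr_ge0 // andbT paddr_eq0 ?sqr_ge0 // !sqrf_eq0.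
by apply/negP => /andP[/eqP a /eqP b]; case/eqP: v0; apply: row2_eqP; rewrite ?a ?b mxE.
Qed.

(* Gauss reduction: the two successive minima form a basis. *)
Lemma translation_basis : exists u v, [/\ K u, K v, det2 u v != 0 &
  forall x, K x -> exists n m : int, x = n%:~R *: u + m%:~R *: v].
Proof.
have [|u [Ku u0] um] := @translation_min _ _ sg [set x | K x /\ x != 0] (fun x h => h.1).
  by have [v Kv v0] := translation_exists; exists v.
have [t Gt [ts th]] := height_nonzero sg.
have [|v [Kv duv] vm] := @translation_min _ _ sg [set x | K x /\ det2 u x != 0] (fun x h => h.1).
  (* Both coordinates of [u] are nonzero and [t] scales them by different factors, so [u] and
     [lin t u] are independent. *)
  exists (lin t u); split; first exact: translation_conj.
  have [e ee [c0 c1]] := lin_coord sg u Gt ts.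
  have [u00 u01] := translation_coord sg Ku u0.
  rewrite /det2 c0 c1 (_ : _ - _ = u 0 0 * u 0 1 * e * expR (- hgt t) * (expR (2 * hgt t) - 1)).
    have e0 : e != 0 by rewrite -sqrf_eq0 ee oner_eq0.
    have E0 : expR (- hgt t) != 0 by rewrite gt_eqF // expR_gt0.
    rewrite !mulf_neq0 //.
    have := @sign_expR_neq1 R 1 (2 * hgt t); rewrite expr1n mul1r subr_eq0; apply=> //.
    by rewrite mulf_neq0 // pnatr_eq0.
  have -> : expR (hgt t) = expR (- hgt t) * expR (2 * hgt t) by rewrite -expRD; congr expR; ring.
  by ring.
exists u, v; split => // x Kx; set a := det2 x v / det2 u v; set b := det2 u x / det2 u v.
have xE := det2_coord x duv; rewrite -/a -/b in xE.
have [n hn] := nearest_int a; have [m hm] := nearest_int b; exists n, m.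
pose y := x - (n%:~R *: u + m%:~R *: v).
have Ky : K y.
  by apply: translationD => //; apply: translationN => //; apply: translationD => //;
    exact: translationZ.
set al := a - n%:~R in hn; set be := b - m%:~R in hm.
have yE : y = al *: u + be *: v.
  by rewrite /y {1}xE /al /be !scalerBl opprD addrACA.
have sq_le (c : R) : `|c| <= 2^-1 -> c ^+ 2 <= 4^-1.
  rewrite ler_norml => /andP[? ?]; nra.
have be0 : be = 0.
  apply: contrapT => /eqP nz.
  have dy : det2 u y = be * det2 u v by rewrite yE /det2 !mxE; ring.
  have le : sqn v <= sqn y by apply: vm; split => //; rewrite dy mulf_neq0.
  have leu : sqn u <= sqn v.
    apply: um; split => //; apply: contra_neq duv => ->.
    by rewrite /det2 !mxE !mulr0 subrr.
  have vp : 0 < sqn v by apply: lt_le_trans leu; exact: sqn_gt0.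
  have a4 := sq_le _ hn; have b4 := sq_le _ hm.
  (* By the parallelogram law and $|al|,|be|\le1/2$, the two squared norms add up to at most
     [sqn v]. The second is positive, so [y] is shorter than [v] although independent of [u]. *)
  have cs : sqn y + sqn (al *: u - be *: v) = 2 * (al ^+ 2 * sqn u + be ^+ 2 * sqn v).
    by rewrite yE /sqn !mxE; ring.
  have q1 : al ^+ 2 * sqn u <= 4^-1 * sqn v.
    by apply: ler_pM => //; [exact: sqr_ge0|exact/ltW/sqn_gt0].
  have q2 : be ^+ 2 * sqn v <= 4^-1 * sqn v by rewrite ler_pM2r.
  have q3 : 0 < sqn (al *: u - be *: v).
    apply: sqn_gt0; apply: contra_neq nz => z.
    have /(congr1 (det2 u)) := z; rewrite /det2 !mxE => z2.
    have : be * det2 u v = 0 by rewrite /det2; lra.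
    by move=> /eqP; rewrite mulf_eq0 (negPf duv) orbF => /eqP.
  clear xE yE; lra.
have al0 : al = 0.
  apply: contrapT => /eqP nz.
  have y0 : y = al *: u by rewrite yE be0 scale0r addr0.
  have : sqn u <= sqn y by apply: um; split => //; rewrite y0 scaler_eq0 negb_or nz.
  rewrite y0 sqnZ leNgt => /negP; apply.
  have := sq_le _ hn; have := sqn_gt0 u0; nra.
by apply/eqP; rewrite -subr_eq0 -/y yE al0 be0 !scale0r addr0.
Qed.

(** Modulo the lattice, an element with height in a bounded interval has a bounded translation part,
    so only finitely many heights occur there. The least positive one generates, by Euclidean
    division. *)
Lemma height_generator : exists2 t, G t & [/\ swp t = false, 0 < hgt t &
  forall g, G g -> swp g = false -> exists n : int, hgt g = n%:~R * hgt t].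
Proof.
have [u [v [Ku Kv duv basis]]] := translation_basis.
have [t1 Gt1 [ts1 th1]] := height_pos sg.
pose r := sqn u + sqn v + 2 + hgt t1.
pose S := [set g | G g /\ [/\ swp g = false, 0 < hgt g <= hgt t1 & forall j, `|g 0 0 j| <= r]].
have finS : finite_set S.
  by apply: sub_finite_set (sg_fin sg r) => g [Gg [_ _ h]].
have reduce g : G g -> swp g = false -> 0 < hgt g <= hgt t1 -> exists2 k, S k & hgt k = hgt g.
  move=> Gg gs gh; have xE := det2_coord (tra g) duv.
  set a := det2 (tra g) v / _ in xE; set b := det2 u (tra g) / _ in xE.
  have [n hn] := nearest_int a; have [m hm] := nearest_int b.
  have Kx : K (- (n%:~R *: u + m%:~R *: v)).
    by apply: translationN => //; apply: translationD => //; exact: translationZ.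
  have [k Gk [ks kh kt]] := Kx; exists (k \o g); last first.
    by rewrite (hgt_comp _ (Go Gk)) ks kh expr0 mul1r addr0.
  have hE : hgt (k \o g) = hgt g by rewrite (hgt_comp _ (Go Gk)) ks kh expr0 mul1r addr0.
  split; first exact: Gc; split.
  - by rewrite (swp_comp (Go Gk) (Go Gg)) ks gs.
  - by rewrite hE.
  have tE : tra (k \o g) = (a - n%:~R) *: u + (b - m%:~R) *: v.
    rewrite (tra_comp _ (Go Gk)) (translation_lin sg) // kt {1}xE !scalerBl opprD.
    by rewrite addrACA.
  have bd (al be x y : R) : `|al| <= 2^-1 -> `|be| <= 2^-1 -> x ^+ 2 <= sqn u ->
      y ^+ 2 <= sqn v -> `|al * x + be * y| <= r.
    move=> h1 h2 h3 h4; apply: le_trans (ler_normD _ _) _; rewrite !normrM.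
    have n1 (z s : R) : z ^+ 2 <= s -> `|z| <= s + 1.
      by move=> ?; rewrite ler_norml; apply/andP; split; nra.
    have := n1 _ _ h3; have := n1 _ _ h4 => l4 l3.
    have := ler_pM (normr_ge0 _) (normr_ge0 _) h1 l3.
    have := ler_pM (normr_ge0 _) (normr_ge0 _) h2 l4.
    have := normr_ge0 x; have := normr_ge0 y.
    by rewrite /r; lra.
  have sq (w : V) j : w 0 j ^+ 2 <= sqn w.
    by case: j => -[|[|//]] i; rewrite /sqn ?lerDl ?lerDr;
     [rewrite (_ : Ordinal i = 0) ?lerDl ?sqr_ge0 //; exact: val_inj|
      rewrite (_ : Ordinal i = 1) ?lerDr ?sqr_ge0 //; exact: val_inj].
  have trj (j : 'I_2) : `|tra (k \o g) 0 j| <= r by rewrite tE !mxE; exact: bd.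
  apply: ord3_all.
  - by have := trj 0; rewrite /tra /planar row2E.
  - by have := trj 1; rewrite /tra /planar row2E.
  - rewrite -/(hgt (k \o g)) hE; case/andP: gh => g0 g1; rewrite gtr0_norm //.
    apply: le_trans g1 _; rewrite /r lerDr.
    have := sqr_ge0 (u 0 0); have := sqr_ge0 (u 0 1); have := sqr_ge0 (v 0 0).
    by have := sqr_ge0 (v 0 1); rewrite /sqn; lra.
have [|t [Gt [ts /andP[t0 tle] _]] tm] := finite_min (@hgt R) finS.
  have [|k Sk _] := reduce t1 Gt1 ts1; first by rewrite th1 lexx.
  by exists k.
exists t => //; split => // g Gg gs.
have [t' Gt' [tK t'K]] := Gi Gt.
have [ts' th' _ _] := inverse_maps sg Gt Gt' tK t'K.
rewrite ts expr0 mulN1r in th'; rewrite ts in ts'.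
pose n := Num.floor (hgt g / hgt t); exists n.
have zp (k : int) : [/\ G (zpow t t' k), swp (zpow t t' k) = false & hgt (zpow t t' k) = k%:~R * hgt t].
  elim/int_step_ind: k => [|k [G1 s1 h1]|k [G1 s1 h1]].
  - by split; [exact: Gid|exact: swp_id|rewrite hgt_id mul0r].
  - have -> : zpow t t' (k + 1) = t \o zpow t t' k by apply/funext => x /=; rewrite zpow_succ.
    split; [exact: Gc|by rewrite (swp_comp (Go Gt) (Go G1)) ts s1|].
    by rewrite (hgt_comp _ (Go Gt)) ts h1 expr0 mul1r intrD mulrDl mul1r.
  - have -> : zpow t t' (k - 1) = t' \o zpow t t' k by apply/funext => x /=; rewrite zpow_pred.
    split; [exact: Gc|by rewrite (swp_comp (Go Gt') (Go G1)) ts' s1|].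
    by rewrite (hgt_comp _ (Go Gt')) ts' h1 th' expr0 mul1r intrD mulrDl mulN1r.
have [Gz sz hz] := zp (- n).
pose d := hgt g - n%:~R * hgt t.
have dE : hgt (zpow t t' (- n) \o g) = d.
  by rewrite (hgt_comp _ (Go Gz)) sz hz expr0 mul1r mulrNz mulNr.
have d0 : 0 <= d.
  by rewrite /d subr_ge0 -ler_pdivlMr // floor_le_tmp.
have d1 : d < hgt t.
  rewrite /d ltrBlDl -{2}[hgt t]mul1r -mulrDl -ltr_pdivrMr //.
  by have := floorD1_gt (hgt g / hgt t); rewrite -intrD1.
have [d00|dn] := eqVneq d 0; first by apply/eqP; rewrite -subr_eq0 -/d d00.
have dp : 0 < d by rewrite lt0r dn.
have [|||k Sk kh] := reduce (zpow t t' (- n) \o g).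
- exact: Gc.
- by rewrite (swp_comp (Go Gz) (Go Gg)) sz gs.
- by rewrite dE dp (le_trans (ltW d1)).
by have := tm _ Sk; rewrite kh dE leNgt d1.
Qed.

End SolLattice.

Definition row_int (n m : int) : 'rV[int]_2 := \row_i (if i == 0 then n else m).

Lemma linV_mx2 (R : realType) (a b c d : int) (w : 'rV[R]_2) : linV (mx2 a b c d) w =
  row2 (a%:~R * w 0 0 + b%:~R * w 0 1) (c%:~R * w 0 0 + d%:~R * w 0 1).
Proof.
have sum2 (f : 'I_2 -> R) : \sum_i f i = f 0 + f 1.
  by rewrite big_ord_recl big_ord1; congr (_ + f _); exact: val_inj.
by rewrite /linV; apply: row2_eqP; rewrite mxE sum2 !mxE /=; ring.
Qed.

Lemma affine_cts (R : realType) (T : topologicalType) (f1 f2 f3 : T -> R) (k0 k1 k2 k3 : R) :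
  continuous f1 -> continuous f2 -> continuous f3 ->
  continuous (fun x => k0 + f1 x * k1 + f2 x * k2 + f3 x * k3).
Proof.
move=> c1 c2 c3 x.
apply: cvgD; last exact: mulr_cst_cts.
apply: cvgD; last exact: mulr_cst_cts.
by apply: cvgD; [exact: cvg_cst|exact: mulr_cst_cts].
Qed.

Section SolMappingTorus.
Variable R : realType.
Local Notation E3 := 'rV[R]_3.
Local Notation V := 'rV[R]_2.
Variable G : set (E3 -> E3).
Hypothesis sg : sol_group G.
Let Gid := sg_id sg.
Let Gc := sg_comp sg.
Let Gi := sg_inv sg.
Let Go := sg_oriented sg.
Local Notation K := (translations G).
Local Notation lat := (map_mx (intr : int -> R)).

Section Generator.
Variables (t t' : E3 -> E3).
Hypotheses (Gt : G t) (Gt' : G t') (tK : cancel t t') (t'K : cancel t' t).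
Hypotheses (ts : swp t = false) (th : 0 < hgt t).
Hypothesis gen : forall g, G g -> swp g = false -> exists n : int, hgt g = n%:~R * hgt t.

Lemma zpow_height (k : int) :
  [/\ G (zpow t t' k), swp (zpow t t' k) = false & hgt (zpow t t' k) = k%:~R * hgt t].
Proof.
have [ts' th' _ _] := inverse_maps sg Gt Gt' tK t'K.
rewrite ts expr0 mulN1r in th'; rewrite ts in ts'.
elim/int_step_ind: k => [|k [G1 s1 h1]|k [G1 s1 h1]].
- by split; [exact: Gid|exact: swp_id|rewrite hgt_id mul0r].
- have -> : zpow t t' (k + 1) = t \o zpow t t' k by apply/funext => x /=; rewrite zpow_succ.
  split; [exact: Gc|by rewrite (swp_comp (Go Gt) (Go G1)) ts s1|].
  by rewrite (hgt_comp _ (Go Gt)) ts h1 expr0 mul1r intrD mulrDl mul1r.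
- have -> : zpow t t' (k - 1) = t' \o zpow t t' k by apply/funext => x /=; rewrite zpow_pred.
  split; [exact: Gc|by rewrite (swp_comp (Go Gt') (Go G1)) ts' s1|].
  by rewrite (hgt_comp _ (Go Gt')) ts' h1 th' expr0 mul1r intrD mulrDl mulN1r.
Qed.

Lemma zpow_translation g : G g -> swp g = false -> exists (k : int) (f : E3 -> E3),
  [/\ G f, swp f = false, hgt f = 0 & g = f \o zpow t t' k].
Proof.
move=> Gg gs; have [k gk] := gen Gg gs; have [Gz sz hz] := zpow_height (- k).
exists k, (g \o zpow t t' (- k)); split.
- exact: Gc.
- by rewrite (swp_comp (Go Gg) (Go Gz)) gs sz.
- by rewrite (hgt_comp _ (Go Gg)) gs hz expr0 mul1r gk mulrNz mulNr addNr.
- by apply/funext => x /=; rewrite zpowNK.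
Qed.

End Generator.

(** [M] is the action of the generator [t] on the lattice, in the basis [u], [v]. In this basis,
    centred at the fixed point of [t] and with rescaled height, the group becomes the deck group of
    the mapping torus of [M]. *)
Lemma sol_mapping_torus (Y : topologicalType) (p : E3 -> Y) : gcover G p ->
  (forall g, G g -> swp g = false) ->
  exists M : 'M[int]_2, [/\ \det M = 1, 4 < trans2 M ^+ 2 &
    homeomorphic Y (mapping_torus (@linear_torus_map R M))].
Proof.
move=> gc nosw; have [t Gt [ts tpos gen]] := height_generator sg.
have [t' Gt' [tK t'K]] := Gi Gt.
have [ o oE] : exists o, pl t o = o by apply: (fixed_point sg Gt ts); rewrite gt_eqF.
have [u [v [Ku Kv d0 basis]]] := translation_basis sg.
set d := det2 u v in d0; pose c0 := hgt t.
have c00 : c0 != 0 by rewrite gt_eqF.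
have [a [b uE]] := basis _ (translation_conj sg Gt Ku).
have [c [e vE]] := basis _ (translation_conj sg Gt Kv).
pose M := mx2 a c b e.
have [la [lb [lab lE]]] : exists la lb : R, la * lb = 1 /\ lb = expR c0 * (la * expR c0) /\
    forall w, lin t w = row2 (la * w 0 0) (lb * w 0 1).
  have [x xx lE] := oriented_lin (Go Gt); exists (x * expR (- c0)), (x * expR c0).
  have E : expR (- c0) * expR c0 = 1 by rewrite -expRD addNr expR0.
  split; first by rewrite mulrACA -expr2 xx E mulr1.
  split; first by rewrite -mulrA E mulr1 mulrC.
  by move=> w; rewrite lE ts.
case: lE => lba lE.
have detM : \det M = 1.
  apply: (@intr_inj R); rewrite /M det_mx2 !mx2E rmorphB !rmorphM /=.
  apply: (mulIf d0); rewrite mul1r.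
  transitivity (det2 (lin t u) (lin t v)); first by rewrite uE vE /d /det2 !mxE; ring.
  by rewrite !lE /det2 !row2E /d /det2 -[RHS]mul1r -lab; ring.
have trM : 4 < trans2 M ^+ 2.
  have trE : (trans2 M)%:~R = la + lb :> R.
    rewrite /trans2 /M !mx2E rmorphD /=; apply: (mulIf d0).
    transitivity (det2 (lin t u) v + det2 u (lin t v)).
      by rewrite uE vE /d /det2 !mxE; ring.
    by rewrite !lE /det2 !row2E /d /det2; ring.
  rewrite -(@ltr_int R) rmorphXn /= trE.
  (* The eigenvalues [la] and [lb] have product 1 and differ because the height of [t] is nonzero,
     so $(\mathrm{tr}\,M)^2-4=(la-lb)^2>0$. *)
  have : (la - lb) ^+ 2 > 0.
    rewrite lt0r sqr_ge0 andbT sqrf_eq0 subr_eq0; apply/eqP => ll.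
    have la0 : la != 0 by apply/eqP => z; move/eqP: lab; rewrite z mul0r eq_sym oner_eq0.
    have := @sign_expR_neq1 R 1 (2 * c0); rewrite expr1n mul1r => /(_ erefl).
    rewrite mulf_neq0 ?pnatr_eq0 // => /(_ isT) /eqP; apply.
    apply: (mulfI la0); rewrite mulr1 {2}ll lba mulrCA -expRD mulrC.
    by rewrite [RHS]mulrC; congr (expR _ * _); ring.
  move=> pos; rewrite -subr_gt0 (_ : _ - _ = (la - lb) ^+ 2) //.
  by transitivity ((la + lb) ^+ 2 - 4 * (la * lb)); [rewrite lab mulr1|ring].
have [M' MM'] : exists M', M *m M' = 1%:M by exact: det1_inv.
have M'M := mulmx1C MM'.
exists M; split => //.
have tl := linear_torus_lift R MM'.
pose crd (w : V) : V := row2 (det2 w v / d) (det2 u w / d).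
have crdM w : crd (lin t w) = linV M (crd w).
  have wE := det2_coord w d0; rewrite -/d in wE.
  rewrite [in LHS]wE linD ?linZ ?uE ?vE; [|exact: Go..].
  by rewrite linV_mx2 /crd /d /det2; apply: row2_eqP; rewrite !row2E !mxE; field.
have crdD x y : crd (x + y) = crd x + crd y.
  by rewrite /crd /det2; apply: row2_eqP; rewrite !mxE /=; field.
have crdK (n m : int) : crd (n%:~R *: u + m%:~R *: v) = lat (row_int n m).
  by rewrite /crd /d /det2; apply: row2_eqP; rewrite !mxE /=; field.
(* With the fixed point [o] as origin, [t] becomes linear. The sign of the height is reversed
   because [t] raises heights while the deck transformation for $k=1$ lowers them. *)
pose F (q : E3) : V * R^o := (crd (planar q - o), - (q 0 2 / c0)).
pose F' (x : V * R^o) : E3 := row3 (o 0 0 + x.1 0 0 * u 0 0 + x.1 0 1 * v 0 0)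
  (o 0 1 + x.1 0 0 * u 0 1 + x.1 0 1 * v 0 1) (- c0 * (x.2 : R)).
have FK : cancel F F'.
  move=> q; rewrite /F /F' /crd /planar /d /det2; apply: row3_eqP;
    rewrite row3E !mxE /=; field => //.
have F'K : cancel F' F.
  move=> [x s]; rewrite /F /F' /crd /planar /d /det2; congr pair; last by rewrite row3E /=; field.
  by apply: row2_eqP; rewrite !mxE /=; field.
have cF : continuous F.
  apply: cvg_pairT => z.
    apply: (@rV_continuous R E3 2 (fun q => crd (planar q - o))) => j x.
    have aff (f : E3 -> R) (k1 k2 k0 : R) : (forall q, f q = q 0 0 * k1 + q 0 1 * k2 + k0) ->
        {for x, continuous f}.
      move=> fE; rewrite (_ : f = fun q => k0 + q 0 0 * k1 + q 0 1 * k2 + q 0 2 * 0); last first.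
        by apply/funext => q; rewrite fE; ring.
      by apply: affine_cts; exact: coord_cts.
    case: j => -[|[|//]] ij.
      apply: (aff _ (v 0 1 / d) (- v 0 0 / d) ((o 0 1 * v 0 0 - o 0 0 * v 0 1) / d)) => q.
      by rewrite /crd /planar /det2 !mxE /=; field.
    apply: (aff _ (- u 0 1 / d) (u 0 0 / d) ((o 0 0 * u 0 1 - o 0 1 * u 0 0) / d)) => q.
    by rewrite /crd /planar /det2 !mxE /=; field.
  rewrite (_ : (fun q => (F q).2) = fun q : E3 => q 0 2 * - c0^-1).
    by apply: mulr_cst_cts; exact: coord_cts.
  by apply/funext => q; rewrite /F /= mulrN.
have cF' : continuous F'.
  apply: rV_continuous => j x.
  have aff (f : V * R^o -> R) (k0 k1 k2 k3 : R) :
      (forall q : V * R^o, f q = k0 + q.1 0 0 * k1 + q.1 0 1 * k2 + q.2 * k3) -> {for x, continuous f}.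
    move=> fE; rewrite (_ : f = fun q => k0 + q.1 0 0 * k1 + q.1 0 1 * k2 + q.2 * k3); last exact/funext.
    have c1 k : continuous (fun q : V * R^o => q.1 0 k).
      by move=> y; apply: (@continuous_comp _ _ _ fst (fun w : V => w 0 k)); [exact: cvg_fst|exact: coord_cts].
    by apply: affine_cts; [exact: c1|exact: c1|move=> y; exact: cvg_snd].
  move: j; apply: ord3_all.
  - by apply: (aff _ (o 0 0) (u 0 0) (v 0 0) 0) => q; rewrite /F' row3E mulr0 addr0.
  - by apply: (aff _ (o 0 1) (u 0 1) (v 0 1) 0) => q; rewrite /F' row3E mulr0 addr0.
  - by apply: (aff _ 0 0 0 (- c0)) => q; rewrite /F' row3E !mulr0 !addr0 add0r mulrC.
pose D (x : V * R^o) : V * R^o := (linV M x.1, (x.2 : R) - 1).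
pose D' (x : V * R^o) : V * R^o := (linV M' x.1, (x.2 : R) + 1).
have FD q : F (t q) = D (F q).
  have [t1 t2] := oriented_apply q (Go Gt); rewrite /F /D /= t1 t2 ts; congr pair.
    rewrite -crdM; congr crd; transitivity (pl t (planar q) - pl t o); first by rewrite oE.
    by rewrite /pl opprD addrACA subrr addr0 linD ?linN //; exact: Go.
  by rewrite expr0 mul1r mulrDl divff // opprD.
have D'D x : D' (D x) = x.
  by case: x => x s; rewrite /D /D' /= linVM M'M linV1 subrK.
have FD' q : F (t' q) = D' (F q) by rewrite -{2}[q]t'K FD D'D.
have zD (k : int) x : zpow D D' k x = (zpow (linV M) (linV M') k x.1, (x.2 : R) - k%:~R).
  have DD' y : D (D' y) = y by case: y => y s; rewrite /D /D' /= linVM MM' linV1 addrK.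
  elim/int_step_ind: k => [|k IH|k IH]; first by case: x => x s; rewrite /= subr0.
    rewrite !zpow_succ ?IH /D /= ?intrD ?opprD ?addrA //; by [exact: (tl_K tl)|exact: (tl_K' tl)|exact: DD'|exact: D'D].
  rewrite !zpow_pred ?IH /D' /= ?intrD ?opprD ?opprK ?addrA //; by [exact: (tl_K tl)|exact: (tl_K' tl)|exact: DD'|exact: D'D].
have FG (f : E3 -> E3) (k : int) (n m : int) q : G f -> swp f = false -> hgt f = 0 ->
    tra f = n%:~R *: u + m%:~R *: v ->
    F (f (zpow t t' k q)) = mt_deck (linV M) (linV M') (row_int n m, k) (F q).
  move=> Gf fs fh ft; have [f1 f2] := oriented_apply (zpow t t' k q) (Go Gf).
  rewrite {1}/F f1 f2 fs fh addr0 expr0 mul1r /pl (translation_lin sg) // ft addrAC crdD crdK.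
  have := @zpow_conj _ _ t t' D D' F k q FD FD'; rewrite zD => -[-> e2].
  by rewrite /mt_deck /= -e2.
apply: (gcover_homeomorphic gc (mt_gcover tl) cF cF' FK F'K) => x y.
rewrite (mt_proj_eq tl); split=> [/(gc_eq gc) [g Gg ->]|[[n k] yE]].
  have [k [f [Gf fs fh ->]]] := zpow_translation Gt Gt' tK t'K ts gen Gg (nosw _ Gg).
  have Kf : K (tra f) by exists f.
  have [n [m ft]] := basis _ Kf; exists (row_int n m, k); exact: FG.
have Kn : K ((n 0 0)%:~R *: u + (n 0 1)%:~R *: v).
  by apply: translationD => //; exact: translationZ.
have [f Gf [fs fh ft]] := Kn; apply/(gc_eq gc).
have [Gz _ _] := zpow_height Gt Gt' tK t'K ts k.
exists (f \o zpow t t' k); first exact: Gc.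
apply: (can_inj FK); rewrite yE /= (FG _ _ _ _ _ Gf fs fh ft); congr mt_deck; congr pair.
by apply/rowP => -[[|[|//]] i]; rewrite mxE /=; congr (n _ _); exact: val_inj.
Qed.


(** * Groups that swap the foliations *)

Section Swaps.
Variables (t t' : E3 -> E3).
Hypotheses (Gt : G t) (Gt' : G t') (tK : cancel t t') (t'K : cancel t' t).
Hypotheses (ts : swp t = false) (th : 0 < hgt t).
Hypothesis gen : forall g, G g -> swp g = false -> exists n : int, hgt g = n%:~R * hgt t.
Variable o : V.
Hypothesis oE : pl t o = o.

Definition offset (g : E3 -> E3) : V := pl g o - o.
(** For a swap [g], the vector of the translation [g \o g]. The choice of [o] makes the powers of
    [t] have offset 0, so that every non-swap has its offset in the lattice. *)
Definition square_offset (g : E3 -> E3) : V := lin g (offset g) + offset g.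

Lemma pl_offset g : pl g o = o + offset g.
Proof. by rewrite /offset addrC subrK. Qed.

Lemma offset_comp f g : G f -> G g -> offset (f \o g) = lin f (offset g) + offset f.
Proof.
move=> Gf Gg; rewrite {1}/offset (pl_comp _ (Go Gf) (Go Gg) (Go (Gc Gf Gg))) (pl_offset g).
rewrite {1}/pl linD; last exact: Go.
by rewrite [offset f]/offset {1}/pl [lin f o + _]addrC -!addrA.
Qed.

Lemma offset_translation f : G f -> swp f = false -> hgt f = 0 -> offset f = tra f.
Proof. by move=> Gf fs fh; rewrite /offset /pl (translation_lin sg) // addrAC subrr add0r. Qed.

Lemma offset_zpow (k : int) : offset (zpow t t' k) = 0.
Proof.
have [_ _ p1 p2] := inverse_maps sg Gt Gt' tK t'K.
have oE' : pl t' o = o by rewrite -{1}oE p2.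
suff e : pl (zpow t t' k) o = o by rewrite /offset e subrr.
elim/int_step_ind: k => [|k IH|k IH]; first exact: pl_id.
- have e : zpow t t' (k + 1) = t \o zpow t t' k by apply/funext => x /=; rewrite zpow_succ.
  have [Gz _ _] := zpow_height Gt Gt' tK t'K ts k.
  by rewrite e (pl_comp _ (Go Gt) (Go Gz) (Go (Gc Gt Gz))) IH oE.
- have e : zpow t t' (k - 1) = t' \o zpow t t' k by apply/funext => x /=; rewrite zpow_pred.
  have [Gz _ _] := zpow_height Gt Gt' tK t'K ts k.
  by rewrite e (pl_comp _ (Go Gt') (Go Gz) (Go (Gc Gt' Gz))) IH oE'.
Qed.

Lemma offset_nonswap g : G g -> swp g = false -> K (offset g).
Proof.
move=> Gg gs; have [k [f [Gf fs fh ->]]] := zpow_translation Gt Gt' tK t'K ts gen Gg gs.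
have [Gz _ _] := zpow_height Gt Gt' tK t'K ts k.
rewrite (offset_comp Gf Gz) offset_zpow lin0 ?add0r; last exact: Go.
by rewrite offset_translation //; exists f.
Qed.

Lemma swap_square g : G g -> swp g ->
  [/\ G (g \o g), swp (g \o g) = false, hgt (g \o g) = 0 & tra (g \o g) = square_offset g].
Proof.
move=> Gg gs; have Ggg := Gc Gg Gg.
have s0 : swp (g \o g) = false by rewrite (swp_comp (Go Gg) (Go Gg)) addbb.
have h0 : hgt (g \o g) = 0 by rewrite (hgt_comp _ (Go Gg)) gs expr1 mulN1r addNr.
by split => //; rewrite -offset_translation // offset_comp.
Qed.

Lemma square_offset_translation g : G g -> swp g -> K (square_offset g).
Proof. by move=> Gg gs; have [Ggg s0 h0 <-] := swap_square Gg gs; exists (g \o g). Qed.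

Lemma lin_square_offset g : G g -> swp g -> lin g (square_offset g) = square_offset g.
Proof.
move=> Gg gs; rewrite /square_offset linD; last exact: Go.
by rewrite (lin_swap _ (Go Gg) gs) addrC.
Qed.

(* Otherwise [g] would be an affine involution, which has a fixed point. *)
Lemma square_offset_neq0 g : G g -> swp g -> square_offset g != 0.
Proof.
move=> Gg gs; apply/eqP => p0; have [Ggg s0 h0 tE] := swap_square Gg gs.
pose w := 2^-1 *: tra g.
pose q := row3 (w 0 0) (w 0 1) (hgt g / 2).
have [g1 g2] := oriented_apply q (Go Gg).
have lt : lin g (tra g) = - tra g.
  by apply/eqP; rewrite -addr_eq0 -(tra_comp _ (Go Gg)) tE p0.
have qE : planar q = w by apply: row2_eqP; rewrite row2E row3E.
suff e : g = id by move: gs; rewrite e swp_id.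
apply: (sg_free sg Gg (p := q)).
have : planar (g q) = w.
  rewrite g1 qE /pl /w linZ ?lt; last exact: Go.
  by apply: row2_eqP; rewrite !mxE; lra.
move=> /rowP z; apply: row3_eqP.
- by have := z 0; rewrite row2E /q row3E.
- by have := z 1; rewrite row2E /q row3E.
- by rewrite g2 gs expr1 /q row3E; lra.
Qed.

Lemma swap_translate g k : G g -> swp g -> K k -> exists f,
  [/\ G f, swp f, hgt f = hgt g, (forall v, lin f v = lin g v) &
      square_offset f = square_offset g + (lin g k + k)].
Proof.
move=> Gg gs [f Gf [fs fh ft]]; have Gfg := Gc Gf Gg; exists (f \o g).
have lE v : lin (f \o g) v = lin g v.
  by rewrite (lin_comp _ (Go Gf) (Go Gg) (Go Gfg)) (translation_lin sg).
split => //.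
- by rewrite (swp_comp (Go Gf) (Go Gg)) fs gs.
- by rewrite (hgt_comp _ (Go Gf)) fs fh addr0 expr0 mul1r.
- rewrite /square_offset lE (offset_comp Gf Gg) (translation_lin sg _ Gf fs fh) (offset_translation Gf fs fh) ft.
  by rewrite linD; [rewrite addrACA|exact: Go].
Qed.

Lemma swap_lin_eq f g : G f -> G g -> swp f -> swp g -> hgt f = hgt g ->
  forall v, lin f v = lin g v.
Proof.
move=> Gf Gg fs gs hE v; have [g' Gg' [gK g'K]] := Gi Gg.
have [gs' gh' _ _] := inverse_maps sg Gg Gg' gK g'K.
have Gfg := Gc Gf Gg'.
have e : f = (f \o g') \o g by apply/funext => x /=; rewrite gK.
rewrite {1}e (lin_comp _ (Go Gfg) (Go Gg)) -?e; last exact: Go.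
apply: (translation_lin sg _ Gfg).
  by rewrite (swp_comp (Go Gf) (Go Gg')) fs gs' gs.
by rewrite (hgt_comp _ (Go Gf)) fs gh' gs hE !expr1 opprK mul1r mulN1r addNr.
Qed.

Lemma lin_fixed_det g u v : G g -> swp g -> lin g u = u -> lin g v = v -> det2 u v = 0.
Proof.
move=> Gg gs; have [e ee lE] := oriented_lin (Go Gg); rewrite !lE gs /scal.
move=> /rowP /(_ 1) uE /rowP /(_ 1) vE; rewrite row2E in uE; rewrite row2E in vE.
by rewrite /det2 -uE -vE; ring.
Qed.

(** Swaps of equal height share their linear part, an involution with a fixed line, and their
    squares are multiples of the shortest lattice vector [u] on it. If one were an even multiple
    $2mu$, composing that swap with the translation by $-mu$ would give a swap with trivial square,
    which is impossible. *)
Lemma square_offset_odd s : G s -> swp s -> exists2 u, [/\ K u, u != 0 & lin s u = u] &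
  forall g, G g -> swp g -> hgt g = hgt s -> exists m : int, square_offset g = (m * 2 + 1)%:~R *: u.
Proof.
move=> Gs ss.
have [|u [Ku [u0 lu]] um] := @translation_min _ _ sg [set u | K u /\ u != 0 /\ lin s u = u] (fun x h => h.1).
  exists (square_offset s); split; first exact: square_offset_translation.
  by split; [exact: square_offset_neq0|exact: lin_square_offset].
have mult k : K k -> lin s k = k -> exists n : int, k = n%:~R *: u.
  move=> Kk lk; have [a kE] := det2_eq0 u0 (lin_fixed_det Gs ss lu lk).
  have [n hn] := nearest_int a; exists n; pose y := k - n%:~R *: u.
  have yE : y = (a - n%:~R) *: u by rewrite /y kE scalerBl.
  apply/eqP; rewrite -subr_eq0 -/y; apply: contrapT => /negP y0.
  have : sqn u <= sqn y.
    apply: um; split; first by apply: translationD => //; apply: translationN => //; exact: translationZ.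
    by split => //; rewrite yE linZ ?lu //; exact: Go.
  rewrite yE sqnZ leNgt => /negP; apply.
  have : (a - n%:~R) ^+ 2 <= 4^-1.
    by move: hn; rewrite ler_norml => /andP[? ?]; nra.
  have := sqn_gt0 u0; nra.
exists u => // g Gg gs hE; have lE := swap_lin_eq Gg Gs gs ss hE.
have [n nE] := mult _ (square_offset_translation Gg gs) (etrans (esym (lE _)) (lin_square_offset Gg gs)).
have [m [mE|mE]] : exists m : int, n = m * 2 \/ n = m * 2 + 1.
  by exists (n %/ 2)%Z; have := divz_eq n 2; have := ltz_pmod n (isT : 0 < 2 :> int);
     have := modz_ge0 n (isT : 2 != 0 :> int); lia.
  have Kk : K (- (m%:~R *: u)) by apply: translationN => //; exact: translationZ.
  have [f [Gf fs _ _ fE]] := swap_translate Gg gs Kk.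
  case/eqP: (square_offset_neq0 Gf fs); rewrite fE nE lE linN ?linZ ?lu; [|exact: Go..].
  by rewrite mE intrM -opprD -scalerDl -mulr2n mulr_natr subrr.
by exists m; rewrite nE mE.
Qed.

Definition half_odd (x : R) : Prop := exists m : int, x = m%:~R + 2^-1.
Definition is_int (x : R) : Prop := exists m : int, x = m%:~R.

(** Swaps have heights [hgt s - n%:~R * hgt t]. For swaps [f] and [h] of indices $k$ and $n$, the
    conjugate of [f] by [h] has index $2n-k$, and its square is the image under [lin h] of the
    square [p] of [f]. Comparing the squares of [h] and of its composite with the translation by [p]
    shows that [l (lin h p) + l p] is an integer. So the property passes from $2n-k$ to $k$, and two
    adjacent indices suffice. *)
Lemma half_odd_height (l : V -> R) s : {morph l : x y / x + y} -> G s -> swp s ->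
  (forall g, G g -> swp g -> hgt g = hgt s -> half_odd (l (square_offset g))) ->
  (forall g, G g -> swp g -> hgt g = hgt s - hgt t -> half_odd (l (square_offset g))) ->
  forall g, G g -> swp g -> half_odd (l (square_offset g)).
Proof.
move=> lD Gs ss l0 l1 g Gg gs.
pose P (n : int) := forall g, G g -> swp g -> hgt g = hgt s - n%:~R * hgt t ->
  half_odd (l (square_offset g)).
have sw (n : int) : exists h, [/\ G h, swp h & hgt h = hgt s - n%:~R * hgt t].
  have [Gz sz hz] := zpow_height Gt Gt' tK t'K ts n.
  exists (s \o zpow t t' n); split; first exact: Gc.
    by rewrite (swp_comp (Go Gs) (Go Gz)) ss sz.
  by rewrite (hgt_comp _ (Go Gs)) hz ss expr1 mulN1r addrC.
(* The swap in the middle conjugates the swaps on one side of it to those on the other. *)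
have step (n m k : int) : m + k = n * 2 -> P n -> P m -> P k.
  move=> nmk Pn Pm f Gf fs fh; have [h [Gh hs hh]] := sw n.
  have [h' Gh' [hK h'K]] := Gi Gh.
  have [hs' hh' _ _] := inverse_maps sg Gh Gh' hK h'K.
  rewrite hs expr1 opprK mul1r in hh'.
  have Gfh := Gc Gf Gh'; have Ghfh := Gc Gh Gfh.
  have cs : swp (h \o (f \o h')).
    by rewrite (swp_comp (Go Gh) (Go Gfh)) (swp_comp (Go Gf) (Go Gh')) hs fs hs' hs.
  have ch : hgt (h \o (f \o h')) = hgt s - m%:~R * hgt t.
    rewrite (hgt_comp _ (Go Gh)) (hgt_comp _ (Go Gf)) hs fs hh' hh fh expr1.
    have : m%:~R + k%:~R = n%:~R * 2 :> R by rewrite -intrD nmk intrM.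
    move=> e; have -> : m%:~R = n%:~R * 2 - k%:~R :> R by rewrite -e addrK.
    by ring.
  have [a aE] := Pm _ Ghfh cs ch.
  have [b bE] := Pn _ Gh hs hh.
  have Kf := square_offset_translation Gf fs.
  have [h2 [Gh2 h2s h2h _ h2E]] := swap_translate Gh hs Kf.
  have [c cE] := Pn _ Gh2 h2s (etrans h2h hh).
  have fE : square_offset (h \o (f \o h')) = lin h (square_offset f).
    have [Gff ff0 ffh ffE] := swap_square Gf fs.
    have [Gcc c0 c_h <-] := swap_square Ghfh cs.
    have -> : (h \o (f \o h')) \o (h \o (f \o h')) = h \o ((f \o f) \o h').
      by apply/funext => x /=; rewrite hK.
    have G3 := Gc Gff Gh'.
    have := pl_comp 0 (Go Gh) (Go G3) (Go (Gc Gh G3)).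
    rewrite -(tra_pl (Go (Gc Gh G3))) => ->.
    rewrite (pl_comp _ (Go Gff) (Go Gh') (Go G3)) {2}/pl (translation_lin sg _ Gff ff0 ffh) ffE.
    rewrite /pl linD; last exact: Go.
    have [_ _ p1 _] := inverse_maps sg Gh Gh' hK h'K.
    by rewrite addrAC -/(pl h _) -/(pl h' 0) p1 add0r.
  exists (c - b - a - 1).
  have : l (square_offset h2) = l (square_offset h) + (l (lin h (square_offset f)) + l (square_offset f)).
    by rewrite h2E !lD.
  rewrite cE bE -fE aE !intrB => e.
  lra.
have all n : P n /\ P (n + 1).
  elim/int_step_ind: n => [|n [P0 P1]|n [P0 P1]].
  - by split=> f Gf fs fh; [apply: l0|apply: l1] => //; rewrite fh ?add0r ?mul0r ?subr0 ?mul1r.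
  - by split=> //; apply: step P1 P0; lia.
  - by split; [apply: step P0 P1; lia|rewrite subrK].
have Gsg := Gc Gs Gg.
have [|n nE] := gen Gsg; first by rewrite (swp_comp (Go Gs) (Go Gg)) ss gs.
apply: (all n).1 => //; move: nE; rewrite (hgt_comp _ (Go Gs)) ss expr1 => <-.
by ring.
Qed.

(** The swaps [s] and [s \o t] have different reflections as linear parts, so the vectors [u] and
    [v] of [square_offset_odd] form a basis. The functional with value $1/2$ on both is half-odd on
    their odd multiples. *)
Lemma half_odd_functional s : G s -> swp s -> exists l : V -> R,
  {morph l : x y / x + y} /\ forall g, G g -> swp g -> half_odd (l (square_offset g)).
Proof.
move=> Gs ss; have Gst := Gc Gs Gt.
have s2 : swp (s \o t) by rewrite (swp_comp (Go Gs) (Go Gt)) ss ts.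
have h2 : hgt (s \o t) = hgt s - hgt t by rewrite (hgt_comp _ (Go Gs)) ss expr1 mulN1r addrC.
have [u [Ku u0 uE] uP] := square_offset_odd Gs ss.
have [v [Kv v0 vE] vP] := square_offset_odd Gst s2.
have d0 : det2 u v != 0.
  have [u00 _] := translation_coord sg Ku u0; have [v00 _] := translation_coord sg Kv v0.
  have [e ee eE] := oriented_lin (Go Gs); have [f ff fE] := oriented_lin (Go Gst).
  move/rowP/(_ 1): uE; move/rowP/(_ 1): vE; rewrite eE fE ss s2 /scal !row2E /det2 => <- <-.
  have E0 : expR (hgt s - hgt t) != 0 by rewrite gt_eqF ?expR_gt0.
  have e0 : e != 0 by rewrite -sqrf_eq0 ee oner_eq0.
  have f0 : f != 0 by rewrite -sqrf_eq0 ff oner_eq0.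
  have EE : expR (hgt s) = expR (hgt s - hgt t) * expR (hgt t) by rewrite -expRD subrK.
  rewrite h2 (_ : _ - _ = u 0 0 * v 0 0 * f * expR (hgt s - hgt t) * (1 - e * f * expR (hgt t))).
    rewrite !mulf_neq0 // subr_eq0 eq_sym sign_expR_neq1 ?gt_eqF //.
    by rewrite exprMn ee ff mul1r.
  rewrite EE; transitivity (u 0 0 * v 0 0 * expR (hgt s - hgt t) * (f - f ^+ 2 * e * expR (hgt t))).
    by rewrite ff; ring.
  by ring.
pose l (x : V) := (2 * det2 u v)^-1 * (det2 x v + det2 u x).
have two : (2 : R) != 0 by rewrite pnatr_eq0.
have lD : {morph l : x y / x + y} by move=> x y; rewrite /l -mulrDr; congr (_ * _); rewrite /det2 !mxE; ring.
have lodd (m : int) w : l w = 2^-1 -> half_odd (l ((m * 2 + 1)%:~R *: w)).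
  move=> lw; exists m; have -> : l ((m * 2 + 1)%:~R *: w) = (m * 2 + 1)%:~R * l w.
    by rewrite /l [RHS]mulrCA; congr (_ * _); rewrite /det2 !mxE; ring.
  by rewrite lw intrD intrM; lra.
exists l; split => //; apply: (half_odd_height lD Gs ss) => g Gg gs gh.
  have [m ->] := uP g Gg gs gh; apply: lodd.
  by rewrite /l [X in _ * (_ + X)](_ : _ = 0) ?addr0; [field|rewrite /det2; ring].
have [m ->] := vP g Gg gs (etrans gh (esym h2)); apply: lodd.
by rewrite /l [X in _ * (X + _)](_ : _ = 0) ?add0r; [field|rewrite /det2; ring].
Qed.

End Swaps.

(** Swaps go to flips and the other elements to rotations. The square of a swap then goes to a
    rotation by an odd multiple of $\pi$, which is the square of a flip. *)
Lemma sol_swap_nonabelian s : G s -> swp s -> exists (r : (E3 -> E3) -> 'M[R[i]]_2) g h,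
  [/\ SU2_hom G r, G g, G h & r g *m r h <> r h *m r g].
Proof.
move=> Gs ss; have [t Gt [ts tpos gen]] := height_generator sg.
have [t' Gt' [tK t'K]] := Gi Gt.
have [ o oE] : exists o, pl t o = o by apply: (fixed_point sg Gt ts); rewrite gt_eqF.
have [l [lD lodd]] := half_odd_functional Gt Gt' tK t'K ts tpos gen o Gs ss.
have l0 : l 0 = 0 by apply: (addrI (l 0)); rewrite -lD !addr0.
pose sh := offset o.
(* The coefficient of the height makes [t] a quarter turn, which does not commute with flips; swaps
   reverse heights as flips reverse angles. *)
pose theta g := 2 * pi * l (sh g) + pi / (2 * hgt t) * hgt g.
have one_plus a k : G a -> swp a -> K k -> is_int (l (lin a k) + l k).
  move=> Ga sa Kk; have [f [Gf fs _ _ fE]] := swap_translate o Ga sa Kk.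
  have [m mE] := lodd _ Ga sa; have [n nE] := lodd _ Gf fs.
  exists (n - m); move: nE; rewrite fE lD mE lD intrB => e; lra.
have swap2 a h : G a -> swp a -> G h -> swp h -> half_odd (l (lin a (sh h)) + l (sh h)).
  move=> Ga sa Gh s_h; have [a' Ga' [aK a'K]] := Gi Ga.
  have [sa' _ _ _] := inverse_maps sg Ga Ga' aK a'K.
  have Gah := Gc Ga' Gh.
  have sah : swp (a' \o h) = false by rewrite (swp_comp (Go Ga') (Go Gh)) sa' sa s_h.
  have Kk := offset_nonswap Gt Gt' tK t'K ts gen oE Gah sah.
  have hE : h = a \o (a' \o h) by apply/funext => x /=; rewrite a'K.
  set b := a' \o h in Gah sah Kk hE.
  have shE : offset o h = lin a (offset o b) + offset o a by rewrite {1}hE offset_comp.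
  have [m mE] := lodd _ Ga sa; have [n nE] := one_plus _ _ Ga sa Kk.
  rewrite /square_offset lD in mE.
  have E1 : l (sh h) = l (lin a (offset o b)) + l (offset o a) by rewrite /sh shE lD.
  have E2 : l (lin a (sh h)) = l (offset o b) + l (lin a (offset o a)).
    by rewrite /sh shE linD; [rewrite (lin_swap _ (Go Ga) sa) lD|exact: Go].
  by exists (m + n); rewrite E1 E2 intrD; lra.
have factor g : G g -> swp g = false -> forall h, G h -> swp h -> exists2 a, G a /\ swp a & g = a \o h.
  move=> Gg gs h Gh s_h; have [h' Gh' [hK h'K]] := Gi Gh.
  have [sh' _ _ _] := inverse_maps sg Gh Gh' hK h'K.
  exists (g \o h'); last by apply/funext => x /=; rewrite hK.
  by split; [exact: Gc|rewrite (swp_comp (Go Gg) (Go Gh')) gs sh' s_h].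
have thD g h : G g -> G h -> exists k : int, theta (g \o h) =
    theta g + (-1) ^+ swp g * theta h + (pi : R) * (swp g && swp h)%:R + 2 * (pi : R) * k%:~R.
  (* The heights satisfy the cocycle rule exactly. So [x] is the whole discrepancy, divided by
     $2\pi$, and its integrality is checked in the four cases. *)
  move=> Gg Gh; pose x := l (lin g (sh h)) - (-1) ^+ swp g * l (sh h) - 2^-1 * (swp g && swp h)%:R.
  suff [k kE] : is_int x.
    exists k; rewrite -kE /theta /sh offset_comp // lD (hgt_comp _ (Go Gg)) /x -/sh.
    by field; rewrite gt_eqF.
  rewrite /x; case gs: (swp g); case hs: (swp h); rewrite /= ?expr1 ?expr0 ?mulN1r ?opprK ?mul1r ?mulr1 ?mulr0 ?subr0.
  - by have [m ->] := swap2 _ _ Gg gs Gh hs; exists m; rewrite addrK.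
  - by apply: one_plus => //; exact: (offset_nonswap Gt Gt' tK t'K ts gen oE).
  - have [a [Ga sa] gE] := factor _ Gg gs _ Gh hs.
    have [m mE] := swap2 _ _ Ga sa Gh hs; have [n nE] := lodd _ Gh hs.
    have [k kE] := one_plus _ _ Ga sa (square_offset_translation o Gh hs).
    have e : lin g (sh h) + lin a (sh h) = lin a (square_offset o h).
      rewrite gE (lin_comp _ (Go Ga) (Go Gh)) -?gE; last exact: Go.
      by rewrite /square_offset linD //; exact: Go.
    exists (k - n - m - 1); move/(congr1 l): e; rewrite lD => e.
    rewrite !intrB; lra.
  - have [a [Ga sa] gE] := factor _ Gg gs _ Gs ss.
    have Kh := offset_nonswap Gt Gt' tK t'K ts gen oE Gh hs.
    have [m mE] := one_plus _ _ Ga sa (translation_conj sg Gs Kh).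
    have [n nE] := one_plus _ _ Gs ss Kh.
    exists (m - n); rewrite gE (lin_comp _ (Go Ga) (Go Gs)) -?gE; last exact: Go.
    rewrite intrB -mE -nE; ring.
have thT : theta t = pi / 2.
  by rewrite /theta /sh /offset oE subrr l0 mulr0 add0r; field; rewrite gt_eqF.
have [||r rhom rn] := @dihedral_nonabelian R _ G (@swp R) theta t s _ thD Gt Gs ts ss.
- by move=> g h Gg Gh; rewrite (swp_comp (Go Gg) (Go Gh)).
- by rewrite thT sin_pihalf oner_eq0.
by exists r, t, s.
Qed.

End SolMappingTorus.

(** * Orientation *)

Lemma mul_eq1_neq0 (R : realType) (a b : R) : 1 = a * b -> a != 0.
Proof. by move=> e; apply/eqP => a0; move/eqP: e; rewrite a0 mul0r oner_eq0. Qed.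

Lemma mulmx_inj (R : realType) n m (A B : 'M[R]_(n, m)) :
  (forall v : 'rV_n, v *m A = v *m B) -> A = B.
Proof. by move=> h; apply/row_matrixP => i; rewrite !rowE h. Qed.

Section LocalCalculus.
Variable R : realType.

Lemma near_nbhs (T : topologicalType) (x : T) (A : set T) : nbhs x A ->
  \forall y \near x, nbhs y A.
Proof. exact: nbhs_interior. Qed.

Lemma near_eq_differentiable (V W : normedModType R) (f g : V -> W) (x : V) :
  (\forall y \near x, f y = g y) -> differentiable f x ->
  differentiable g x /\ 'd g x = 'd f x :> (V -> W).
Proof.
move=> fg df; have [c e] := (diff_locallyP x f).1 df.
have E : g \o shift x = cst (g x) + 'd f x +o_ 0 id.
  apply/eqaddoP => eps eps0; move/eqaddoP: e => /(_ eps eps0).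
  have fg0 : \forall h \near (0 : V), f (h + x) = g (h + x).
    by move: fg; rewrite (near_shift 0) subr0; apply: filterS.
  apply: filter_app; apply: filterS fg0 => h /= eh.
  have ex := nbhs_singleton fg.
  suff -> : (g \o shift x - (cst (g x) + 'd f x)) h = (f \o shift x - (cst (f x) + 'd f x)) h by [].
  exact: (congr2 (fun a b => a - (b + 'd f x h)) (esym eh) (esym ex)).
have dE := diff_unique c E; split; last exact: dE.
by apply/diff_locallyP; rewrite dE.
Qed.

Variables n m : nat.
Implicit Types (M : 'M[R]_(n, m)) (c : 'rV[R]_m).

Lemma affine_diff M c (x : 'rV[R]_n) : differentiable (fun v => v *m M + c) x /\
  'd (fun v => v *m M + c) x = mulmxr M :> ('rV[R]_n -> 'rV[R]_m).
Proof.
have cM : continuous (mulmxr M : 'rV[R]_n -> 'rV[R]_m) by exact: mulmxr_continuous.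
have E : (fun v : 'rV[R]_n => v *m M + c) = (mulmxr M : 'rV[R]_n -> 'rV[R]_m) + cst c by [].
have d1 : differentiable (mulmxr M : 'rV[R]_n -> 'rV[R]_m) x by exact: linear_differentiable.
have d2 : differentiable (cst c : 'rV[R]_n -> 'rV[R]_m) x by exact: differentiable_cst.
rewrite E; split; first exact: differentiableD.
apply/funext => v; apply: etrans (congr1 (fun F => F v) (diffD d1 d2)) _.
apply: etrans (congr2 +%R (congr1 (fun F => F v) (diff_lin x cM)) (congr1 (fun F => F v) (diff_cst c x))) _.
exact: addr0.
Qed.

Lemma jacobian_affine M c x : 'J (fun v => v *m M + c) x = M.
Proof.
apply: mulmx_inj => v; apply: etrans (mul_rV_lin1 _ v) _.
exact: (congr1 (fun F => F v) (affine_diff M c x).2).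
Qed.

(** The deck groups in use act by affine maps, so the coordinate expressions of the maps constructed
    below are affine near each point. This class is closed under directional derivatives, which
    gives smoothness of every order by induction. *)
Definition locally_affine (U : set 'rV[R]_n) (h : 'rV[R]_n -> 'rV[R]_m) : Prop :=
  forall x, U x -> exists M c, \forall y \near x, h y = y *m M + c.

Lemma locally_affine_smooth U h : locally_affine U h -> smooth_on U h.
Proof.
move=> + k; elim: k h => [|k IH] h la /=.
  move=> x Ux; have [M [c e]] := la x Ux.
  apply: (@near_continuous _ _ (fun v : 'rV[R]_n => v *m M + c)).
    by apply: filterS e => y ->.
  by apply: differentiable_continuous; exact: (affine_diff M c x).1.
split=> [x Ux|v].
  have [M [c e]] := la x Ux.
  apply: (near_eq_differentiable _ (affine_diff M c x).1).1.
  by apply: filterS e => y ->.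
apply: IH => x Ux; have [M [c e]] := la x Ux; exists 0, (v *m M).
apply: filterS (near_nbhs e) => y ey; rewrite mulmx0 add0r.
have ey' : \forall z \near y, (fun v => v *m M + c) z = h z by apply: filterS ey => z ->.
have [dh dE] := near_eq_differentiable ey' (affine_diff M c y).1.
apply: etrans (deriveE v dh) (etrans (congr1 (fun F => F v) dE) _).
exact: (congr1 (fun F => F v) (affine_diff M c y).2).
Qed.

End LocalCalculus.

Section C1.
Variable R : realType.

Lemma sum_at (T : topologicalType) (I : Type) (r : seq I) (f : I -> T -> R) (x : T) :
  (forall i, {for x, continuous (f i)}) -> {for x, continuous (fun y => \sum_(i <- r) f i y)}.
Proof.
move=> cf; elim: r => [|i r IH].
  by rewrite (_ : (fun y => _) = cst 0); [exact: cvg_cst|apply/funext => y; rewrite big_nil].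
rewrite (_ : (fun y => _) = (fun y => f i y + \sum_(i <- r) f i y)); last first.
  by apply/funext => y; rewrite big_cons.
by apply: cvgD; [exact: cf|exact: IH].
Qed.

Lemma mul_at (T : topologicalType) (f g : T -> R) (x : T) :
  {for x, continuous f} -> {for x, continuous g} -> {for x, continuous (fun y => f y * g y)}.
Proof. by move=> cf cg; exact: cvgM. Qed.

Lemma prod_at (T : topologicalType) (I : Type) (r : seq I) (f : I -> T -> R) (x : T) :
  (forall i, {for x, continuous (f i)}) -> {for x, continuous (fun y => \prod_(i <- r) f i y)}.
Proof.
move=> cf; elim: r => [|i r IH].
  by rewrite (_ : (fun y => _) = cst 1); [exact: cvg_cst|apply/funext => y; rewrite big_nil].
rewrite (_ : (fun y => _) = (fun y => f i y * \prod_(i <- r) f i y)); last first.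
  by apply/funext => y; rewrite big_cons.
by apply: cvgM; [exact: cf|exact: IH].
Qed.

Lemma det_at (T : topologicalType) n (A : T -> 'M[R]_n) (x : T) :
  (forall i j, {for x, continuous (fun y => A y i j)}) -> {for x, continuous (fun y => \det (A y))}.
Proof.
move=> cA; rewrite /determinant; apply: sum_at => s; apply: mul_at; first exact: cvg_cst.
by apply: prod_at => i; exact: cA.
Qed.

(** Enough regularity for the sign of a Jacobian determinant to be locally constant where it does
    not vanish, and stable under composition. *)
Definition C1 n m (h : 'rV[R]_n -> 'rV[R]_m) (p : 'rV[R]_n) : Prop :=
  (\forall q \near p, differentiable h q) /\
  forall i j, {for p, continuous (fun q => 'J h q i j)}.

Lemma near_eq_jacobian n m (h k : 'rV[R]_n -> 'rV[R]_m) p : (\forall q \near p, h q = k q) ->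
  differentiable h p -> 'J k p = 'J h p.
Proof.
move=> e dh; have [_ dE] := near_eq_differentiable e dh.
apply: mulmx_inj => v; apply: etrans (mul_rV_lin1 _ v) _.
exact: etrans (congr1 (fun F => F v) dE) (esym (mul_rV_lin1 _ v)).
Qed.

Lemma C1_near n m (h k : 'rV[R]_n -> 'rV[R]_m) p : (\forall q \near p, h q = k q) ->
  C1 h p -> C1 k p.
Proof.
move=> e [dh ch]; have e2 := near_nbhs e; split.
  apply: filter_app dh; apply: filterS e2 => q eq dq; exact: (near_eq_differentiable eq dq).1.
move=> i j; apply: near_continuous (ch i j).
by apply: filter_app dh; apply: filterS e2 => q eq dq; rewrite (near_eq_jacobian eq dq).
Qed.

Lemma jacobian_comp n m l (k : 'rV[R]_n -> 'rV[R]_m) (h : 'rV[R]_m -> 'rV[R]_l) p :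
  differentiable k p -> differentiable h (k p) -> 'J (h \o k) p = 'J k p *m 'J h (k p).
Proof.
move=> dk dh; apply: mulmx_inj => v; apply: etrans (mul_rV_lin1 _ v) _.
apply: etrans (congr1 (fun F => F v) (diff_comp dk dh)) _.
apply: etrans (esym (mul_rV_lin1 ('d h (k p)) ('d k p v))) _; rewrite mulmxA.
exact: (congr1 (mulmx^~ _) (esym (mul_rV_lin1 _ v))).
Qed.

Lemma C1_comp n m l (k : 'rV[R]_n -> 'rV[R]_m) (h : 'rV[R]_m -> 'rV[R]_l) p :
  C1 k p -> C1 h (k p) -> C1 (h \o k) p.
Proof.
move=> [dk ck] [dh ch]; have ckp : {for p, continuous k}.
  by apply: differentiable_continuous; exact: nbhs_singleton dk.
have dh' : \forall q \near p, differentiable h (k q) by exact: (ckp _ dh).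
split; first by apply: filter_app dh'; apply: filterS dk => q a b; exact: differentiable_comp.
move=> i j; apply: (@near_continuous _ _ (fun q => \sum_a 'J k q i a * 'J h (k q) a j)).
  apply: filter_app dh'; apply: filterS dk => q a b; rewrite jacobian_comp //.
  by rewrite [RHS]mxE.
apply: sum_at => a; apply: (mul_at (ck i a)).
by apply: (@continuous_comp _ _ _ k (fun y => 'J h y a j)) => //; exact: ch.
Qed.

Lemma C1_smooth n m (U : set 'rV[R]_n) (h : 'rV[R]_n -> 'rV[R]_m) p : nbhs p U -> smooth_on U h -> C1 h p.
Proof.
move=> Up sh; have [dh Dh] := sh 1%N.
have dn : \forall q \near p, differentiable h q by apply: filterS Up => q; exact: dh.
split=> // i j; apply: (@near_continuous _ _ (fun q => 'D_(delta_mx 0 i) h q 0 j)).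
  by apply: filterS dn => q dq; rewrite deriveE // /jacobian -mul_rV_lin1 -rowE mxE.
apply: (@continuous_comp _ _ _ (fun q => 'D_(delta_mx 0 i) h q) (fun v : 'rV[R]_m => v 0 j)).
  by apply: Dh; exact: nbhs_singleton.
exact: coord_cts.
Qed.

Lemma det_jacobian_neq0 n (k h : 'rV[R]_n -> 'rV[R]_n) p : differentiable k p ->
  differentiable h (k p) -> (\forall q \near p, h (k q) = q) -> \det ('J k p) != 0.
Proof.
move=> dk dh e; have e' : \forall q \near p, (h \o k) q = q *m 1%:M + 0.
  by apply: filterS e => q /= ->; rewrite mulmx1 addr0.
have := near_eq_jacobian e' (differentiable_comp dk dh).
rewrite jacobian_affine jacobian_comp // => /(congr1 determinant).
rewrite det1 det_mulmx; exact: mul_eq1_neq0.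
Qed.

End C1.

Section CoverCharts.
Variables (R : realType) (n : nat) (T : topologicalType).
Implicit Types c d : chart R n T.

Lemma chart_inv_open c (W : set T) : is_chart c -> open W -> open (chart_cod c `&` chart_inv c @^-1` W).
Proof.
move=> [[_ oc] _ _ _ ci] oW; rewrite openE => v [cv Wv]; apply: filterI.
  exact: open_nbhs_nbhs.
move: ci; rewrite continuous_open_subspace // => /(_ v); rewrite inE => /(_ cv) ci.
by apply: ci; exact: open_nbhs_nbhs.
Qed.

Variables (G : set ('rV[R]_n -> 'rV[R]_n)) (p : 'rV[R]_n -> T).
Hypothesis gc : gcover G p.

Lemma cover_chart_exists v (U : set 'rV[R]_n) : nbhs v U -> exists2 c, cover_atlas p c &
  chart_cod c v /\ chart_cod c `<=` U.
Proof.
move=> Uv; have [W Wv WG] := gc_free gc v.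
have : nbhs v (U `&` W) by exact: filterI.
rewrite nbhsE => -[E [oE Ev] EUW].
have inj a b : E a -> E b -> p a = p b -> a = b.
  move=> Ea Eb /(gc_eq gc) [g Gg bE]; rewrite bE (WG g a) //; first by have [] := EUW _ Ea.
  by rewrite -bE; have [] := EUW _ Eb.
have /choice [s sP] : forall y, exists a, (p @` E) y -> E a /\ p a = y.
  move=> y; have [[a Ea ay]|n0] := pselect ((p @` E) y); first by exists a.
  by exists 0.
have sK a : E a -> s (p a) = a.
  by move=> Ea; have [|Es e] := sP (p a); [exists a|exact: inj].
exists (Chart (p @` E) E s p); last by split => //= a /EUW [].
split=> //; split => //=.
- by split => //; exact: (gc_open gc).
- by move=> a Ea; split; [exists a|exact: sK].
- rewrite continuous_open_subspace; last exact: (gc_open gc).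
  move=> y; rewrite inE => -[a Ea <-] N; rewrite sK // => Na.
  have NE : nbhs a (N `&` E) by apply: filterI => //; exact: open_nbhs_nbhs.
  have := gc_nbhs gc NE; apply: filterS => _ [b [Nb Eb] <-] /=.
  by rewrite sK.
- by rewrite continuous_open_subspace // => a _; exact: (gc_pcts gc).
Qed.

End CoverCharts.

Lemma pos_mul_trans (R : realType) (x y z : R) : 0 < x * y -> 0 < y * z -> 0 < x * z.
Proof.
move=> a b; have y0 : y != 0 by apply/eqP => y0; move: a; rewrite y0 mulr0 ltxx.
have y2 : 0 < y ^+ 2 by rewrite lt0r sqrf_eq0 y0 sqr_ge0.
rewrite -(pmulr_lgt0 _ y2); have -> : x * z * y ^+ 2 = (x * y) * (y * z) by ring.
exact: mulr_gt0.
Qed.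

Lemma pos_mul_sq (R : realType) (x y : R) : 0 < x * y * y -> 0 < x.
Proof.
move=> h; have y0 : y != 0 by apply/eqP => y0; move: h; rewrite y0 mulr0 ltxx.
by move: h; rewrite -mulrA -expr2 pmulr_lgt0 // lt0r sqrf_eq0 y0 sqr_ge0.
Qed.

Lemma scale_preimage (R : realType) n (v : 'rV[R]_n) (t : R) (V : set 'rV[R]_n) :
  nbhs (t *: v) V -> nbhs t ((fun s : R => s *: v) @^-1` V).
Proof. exact: (@scalel_continuous R 'rV[R]_n v t V). Qed.

Section Orientation.
Variables (R : realType) (n : nat) (Y Q : topologicalType).
Variables (A B : set (chart R n Y)) (G : set ('rV[R]_n -> 'rV[R]_n)) (p : 'rV[R]_n -> Q).
Variables (f : Y -> Q) (f' : Q -> Y).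
Hypotheses (gc : gcover G p) (f'K : cancel f' f).
Hypotheses (sf : smooth_map A (cover_atlas p) f) (sf' : smooth_map (cover_atlas p) A f').
Hypotheses (sA : smooth_atlas A) (sB : smooth_atlas B).
Hypothesis AB : forall a b, A a -> B b -> compatible a b.
Hypothesis Bpos : forall c d, B c -> B d -> forall v, overlap c d v -> 0 < \det ('J (transition c d) v).

Local Notation h := (f' \o p).
Local Notation phi b := (chart_fun b \o (f' \o p)).

Let hcts : continuous h.
Proof. by move=> x; apply: continuous_comp; [exact: (gc_pcts gc)|exact: sf'.1]. Qed.

Let near_dom (b : chart R n Y) q : is_chart b -> chart_dom b (h q) -> \forall r \near q, chart_dom b (h r).
Proof. by move=> [[od _] _ _ _ _] dq; apply: hcts; exact: open_nbhs_nbhs. Qed.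

Let near_cod (c : chart R n Q) q : is_chart c -> chart_cod c q -> \forall r \near q, chart_cod c r.
Proof. by move=> [[_ oc] _ _ _ _] dq; exact: open_nbhs_nbhs. Qed.

Lemma overlap_nbhs (c d : chart R n Y) y : is_chart c -> is_chart d -> chart_dom c y -> chart_dom d y ->
  nbhs (chart_fun c y) (overlap c d).
Proof.
move=> ic id_ cy dy; have [_ cP _ _ _] := ic; have [k1 k2] := cP _ cy.
have [[od _] _ _ _ _] := id_; apply: open_nbhs_nbhs; split; first exact: chart_inv_open.
by split => //=; rewrite k2.
Qed.

(** The map [f] is smooth with respect to [A], while [b] belongs to the oriented atlas [B]. So the
    expression factors through a chart [a] of [A] and a transition from [a] to [b]. The local
    inverse [H], built the same way, makes the determinant nonzero. *)
Lemma lifted_chart_C1 q b : B b -> chart_dom b (h q) -> C1 (phi b) q /\ \det ('J (phi b) q) != 0.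
Proof.
move=> Bb bq; have [Ac Acov _] := sA; have [Bc _ _] := sB.
have ib := Bc _ Bb; have [a Aa aq] := Acov (h q); have ia := Ac _ Aa.
have [c [ic cE] [cq _]] := cover_chart_exists gc (@filterT _ (nbhs q) _).
have cc : cover_atlas p c by [].
have [_ aP _ _ _] := ia; have [_ bP _ _ _] := ib; have [_ _ cP _ _] := ic.
have [[oda _] _ _ _ _] := ia; have [[odc _] _ _ _ _] := ic.
pose psi := chart_fun a \o f' \o chart_inv c.
have psi1 : C1 psi q.
  apply: C1_smooth (sf'.2 _ _ cc Aa); apply: open_nbhs_nbhs; split.
    apply: (chart_inv_open (W := f' @^-1` chart_dom a)) => //.
    by apply: open_comp => // x _; exact: sf'.1.
  by split => //=; rewrite cE.
have psiE : \forall r \near q, psi r = chart_fun a (h r).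
  by apply: filterS (near_cod ic cq) => r cr; rewrite /psi /= cE.
have psiq : psi q = chart_fun a (h q) := nbhs_singleton psiE.
have tau1 : C1 (transition a b) (psi q).
  by rewrite psiq; apply: C1_smooth (AB Aa Bb).1; exact: overlap_nbhs.
split.
  apply: C1_near (C1_comp psi1 tau1).
  apply: filter_app (near_dom ia aq); apply: filterS psiE => r pr ar.
  by rewrite /= pr /transition /= (aP _ ar).2.
pose H := (chart_fun c \o f \o chart_inv a) \o transition b a.
have bq' : phi b q = chart_fun b (h q) by [].
have ov : overlap b a (phi b q) by exact: nbhs_singleton (overlap_nbhs ib ia bq aq).
have tq : transition b a (phi b q) = chart_fun a (h q) by rewrite /transition /= (bP _ bq).2.
have fh r : f (h r) = p r by rewrite /= f'K.
apply: (det_jacobian_neq0 (h := H)).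
- have [dphi _] : C1 (phi b) q.
    apply: C1_near (C1_comp psi1 tau1).
    apply: filter_app (near_dom ia aq); apply: filterS psiE => r pr ar.
    by rewrite /= pr /transition /= (aP _ ar).2.
  exact: nbhs_singleton dphi.
- apply: differentiable_comp; first exact: ((AB Aa Bb).2 1%N).1 ov.
  rewrite tq; apply: ((sf.2 _ _ Aa cc) 1%N).1; split; first exact: (aP _ aq).1.
  by rewrite /= (aP _ aq).2 fh -cE //; exact: (cP _ cq).1.
- apply: filter_app (near_dom ia aq); apply: filter_app (near_dom ib bq).
  apply: filterS (near_cod ic cq) => r cr br ar.
  by rewrite /H /transition /= (bP _ br).2 (aP _ ar).2 f'K -cE // (cP _ cr).2.
Qed.

Lemma lifted_chart_change q b b' : B b -> B b' -> chart_dom b (h q) -> chart_dom b' (h q) ->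
  0 < \det ('J (phi b) q) * \det ('J (phi b') q).
Proof.
move=> Bb Bb' bq bq'; have [Bc _ _] := sB; have [ib ib'] := (Bc _ Bb, Bc _ Bb').
have [_ bP _ _ _] := ib.
have [[dn _] d0] := lifted_chart_C1 Bb bq.
have ov : overlap b b' (phi b q) by exact: nbhs_singleton (overlap_nbhs ib ib' bq bq').
have dphi : differentiable (phi b) q by exact: nbhs_singleton dn.
have [_ _ comp] := sB.
have dt : differentiable (transition b b') (phi b q) := ((comp _ _ Bb Bb').1 1%N).1 _ ov.
have e : \forall r \near q, (transition b b' \o phi b) r = phi b' r.
  by apply: filterS (near_dom ib bq) => r br; rewrite /transition /= (bP _ br).2.
have -> := near_eq_jacobian e (differentiable_comp dphi dt).
rewrite (jacobian_comp dphi dt) det_mulmx mulrA -expr2.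
by rewrite mulr_gt0 ?(Bpos Bb Bb' ov) // lt0r sqrf_eq0 d0 sqr_ge0.
Qed.

(** The sign of the Jacobian determinant of a lifted oriented chart depends neither on the chart nor
    on the point of the segment from 0 to [g 0]. The chain rule for the [g]-invariant lifted chart
    at 0 then gives the sign of the determinant of [g]. *)
Lemma deck_orientation_preserving g : G g -> differentiable g 0 -> 0 < \det ('J g 0).
Proof.
move=> Gg dg; have [Bc Bcov _] := sB; have [b0 Bb0 b0q] := Bcov (h 0).
have hg q : h (g q) = h q by rewrite /= (gc_orb gc).
pose D b q := \det ('J (phi b) q).
pose P (t : R) := forall b, B b -> chart_dom b (h (t *: g 0)) -> 0 < D b0 0 * D b (t *: g 0).
have P1 : P 1.
  apply: (@real_ind R P) => //; last by rewrite ler01 lexx.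
    by move=> b Bb; rewrite scale0r => bq; exact: lifted_chart_change.
  move=> t _; have [b Bb bq] := Bcov (h (t *: g 0)).
  have [[dn c1] d0] := lifted_chart_C1 Bb bq.
  have [V Vn VP] : exists2 V : set 'rV[R]_n, nbhs (t *: g 0) V &
      forall r, V r -> chart_dom b (h r) /\ 0 < D b (t *: g 0) * D b r.
    exists [set r | chart_dom b (h r) /\ 0 < D b (t *: g 0) * D b r] => //.
    apply: filterI; first exact: near_dom (Bc _ Bb) bq.
    have cD : {for t *: g 0, continuous (fun r => D b (t *: g 0) * D b r)}.
      apply: (@mul_at R _ (fun=> D b (t *: g 0)) (D b)); last exact: det_at.
      exact: cst_continuous.
    apply: (cD [set x | 0 < x]); apply: open_nbhs_nbhs; split; first exact: open_gt.
    by rewrite /= -expr2 lt0r sqrf_eq0 d0 sqr_ge0.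
  exists ((fun s : R => s *: g 0) @^-1` V).
    exact: scale_preimage.
  move=> s r /VP [bs Ds] /VP [br Dr] _ _ Ps b' Bb' b'r.
  apply: pos_mul_trans (lifted_chart_change Bb Bb' br b'r).
  apply: pos_mul_trans (Ps b Bb bs) _; apply: pos_mul_trans Dr.
  by rewrite mulrC.
have b0g : chart_dom b0 (h (g 0)) by rewrite hg.
have := P1 b0 Bb0; rewrite scale1r => /(_ b0g).
have [[dn _] d0] := lifted_chart_C1 Bb0 b0g.
have dphi : differentiable (phi b0) (g 0) by exact: nbhs_singleton dn.
have e : phi b0 \o g = phi b0 by apply/funext => r; rewrite /= (gc_orb gc).
have JE : 'J (phi b0) 0 = 'J g 0 *m 'J (phi b0) (g 0).
  by rewrite -{1}e; exact: jacobian_comp.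
rewrite {1}/D JE det_mulmx.
exact: pos_mul_sq.
Qed.

End Orientation.

Lemma det_mx3 (S : comNzRingType) (A : 'M[S]_3) : \det A =
  A 0 0 * (A 1 1 * A 2 2 - A 1 2 * A 2 1) - A 0 1 * (A 1 0 * A 2 2 - A 1 2 * A 2 0)
  + A 0 2 * (A 1 0 * A 2 1 - A 1 1 * A 2 0).
Proof.
have l00 : lift 0 (0 : 'I_2) = 1 :> 'I_3 by exact: val_inj.
have l01 : lift 0 (1 : 'I_2) = 2 :> 'I_3 by exact: val_inj.
have l10 : lift 1 (0 : 'I_2) = 0 :> 'I_3 by exact: val_inj.
have l11 : lift 1 (1 : 'I_2) = 2 :> 'I_3 by exact: val_inj.
have l20 : lift 2 (0 : 'I_2) = 0 :> 'I_3 by exact: val_inj.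
have l21 : lift 2 (1 : 'I_2) = 1 :> 'I_3 by exact: val_inj.
have sum3' (F : 'I_3 -> S) : \sum_i F i = F 0 + F 1 + F 2.
  by rewrite !big_ord_recl big_ord0 addr0 addrA; congr (_ + F _ + F _); exact: val_inj.
rewrite (expand_det_row _ 0) sum3' /cofactor !det_mx2 !mxE l00 l01 l10 l11 l20 l21 /=.
by ring.
Qed.

Lemma unit_ball_bound (R : realType) n (x v : 'rV[R]_n) j : ball x 1 v ->
  `|v 0 j| <= \sum_i `|x 0 i| + 1.
Proof.
move=> bv; have h := mx_ballE j bv; have -> : v 0 j = x 0 j - (x 0 j - v 0 j) by ring.
apply: le_trans (ler_normB _ _) _; apply: lerD; last exact: ltW.
by rewrite (bigD1 j) //= lerDl sumr_ge0.
Qed.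

(** * Sol manifolds as orbit spaces *)

Section SolManifold.
Variable R : realType.
Local Notation E3 := 'rV[R]_3.

Definition solmx (w : bool) (e1 e2 c : R) : 'M[R]_3 :=
  if w then \matrix_(i, j) row3 (e1 * expR (- c) * (i == 1)%:R) (e2 * expR c * (i == 0)%:R) (- (i == 2)%:R) 0 j
  else \matrix_(i, j) row3 (e1 * expR (- c) * (i == 0)%:R) (e2 * expR c * (i == 1)%:R) ((i == 2)%:R) 0 j.

Lemma solmap_affine w e1 e2 a b c :
  solmap w e1 e2 a b c = (fun p => p *m solmx w e1 e2 c + row3 a b c).
Proof.
apply/funext => p; rewrite /solmap /solmx.
by case: w; apply: row3_eqP; rewrite row3E mxE row3E mxE sum3 !mxE /=; ring.
Qed.

Lemma det_solmx w e1 e2 c : \det (solmx w e1 e2 c) = e1 * e2.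
Proof.
have E : expR (- c) * expR c = 1 by rewrite -expRD addNr expR0.
transitivity (e1 * e2 * (expR (- c) * expR c)); last by rewrite E mulr1.
by rewrite det_mx3 /solmx; case: w; rewrite !mxE /=; ring.
Qed.

Lemma solmap_continuous w e1 e2 a b c : continuous (@solmap R w e1 e2 a b c).
Proof.
rewrite solmap_affine => x; apply: differentiable_continuous.
exact: (affine_diff (solmx w e1 e2 c) (row3 a b c) x).1.
Qed.

Lemma cube_compact (r : R) : compact [set v : E3 | forall j, `|v 0 j| <= r].
Proof.
have c : compact [set v : E3 | forall j, `[- r, r]%classic (v 0 j)].
  by apply: (@rV_compact R 3 (fun=> `[- r, r]%classic)) => _; exact: segment_compact.
congr compact: c; apply/seteqP; split=> v h j; have := h j; by rewrite /= in_itv /= ler_norml.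
Qed.

Section IsometryGroup.
Variable G : set (E3 -> E3).
Hypotheses (Giso : isometry_subgroup G) (GPD : properly_discontinuous G) (Gfree : acts_freely G).

Lemma isometry_continuous g : G g -> continuous g.
Proof.
have [+ _ _ _] := Giso; move=> /(_ g) h /h /Sol_isometry_solmap [w [e1 [e2 [a [b [c [_ _ ->]]]]]]].
exact: solmap_continuous.
Qed.

(** Only finitely many translates of a cube around [x] meet the cube. By freeness each nontrivial
    one of these elements moves some neighbourhood of [x] off itself, and the finite intersection of
    these with the cube works for the whole group. *)
Lemma orbit_cover : gcover G (quotient_proj (same_orbit G)).
Proof.
have [Gsub Gid Gc Gi] := Giso.
apply: gcover_quot => //.
- exact: isometry_continuous.
- exact: quotient_proj_surj.
- move=> x y; rewrite quotient_proj_eq; split=> [|[g Gg ->]]; last by apply: rst_step; exists g.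
  elim=> {x y} [x y [g Gg ->]|x|x y _ [g Gg ->]|x y z _ [g Gg ->] _ [k Gk ->]].
  + by exists g.
  + by exists id.
  + by have [g' Gg' [gK _]] := Gi _ Gg; exists g' => //; rewrite gK.
  + by exists (k \o g) => //; exact: Gc.
- move=> x; pose r := \sum_j `|x 0 j| + 1.
  pose K := [set v : E3 | forall j, `|v 0 j| <= r].
  have Kx : nbhs x K.
    apply: filterS (nbhsx_ballx x _ (@ltr01 R)) => v bv j.
    exact: unit_ball_bound.
  have [s sE] := (finite_seqP _).1 (GPD (@cube_compact r)).
  have sep g : G g -> g <> id -> exists2 W : set E3, nbhs x W & forall a, W a -> ~ W (g a).
    move=> Gg gid; have gx : g x != x by apply/eqP => /(Gfree Gg).
    pose d := `|g x - x| / 2; have d0 : 0 < d by rewrite divr_gt0 // normr_gt0 subr_eq0.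
    exists (ball x d `&` g @^-1` ball (g x) d).
      apply: filterI; first exact: nbhsx_ballx.
      by apply: (isometry_continuous Gg); exact: nbhsx_ballx.
    move=> a [xa ga] [xga _].
    have := le_lt_trans (ler_distD (g a) (g x) x); rewrite -!ball_normE /= in ga xga.
    move=> /(_ (d + d)) H; have : `|g x - g a| + `|g a - x| < d + d.
      by apply: ltrD => //; rewrite distrC.
    by move=> /H; rewrite -splitr ltxx.
  have key (l : seq (E3 -> E3)) : (forall g, g \in l -> G g) -> exists2 W : set E3, nbhs x W &
      forall g a, g \in l -> W a -> W (g a) -> g = id.
    elim: l => [|g l IH] lG; first by exists setT; [exact: filterT|].
    have [|W Wx WP] := IH; first by move=> k kl; apply: lG; rewrite inE kl orbT.
    have [gid|gid] := pselect (g = id).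
      exists W => // k a; rewrite inE => /orP[/eqP -> //|kl]; exact: WP.
    have [|W' W'x W'P] := sep g _ gid; first by apply: lG; rewrite mem_head.
    exists (W `&` W'); first exact: filterI.
    move=> k a; rewrite inE => /orP[/eqP ->|kl] [Wa W'a] [Wk W'k]; last exact: WP Wa Wk.
    by case: (W'P a W'a).
  have [|W Wx WP] := key s.
    by move=> g gs; have : [set` s] g by []; rewrite -sE => -[].
  exists (W `&` K); first exact: filterI.
  move=> g a Gg [Wa Ka] [Wg Kg]; apply: WP Wa Wg.
  have : [set f | G f /\ (f @` K) `&` K !=set0] g by split=> //; exists (g a); split => //; exists a.
  by rewrite sE.
Qed.

Lemma isometry_group_finite (r : R) : finite_set [set g | G g /\ forall j, `|g 0 0 j| <= r].
Proof.
apply: sub_finite_set (GPD (@cube_compact r)) => g [Gg gr]; split => //.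
exists (g 0); split=> //; exists 0 => // j; rewrite mxE normr0.
exact: le_trans (gr j).
Qed.

(** Each point of the quotient has a neighbourhood whose points lift into a bounded cube;
    compactness makes the size of the cube uniform. *)
Lemma cocompact_orbits (Q : topologicalType) (p : E3 -> Q) : gcover G p -> compact [set: Q] ->
  exists r : R, forall q, exists2 g, G g & forall j, `|g q 0 j| <= r.
Proof.
move=> gc /compact_near_coveringP nc.
have := nc nat \oo (fun N y => exists2 q, p q = y & forall j, `|q 0 j| <= N%:R).
have FF : Filter (\oo : set_system nat) by exact: eventually_filter.
move=> /(_ FF) [].
  move=> y _; have [x <-] := gc_surj gc y.
  exists (p @` ball x 1, [set N : nat | \sum_j `|x 0 j| + 1 <= N%:R]).
    split; first by apply: (gc_nbhs gc); exact: nbhsx_ballx.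
    exact: nbhs_infty_ger.
  move=> [_ N] /= [[v xv <-] hN]; exists v => // j; apply: le_trans hN.
  exact: unit_ball_bound.
move=> N _ /(_ N (leqnn N)) h; exists N%:R => q; have [x e hx] := h (p q) I.
by have /(gc_eq gc) [g Gg gE] := esym e; exists g; rewrite // -gE.
Qed.

End IsometryGroup.

Lemma sol_manifold_cover (Y : topologicalType) (A : set (chart R 3 Y)) :
  closed_orientable_Sol_manifold A -> exists (G : set (E3 -> E3)) (p : E3 -> Y),
    sol_group G /\ gcover G p.
Proof.
move=> [[[_ _ sA] cY _] [B [sB AB Bpos]] [G [Giso GPD Gfree [f [f' [fK f'K sf sf']]]]]].
have gq := orbit_cover Giso GPD Gfree.
have gc := gcover_homeo gq sf'.1 sf.1 f'K fK.
exists G, (f' \o quotient_proj (same_orbit G)); split => //.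
have [Gsub Gid Gc Gi] := Giso.
split => //.
- move=> g Gg; have [w [e1 [e2 [a [b [c [h1 h2 gE]]]]]]] := Sol_isometry_solmap (Gsub _ Gg).
  have gE' : g = (fun p => p *m solmx w e1 e2 c + row3 a b c) by rewrite gE solmap_affine.
  have dg : differentiable g 0.
    by rewrite gE'; exact: (affine_diff (solmx w e1 e2 c) (row3 a b c) 0).1.
  have := deck_orientation_preserving gq f'K sf sf' sA sB AB Bpos Gg dg.
  rewrite gE' jacobian_affine det_solmx => pos.
  exists w, e1, a, b, c; split => //; rewrite -solmap_affine; congr solmap.
  have : (e1 - e2) * (e1 + e2) = 0 by rewrite -subr_sqr h1 h2 subrr.
  move=> /eqP; rewrite mulf_eq0 subr_eq0 => /orP[/eqP -> //|].
  rewrite addr_eq0 => /eqP e; move: pos; rewrite e mulNr -expr2 h2; lra.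
- exact: isometry_group_finite.
- exact: cocompact_orbits gc cY.
Qed.

End SolManifold.

(** * Smooth structures on quotients *)

Lemma rat_approx (R : realType) (x d : R) : 0 < d -> exists q : rat, `|x - ratr q| < d.
Proof.
move=> d0; have [|q] := @rat_in_itvoo R (x - d) (x + d); first lra.
rewrite in_itv /= => /andP[h1 h2]; exists q; rewrite ltr_norml; apply/andP; split; lra.
Qed.

Lemma dist_continuous (R : realType) (T : topologicalType) (f : T -> R) (c : R) :
  continuous f -> continuous (fun x => `|f x - c|).
Proof.
move=> cf x; apply: (@continuous_comp _ _ _ (fun y => f y - c) Num.norm).
  by apply: cvgB; [exact: cf|exact: cvg_cst].
exact: norm_continuous.
Qed.

Lemma near_forall (T : topologicalType) n (P : 'I_n -> T -> Prop) (v : T) :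
  (forall j, \forall u \near v, P j u) -> \forall u \near v, forall j, P j u.
Proof. exact: filter_forall. Qed.

Section CoverSmooth.
Variables (R : realType) (n : nat) (T U : topologicalType).
Variables (G : set ('rV[R]_n -> 'rV[R]_n)) (p : 'rV[R]_n -> T).
Variables (H : set ('rV[R]_n -> 'rV[R]_n)) (q : 'rV[R]_n -> U).
Hypotheses (gc : gcover G p) (hc : gcover H q).

(** Read in the total space, a chart of [cover_atlas] is locally a deck transformation. *)
Lemma cover_chart_near (d : chart R n U) v : cover_atlas q d -> chart_dom d (q v) ->
  exists2 g, H g & \forall u \near v, chart_fun d (q u) = g u.
Proof.
move=> [id_ dE] dv; have [[_ oc] dP cP _ _] := id_.
have [cw wE] := dP _ dv; rewrite dE // in wE.
have /(gc_eq hc) [g Gg gE] := esym wE; exists g => //.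
have cg : nbhs v (g @^-1` chart_cod d).
  by apply: (gc_cts hc Gg); rewrite -gE; exact: open_nbhs_nbhs.
by apply: filterS cg => u gu; rewrite -(gc_orb hc u Gg) -(dE _ gu) (cP _ gu).2.
Qed.

Lemma cover_transition (F : T -> U) (F0 : 'rV[R]_n -> 'rV[R]_n) (c : chart R n T) (d : chart R n U) v :
  continuous F0 -> (forall u, F (p u) = q (F0 u)) -> cover_atlas p c -> cover_atlas q d ->
  chart_cod c v -> chart_dom d (F (chart_inv c v)) ->
  exists2 g, H g & \forall u \near v, (chart_fun d \o F \o chart_inv c) u = g (F0 u).
Proof.
move=> cF0 FE [ic cE] dq cv; rewrite cE // FE => dv.
have [g Hg gE] := cover_chart_near dq dv; exists g => //.
have [[_ oc] _ _ _ _] := ic.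
have cv' : \forall u \near v, chart_cod c u by exact: open_nbhs_nbhs.
have gE' : \forall u \near v, chart_fun d (q (F0 u)) = g (F0 u) by exact: (cF0 v _ gE).
by apply: filter_app gE'; apply: filterS cv' => u cu <-; rewrite /= cE // FE.
Qed.

Lemma cover_smooth_map (F : T -> U) (F0 : 'rV[R]_n -> 'rV[R]_n) : continuous F0 ->
  (forall u, F (p u) = q (F0 u)) ->
  (forall g, H g -> exists M c, forall u, g (F0 u) = u *m M + c) ->
  smooth_map (cover_atlas p) (cover_atlas q) F.
Proof.
move=> cF0 FE aff; split.
  apply: (gc_factor gc); have -> : F \o p = q \o F0 by apply/funext.
  by move=> x; apply: continuous_comp; [exact: cF0|exact: (gc_pcts hc)].
move=> c d cc dd; apply: locally_affine_smooth => v [cv dv].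
have [g Hg gE] := cover_transition cF0 FE cc dd cv dv.
have [M [b ME]] := aff _ Hg; exists M, b; apply: filterS gE => u ->; exact: ME.
Qed.

End CoverSmooth.

Section CoverAtlas.
Variables (R : realType) (n : nat) (T : topologicalType).
Variables (G : set ('rV[R]_n -> 'rV[R]_n)) (p : 'rV[R]_n -> T).
Hypothesis gc : gcover G p.
Hypothesis Gaff : forall g, G g -> exists M c, forall u, g u = u *m M + c.

Lemma cover_atlas_smooth : smooth_atlas (cover_atlas p).
Proof.
have sm : smooth_map (cover_atlas p) (cover_atlas p) id.
  by apply: (cover_smooth_map gc gc (F0 := id)) => //; exact: (fun x => @cvg_id _ _).
split=> [c [] //|y|c d cc dd].
  have [v <-] := gc_surj gc y.
  have [c cc [cv _]] := cover_chart_exists gc (@filterT _ (nbhs v) _).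
  exists c => //; have [[_ _ cP _ _] cE] := cc.
  by rewrite -cE //; exact: (cP _ cv).1.
by split; [exact: (sm.2 _ _ cc dd)|exact: (sm.2 _ _ dd cc)].
Qed.

Lemma cover_atlas_orientable : (forall g, G g -> exists M c, (forall u, g u = u *m M + c) /\ 0 < \det M) ->
  orientable (cover_atlas p).
Proof.
move=> Gpos; have sA := cover_atlas_smooth; exists (cover_atlas p); split => //.
  by have [_ _ comp] := sA; exact: comp.
move=> c d cc dd v [cv dv].
have cid : continuous (id : 'rV[R]_n -> 'rV[R]_n) by move=> x; exact: cvg_id.
have [g Gg gE] := cover_transition (F := id) (F0 := id) gc cid (fun u => erefl (p u)) cc dd cv dv.
have [M [b [ME dM]]] := Gpos _ Gg.
have e : \forall u \near v, (fun u => u *m M + b) u = transition c d u.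
  by apply: filterS gE => u uE; rewrite -ME; exact: esym.
by rewrite (near_eq_jacobian e (affine_diff M b v).1) jacobian_affine.
Qed.

Lemma cover_connected : connected [set: T].
Proof.
move=> B [y By] [C oC BC] [D cD BD].
have BC' : B = C by rewrite BC setTI.
have BD' : B = D by rewrite BD setTI.
rewrite eqEsubset; split => // z _.
have [v vy] := gc_surj gc y; have [w wz] := gc_surj gc z.
pose c (t : R) := v + t *: (w - v).
have cc : continuous c.
  move=> t; apply: (@cvgD _ _ _ _ _ (fun=> v)); first exact: cvg_cst.
  exact: (@scalel_continuous R 'rV[R]_n (w - v) t).
have cpc : continuous (p \o c).
  by move=> t; apply: continuous_comp; [exact: cc|exact: (gc_pcts gc)].
have : B (p (c 1)).
  apply: (@real_ind R (fun t => B (p (c t)))) => //; last by rewrite ler01 lexx.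
    by rewrite /c scale0r addr0 vy.
  move=> t _; have [Bt|nBt] := pselect (B (p (c t))).
    exists ((p \o c) @^-1` B) => //; apply: cpc; apply: open_nbhs_nbhs; split => //.
    by rewrite BC'.
  exists ((p \o c) @^-1` (~` B)) => //.
  apply: cpc; apply: open_nbhs_nbhs; split => //.
  by rewrite BD'; exact: closed_openC.
by rewrite /c scale1r addrC subrK wz.
Qed.

Lemma cover_second_countable : @second_countable T.
Proof.
pose cube (qm : 'rV[rat]_n * nat) : set 'rV[R]_n :=
  [set v | forall j, `|v 0 j - ratr (qm.1 0 j)| < qm.2.+1%:R^-1].
exists (range (fun qm => p @` cube qm)).
  by apply: card_le_trans (card_image_le _ _) _; exact: countableP.
split.
  move=> _ [[a m] _ <-]; apply: (gc_open gc).
  rewrite openE => v va.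
  have : nbhs v [set u : 'rV[R]_n | forall j, `|u 0 j - ratr (a 0 j)| < m.+1%:R^-1].
    apply: (@near_forall _ n (fun j (u : 'rV[R]_n) => `|u 0 j - ratr (a 0 j)| < m.+1%:R^-1)) => j.
    have cj : {for v, continuous (fun u : 'rV[R]_n => `|u 0 j - ratr (a 0 j)|)}.
      exact: (@dist_continuous _ _ (fun u : 'rV[R]_n => u 0 j) (ratr (a 0 j)) (@coord_cts R n j) v).
    by apply: (cj [set x | x < m.+1%:R^-1]); apply: open_nbhs_nbhs; split; [exact: open_lt|exact: va].
  exact.
move=> y N Ny; have [v vy] := gc_surj gc y.
have : nbhs v (p @^-1` N) by apply: (gc_pcts gc); rewrite vy.
move=> /nbhs_ballP [e /= e0 eN].
have [m mE] : exists m : nat, m.+1%:R^-1 < e / 2.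
  have [m /= _ mP] := @near_infty_natSinv_lt R (PosNum (divr_gt0 e0 (@ltr0Sn R 1))).
  by exists m; exact: (mP m (leqnn m)).
have /choice [a aP] : forall j, exists x : rat, `|v 0 j - ratr x| < m.+1%:R^-1.
  by move=> j; apply: rat_approx; rewrite invr_gt0.
have av : cube (\row_j a j, m) v by move=> j; rewrite mxE.
exists (p @` cube (\row_j a j, m)).
  by split; [exists (\row_j a j, m)|exists v].
move=> _ [u ua <-]; apply: eN; split=> // i j; rewrite (ord1 i).
have := ua j; have := av j; rewrite /= mxE => h1 h2.
rewrite /ball /= /ball_ (_ : v 0 j - u 0 j = (v 0 j - ratr (a j)) - (u 0 j - ratr (a j))); last by ring.
apply: le_lt_trans (ler_normB _ _) _.
move: (m.+1%:R^-1) mE h1 h2 => d mE h1 h2; lra.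
Qed.

End CoverAtlas.

(** As in [orbit_cover]: of the elements that could carry points near [x] to points near [x'], only
    finitely many are relevant, and each is excluded by shrinking, as the orbits differ. *)
Lemma PD_hausdorff (R : realType) (T : topologicalType) (G : set ('rV[R]_3 -> 'rV[R]_3))
    (p : 'rV[R]_3 -> T) :
  gcover G p -> properly_discontinuous G -> hausdorff_space T.
Proof.
move=> gc PD; rewrite open_hausdorff => y y' yy'.
have [x xy] := gc_surj gc y; have [x' xy'] := gc_surj gc y'.
pose r := \sum_j `|x 0 j| + \sum_j `|x' 0 j| + 1.
pose K := [set v : 'rV[R]_3 | forall j, `|v 0 j| <= r].
have Kn (z : 'rV[R]_3) : \sum_j `|z 0 j| + 1 <= r -> nbhs z K.
  move=> zr; apply: filterS (nbhsx_ballx z _ (@ltr01 R)) => v bv j.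
  by apply: le_trans zr; exact: unit_ball_bound.
have Kx : nbhs x K by apply: Kn; rewrite /r lerD2r lerDl sumr_ge0.
have Kx' : nbhs x' K by apply: Kn; rewrite /r lerD2r lerDr sumr_ge0.
have [s sE] := (finite_seqP _).1 (PD _ (@cube_compact R r)).
have sep g : G g -> exists2 W : set 'rV[R]_3, nbhs x W & exists2 W' : set 'rV[R]_3, nbhs x' W' &
    forall a, W a -> ~ W' (g a).
  move=> Gg; have gx : g x != x'.
    apply/eqP => e; move/eqP: yy'; apply; rewrite -xy -xy' -e.
    exact: (esym (gc_orb gc x Gg)).
  pose d := `|g x - x'| / 2; have d0 : 0 < d by rewrite divr_gt0 // normr_gt0 subr_eq0.
  exists (g @^-1` ball (g x) d); first by apply: (gc_cts gc Gg); exact: nbhsx_ballx.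
  exists (ball x' d); first exact: nbhsx_ballx.
  move=> a ga xga; rewrite -!ball_normE /= in ga xga.
  have := le_lt_trans (ler_distD (g a) (g x) x').
  move=> /(_ (d + d)) H'; have : `|g x - g a| + `|g a - x'| < d + d.
    by apply: ltrD => //; rewrite distrC.
  by move=> /H'; rewrite -splitr ltxx.
have key (l : seq ('rV[R]_3 -> 'rV[R]_3)) : (forall g, g \in l -> G g) ->
    exists2 W : set 'rV[R]_3, nbhs x W & exists2 W' : set 'rV[R]_3, nbhs x' W' &
    forall g a, g \in l -> W a -> ~ W' (g a).
  elim: l => [|g l IH] lG; first by exists setT; [exact: filterT|exists setT; [exact: filterT|]].
  have [|W Wx [W' Wx' WP]] := IH; first by move=> k kl; apply: lG; rewrite inE kl orbT.
  have [|V Vx [V' Vx' VP]] := sep g; first by apply: lG; rewrite mem_head.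
  exists (W `&` V); first exact: filterI.
  exists (W' `&` V'); first exact: filterI.
  move=> k a; rewrite inE => /orP[/eqP ->|kl] [Wa Va] [Wk Vk]; first exact: VP Va Vk.
  exact: WP kl Wa Wk.
have [|W Wx [W' Wx' WP]] := key s.
  by move=> g gs; have : [set` s] g by []; rewrite -sE => -[].
have : nbhs x (W `&` K) by exact: filterI.
rewrite nbhsE => -[E [oE Ex] EW].
have : nbhs x' (W' `&` K) by exact: filterI.
rewrite nbhsE => -[E' [oE' Ex'] EW'].
exists (p @` E, p @` E').
  by rewrite /= -xy -xy'; split; rewrite inE; [exists x|exists x'].
split=> /=; [exact: (gc_open gc)|exact: (gc_open gc)|].
apply/eqP; rewrite -subset0 => _ [[a Ea <-] [b Eb ba]].
have /(gc_eq gc) [g Gg gE] := esym ba.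
have [Wa Ka] := EW _ Ea; have [Wb Kb] := EW' _ Eb.
apply: (WP g a) => //; last by rewrite -gE.
have : [set f | G f /\ (f @` K) `&` K !=set0] g.
  by split=> //; exists b; split => //; exists a.
by rewrite sE.
Qed.

Section LinearTorus.
Variable R : realType.
Local Notation lat := (map_mx (intr : int -> R)).

Lemma linear_torus_diffeo (M M' : 'M[int]_2) : M *m M' = 1%:M -> torus_diffeo (@linear_torus_map R M).
Proof.
move=> MM'; have M'M := mulmx1C MM'.
have sm (N : 'M[int]_2) : smooth_map (cover_atlas (@torus_proj R)) (cover_atlas (@torus_proj R))
    (@linear_torus_map R N).
  apply: (cover_smooth_map (torus_gcover R) (torus_gcover R) (F0 := linV N)).
  - exact: linV_continuous.
  - by move=> u; rewrite linear_torus_mapE.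
  - by move=> _ [m _ <-]; exists (lat N)^T, (lat m).
have inv (N N' : 'M[int]_2) : N' *m N = 1%:M -> cancel (@linear_torus_map R N) (linear_torus_map N').
  move=> e x; have [v <-] := gc_surj (torus_gcover R) x.
  by rewrite -!linear_torus_mapE linVM e linV1.
by exists (linear_torus_map M'); split; [exact: inv|exact: inv|exact: sm|exact: sm].
Qed.

Lemma linear_torus_represented (M : 'M[int]_2) : represented_by (@linear_torus_map R M) M.
Proof.
move=> m; have e : linear_torus_map M \o @torus_loop R m = torus_loop (m *m M^T).
  by apply/funext => t; rewrite /= /torus_loop -linear_torus_mapE /linV -scalemxAl lat_mul map_trmx.
have cl k : continuous (@torus_loop R k).
  move=> t; apply: (@continuous_comp _ _ _ (fun s : R => s *: lat k) (@torus_proj R)).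
    exact: (@scalel_continuous R 'rV[R]_2 (lat k) t).
  exact: (gc_pcts (torus_gcover R)).
exists (fun st => @torus_loop R (m *m M^T) st.2); split => //.
- apply: continuous_subspaceT => st.
  by apply: (@continuous_comp _ _ _ snd (@torus_loop R (m *m M^T))); [exact: cvg_snd|exact: cl].
- by move=> t _; rewrite e.
- move=> s _ /=; rewrite /torus_loop scale0r scale1r.
  by apply/torus_proj_eq; exists (m *m M^T); rewrite add0r.
Qed.

End LinearTorus.

Section SameDeck.
Variables (R : realType) (n : nat) (T U : topologicalType).
Variables (G : set ('rV[R]_n -> 'rV[R]_n)) (p : 'rV[R]_n -> T) (q : 'rV[R]_n -> U).
Hypotheses (gp : gcover G p) (gq : gcover G q).
Hypothesis Gaff : forall g, G g -> exists M c, forall u, g u = u *m M + c.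

Lemma same_deck_diffeo : exists f, diffeomorphism (cover_atlas p) (cover_atlas q) f.
Proof.
have /choice [s sP] := gc_surj gp; have /choice [s' s'P] := gc_surj gq.
have cid : continuous (id : 'rV[R]_n -> 'rV[R]_n) by move=> x; exact: cvg_id.
have fE u : q (s (p u)) = q u.
  by apply/(gc_eq gq); have /(gc_eq gp) : p (s (p u)) = p u by rewrite sP.
have f'E u : p (s' (q u)) = p u.
  by apply/(gc_eq gp); have /(gc_eq gq) : q (s' (q u)) = q u by rewrite s'P.
exists (q \o s), (p \o s'); split.
- by move=> y; rewrite /= f'E sP.
- by move=> y; rewrite /= fE s'P.
- exact: (cover_smooth_map gp gq (F0 := id)).
- exact: (cover_smooth_map gq gp (F0 := id)).
Qed.

End SameDeck.

Section SolIsometry.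
Variable R : realType.
Local Notation E3 := 'rV[R]_3.

Lemma solmap_smooth w e1 e2 a b c : smooth_on setT (@solmap R w e1 e2 a b c).
Proof.
apply: locally_affine_smooth => x _; exists (solmx w e1 e2 c), (row3 a b c).
by apply: filterS (@filterT _ (nbhs x) _) => y _; rewrite solmap_affine.
Qed.

Lemma solmap_isometry (e a b c : R) : e ^+ 2 = 1 -> Sol_isometry (solmap false e e a b c).
Proof.
move=> ee; have E : expR (- c) * expR c = 1 by rewrite -expRD addNr expR0.
have aux (x y : R) : e * expR (- c) * (e * expR c * x + y) = x + e * expR (- c) * y.
  transitivity (e ^+ 2 * (expR (- c) * expR c) * x + e * expR (- c) * y); first by ring.
  by rewrite ee E !mul1r.
have aux' (x y : R) : e * expR c * (e * expR (- c) * x + y) = x + e * expR c * y.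
  transitivity (e ^+ 2 * (expR (- c) * expR c) * x + e * expR c * y); first by ring.
  by rewrite ee E !mul1r.
split.
  exists (solmap false e e (- (e * expR c * a)) (- (e * expR (- c) * b)) (- c)); split.
  - by move=> q; rewrite /solmap opprK; apply: row3_eqP; rewrite !row3E ?aux ?aux' addrK.
  - move=> q; rewrite /solmap opprK; apply: row3_eqP; rewrite !row3E; last by rewrite subrK.
      transitivity (e ^+ 2 * (expR (- c) * expR c) * (q 0 0 - a) + a); first by ring.
      by rewrite ee E; ring.
    transitivity (e ^+ 2 * (expR (- c) * expR c) * (q 0 1 - b) + b); first by ring.
    by rewrite ee E; ring.
  - exact: solmap_smooth.
  - exact: solmap_smooth.
move=> q u v.
have dE w : 'd (solmap false e e a b c) q w = w *m solmx false e e c.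
  rewrite solmap_affine.
  exact: (congr1 (fun F => F w) (affine_diff (solmx false e e c) (row3 a b c) q).2).
have vE (w : E3) : w *m solmx false e e c = row3 (e * expR (- c) * w 0 0) (e * expR c * w 0 1) (w 0 2).
  by rewrite /solmx; apply: row3_eqP; rewrite row3E mxE sum3 !mxE /=; ring.
rewrite !dE !vE /Sol_metric /solmap !row3E.
have p1 : expR (2 * (q 0 2 + c)) = expR (2 * q 0 2) * expR c ^+ 2.
  by rewrite -expRM_natl -expRD; congr expR; ring.
have p2 : expR (- (2 * (q 0 2 + c))) = expR (- (2 * q 0 2)) * expR (- c) ^+ 2.
  by rewrite -expRM_natl -expRD; congr expR; ring.
congr (_ + _ + _).
  transitivity (expR (2 * q 0 2) * (e ^+ 2 * (expR (- c) * expR c) ^+ 2) * (u 0 0 * v 0 0)).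
    by rewrite p1; ring.
  by rewrite ee E expr1n !mulr1.
transitivity (expR (- (2 * q 0 2)) * (e ^+ 2 * (expR (- c) * expR c) ^+ 2) * (u 0 1 * v 0 1)).
  by rewrite p2; ring.
by rewrite ee E expr1n !mulr1.
Qed.

End SolIsometry.

Lemma finite_int_interval (N : nat) : finite_set [set x : int | (absz x <= N)%N].
Proof.
apply: (@sub_finite_set _ _ ((Posz @` `I_N.+1) `|` ((fun i => - Posz i) @` `I_N.+1))).
  by move=> [m|m] /= h; [left; exists m|right; exists m.+1].
by rewrite finite_setU; split; apply: finite_image; exact: finite_II.
Qed.

(** * Sol geometry on mapping tori of trace less than $-2$ *)

Section HyperbolicMappingTorus.
Variables (R : realType) (a b c d : int).
Let M := mx2 a b c d.
Hypotheses (detM : \det M = 1) (trM : a + d < -2) (c0 : c != 0).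
Local Notation E3 := 'rV[R]_3.
Local Notation V := 'rV[R]_2.
Local Notation lat := (map_mx (intr : int -> R)).
Local Notation MT := (mapping_torus (@linear_torus_map R M)).

(** The larger root of $x^2-sx+1$, for $s=-(a+d)$, exceeds 1; [t] is its logarithm. So [M] has the
    eigenvalues $-e^{t}$ and $-e^{-t}$. *)
Lemma hyperbolic_exponent : exists t : R, 0 < t /\ expR t + expR (- t) = - (a + d)%:~R.
Proof.
pose s : R := - (a + d)%:~R; have s2 : 2 < s.
  by rewrite /s ltrNr; have : (a + d)%:~R < (-2)%:~R :> R by rewrite ltr_int.
pose q := Num.sqrt (s ^+ 2 - 4); have q2 : q ^+ 2 = s ^+ 2 - 4 by rewrite sqr_sqrtr //; nra.
have q0 : 0 <= q := sqrtr_ge0 _.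
pose x := (s + q) / 2; have x1 : 1 < x by rewrite /x; lra.
exists (ln x); split; first exact: ln_gt0.
have xp : x \is Num.pos by rewrite posrE; lra.
rewrite expRN lnK //; have x0 : x != 0 by rewrite gt_eqF //; lra.
apply: (mulIf x0); rewrite mulrDl mulVf // -/s /x.
have : (s + q) / 2 * ((s + q) / 2) + 1 - s * ((s + q) / 2) = (q ^+ 2 - s ^+ 2 + 4) / 4 by field.
rewrite q2; lra.
Qed.

Lemma hyperbolic_sol_geometry : exists A : set (chart R 3 MT), closed_orientable_Sol_manifold A.
Proof.
have [t [t0 tE]] := hyperbolic_exponent.
set E := expR t in tE; set Em := expR (- t) in tE.
have EE : E * Em = 1 by rewrite /E /Em -expRD subrr expR0.
have EEm : E - Em != 0.
  by rewrite subr_eq0; apply/eqP => /expR_inj; lra.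
have cR : (c%:~R : R) != 0 by rewrite intr_eq0.
have dE : a%:~R * d%:~R - b%:~R * c%:~R = 1 :> R.
  by move: detM; rewrite det_mx2 !mx2E => /(congr1 (intr : int -> R)); rewrite rmorphB !rmorphM.
have [M' MM'] := det1_inv detM; have M'M := mulmx1C MM'.
have tl := linear_torus_lift R MM'.
(* [X] and [Y] are eigencovectors of [M] for the eigenvalues [- Em] and [- E]. They are independent
   because [c] and [E - Em] are nonzero, so with the height they are coordinates, in which the deck
   group acts by isometries of Sol. *)
pose X (v : V) := c%:~R * v 0 0 + (- Em - a%:~R) * v 0 1.
pose Y (v : V) := c%:~R * v 0 0 + (- E - a%:~R) * v 0 1.
have dR : d%:~R = - (E + Em) - a%:~R :> R by rewrite tE intrD; ring.
have cbE : b%:~R * c%:~R = a%:~R * (- (E + Em) - a%:~R) - 1 :> R by rewrite -dR; lra.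
have XM v : X (linV M v) = - Em * X v.
  rewrite linV_mx2 /X !row2E dR.
  transitivity (c%:~R * a%:~R * v 0 0 + (- Em - a%:~R) * c%:~R * v 0 0 + (b%:~R * c%:~R +
    (- Em - a%:~R) * (- (E + Em) - a%:~R)) * v 0 1); first by ring.
  rewrite cbE (_ : a%:~R * _ - 1 + _ = E * Em - 1 - Em * (- Em - a%:~R)); last by ring.
  by rewrite EE; ring.
have YM v : Y (linV M v) = - E * Y v.
  rewrite linV_mx2 /Y !row2E dR.
  transitivity (c%:~R * a%:~R * v 0 0 + (- E - a%:~R) * c%:~R * v 0 0 + (b%:~R * c%:~R +
    (- E - a%:~R) * (- (E + Em) - a%:~R)) * v 0 1); first by ring.
  rewrite cbE (_ : a%:~R * _ - 1 + _ = E * Em - 1 - E * (- E - a%:~R)); last by ring.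
  by rewrite EE; ring.
have XM' v : X (linV M' v) = - E * X v.
  by rewrite -[in RHS](tl_K' tl v) XM mulrA mulrNN EE mul1r.
have YM' v : Y (linV M' v) = - Em * Y v.
  by rewrite -[in RHS](tl_K' tl v) YM mulrA mulrNN [Em * E]mulrC EE mul1r.
pose Fi (x : V * R^o) : E3 := row3 (X x.1) (Y x.1) (- t * (x.2 : R)).
pose v1 (q : E3) := (q 0 0 - q 0 1) / (E - Em).
pose F (q : E3) : V * R^o := (row2 ((q 0 0 + (Em + a%:~R) * v1 q) / c%:~R) (v1 q), - (q 0 2 / t)).
have tn0 : t != 0 by rewrite gt_eqF.
have FK : cancel F Fi.
  by move=> q; rewrite /F /Fi /X /Y /v1; apply: row3_eqP; rewrite row3E /= ?row2E; field; rewrite ?cR ?EEm.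
have FiK : cancel Fi F.
  move=> [v s]; rewrite /F /Fi /X /Y /v1 !row3E /=; congr pair; last by field.
  by apply: row2_eqP; rewrite row2E; field; rewrite ?cR ?EEm.
have aff3 (f : E3 -> R) (k0 k1 k2 k3 : R) : (forall q, f q = k0 + q 0 0 * k1 + q 0 1 * k2 + q 0 2 * k3) ->
    continuous f.
  move=> fE; rewrite (_ : f = fun q => k0 + q 0 0 * k1 + q 0 1 * k2 + q 0 2 * k3); last exact/funext.
  by apply: affine_cts; exact: coord_cts.
have cF : continuous F.
  apply: cvg_pairT => x; last first.
    by apply: (aff3 _ 0 0 0 (- t^-1)) => q; rewrite /F /=; ring.
  apply: (@rV_continuous R E3 2 (fun q => (F q).1)) => j.
  case: j => -[|[|//]] ij.
    apply: (aff3 _ 0 ((1 + (Em + a%:~R) / (E - Em)) / c%:~R) (- (Em + a%:~R) / (E - Em) / c%:~R) 0) => q.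
    by rewrite /F /v1 /= mxE /=; field; rewrite cR EEm.
  apply: (aff3 _ 0 (E - Em)^-1 (- (E - Em)^-1) 0) => q.
  by rewrite /F /v1 /= mxE /=; field.
have cFi : continuous Fi.
  apply: rV_continuous => j x.
  have aff (f : V * R^o -> R) (k1 k2 k3 : R) :
      (forall q : V * R^o, f q = 0 + q.1 0 0 * k1 + q.1 0 1 * k2 + q.2 * k3) -> {for x, continuous f}.
    move=> fE; rewrite (_ : f = fun q => 0 + q.1 0 0 * k1 + q.1 0 1 * k2 + q.2 * k3); last exact/funext.
    have c1 k : continuous (fun q : V * R^o => q.1 0 k).
      by move=> y; apply: (@continuous_comp _ _ _ fst (fun w : V => w 0 k)); [exact: cvg_fst|exact: coord_cts].
    by apply: affine_cts; [exact: c1|exact: c1|move=> y; exact: cvg_snd].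
  move: j; apply: ord3_all.
  - by apply: (aff _ c%:~R (- Em - a%:~R) 0) => q; rewrite /Fi row3E /X; ring.
  - by apply: (aff _ c%:~R (- E - a%:~R) 0) => q; rewrite /Fi row3E /Y; ring.
  - by apply: (aff _ 0 0 (- t)) => q; rewrite /Fi row3E; ring.
have gp := gcover_conj (mt_gcover tl) cF cFi FK FiK.
set G := [set g' | _] in gp; set p := mt_proj _ \o F in gp.
(* The sign [e] is $(-1)^k$, because both eigenvalues are negative. *)
have zE (k : int) : exists2 e : R, e ^+ 2 = 1 & forall x : V * R^o,
    Fi (zpow (linV M) (linV M') k x.1, (x.2 : R) - k%:~R) = solmap false e e 0 0 (t * k%:~R) (Fi x).
  elim/int_step_ind: k => [|k [e ee IH]|k [e ee IH]].
  - exists 1; first by rewrite expr1n.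
    by move=> x; rewrite /Fi /solmap /= mulr0 oppr0 expR0; apply: row3_eqP; rewrite !row3E; ring.
  - exists (- e); first by rewrite sqrrN.
    move=> x; have /rowP := IH x; rewrite /Fi /solmap !row3E /= => r.
    have := r 0; have := r 1; have := r 2; rewrite !row3E !addr0 => r2 r1 r0.
    rewrite zpow_succ; last exact: (tl_K' tl).
    have e1 : expR (t * (k + 1)%:~R) = E * expR (t * k%:~R).
      by rewrite /E -expRD intrD; congr expR; ring.
    have e2 : expR (- (t * (k + 1)%:~R)) = Em * expR (- (t * k%:~R)).
      by rewrite /Em -expRD intrD; congr expR; ring.
    apply: row3_eqP; rewrite !row3E ?XM ?YM ?r0 ?r1 ?e1 ?e2 ?addr0; [ring|ring|].
    by rewrite intrD; ring.
  - exists (- e); first by rewrite sqrrN.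
    move=> x; have /rowP := IH x; rewrite /Fi /solmap !row3E /= => r.
    have := r 0; have := r 1; have := r 2; rewrite !row3E !addr0 => r2 r1 r0.
    rewrite zpow_pred; [|exact: (tl_K tl)|exact: (tl_K' tl)].
    have e1 : expR (t * (k - 1)%:~R) = Em * expR (t * k%:~R).
      by rewrite /Em -expRD intrB; congr expR; ring.
    have e2 : expR (- (t * (k - 1)%:~R)) = E * expR (- (t * k%:~R)).
      by rewrite /E -expRD intrB; congr expR; ring.
    apply: row3_eqP; rewrite !row3E ?XM' ?YM' ?r0 ?r1 ?e1 ?e2 ?addr0; [ring|ring|].
    by rewrite intrB; ring.
have GE g : G g -> exists (n : 'rV[int]_2) (k : int) (e : R), [/\ e ^+ 2 = 1,
    g = Fi \o mt_deck (linV M) (linV M') (n, k) \o F &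
    g = solmap false e e (X (lat n)) (Y (lat n)) (t * k%:~R)].
  move=> [_ [[n k] _ <-] ->]; have [e ee eE] := zE k; exists n, k, e; split => //.
  apply/funext => q; rewrite /= -[in RHS](FK q); have := eE (F q).
  move: (F q) => x /rowP r; have := r 0; have := r 1; have := r 2.
  rewrite /solmap /Fi !row3E !addr0 => r2 r1 r0.
  apply: row3_eqP; rewrite !row3E.
  + by rewrite -r0 /X /mt_deck /= !mxE; ring.
  + by rewrite -r1 /Y /mt_deck /= !mxE; ring.
  + by rewrite -r2.
have Gaff g : G g -> exists N k, (forall u, g u = u *m N + k) /\ 0 < \det N.
  move=> /GE [n [k [e [ee _ ->]]]]; exists (solmx false e e (t * k%:~R)), (row3 (X (lat n)) (Y (lat n)) (t * k%:~R)).
  by split; [move=> u; rewrite solmap_affine|rewrite det_solmx -expr2 ee].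
have Gaff' g : G g -> exists N k, forall u, g u = u *m N + k.
  by move=> /Gaff [N [k [h _]]]; exists N, k.
have Giso : isometry_subgroup G.
  split; [|exact: (gc_id gp)|exact: (gc_comp gp)|exact: (gc_inv gp)].
  by move=> g /GE [n [k [e [ee _ ->]]]]; exact: solmap_isometry.
have Gfree : acts_freely G by move=> g x Gg; exact: (gc_fix gp).
(* If an element moves a point of the cube of radius [r] into the cube, heights bound [k], then the
   horizontal coordinates bound the values of [X] and [Y] at [n] by [r']. Solving for [n] gives the
   bounds [B1] and [B0], so finitely many integers remain. *)
have GPD : properly_discontinuous G.
  move=> K cK; have [r rP] : exists r : R, forall v, K v -> forall j, `|v 0 j| <= r.
    have /= [N [_ NP]] := @compact_bounded R E3 K cK; exists (N + 2) => v Kv j.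
    have vN : `|v| <= N + 1 by apply: (NP (N + 1)) => //; rewrite ltrDl.
    have bv : ball (0 : E3) (N + 2) v by rewrite -ball_normE /= sub0r normrN; lra.
    by have := mx_ballE j bv; rewrite mxE sub0r normrN => /ltW.
  pose r' := r + expR (2 * r) * r.
  pose B1 := 2 * r' / `|E - Em|; pose B0 := (r' + `|Em + a%:~R| * B1) / `|c%:~R|.
  pose N := (Num.bound B0 + Num.bound B1 + Num.bound (2 * r / t))%N.
  pose S := [set x : int | (absz x <= N)%N].
  have finS : finite_set (S `*` S `*` S).
    by do 2!(apply: finite_setX; last exact: finite_int_interval); exact: finite_int_interval.
  apply: sub_finite_set (finite_image (fun x : int * int * int =>
    Fi \o mt_deck (linV M) (linV M') (row_int x.1.1 x.1.2, x.2) \o F) finS).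
  move=> g [Gg [_ [[q Kq <-] Kgq]]]; have [n [k [e [ee gE1 gE2]]]] := GE g Gg.
  have r0 : 0 <= r := le_trans (normr_ge0 _) (rP q Kq 0).
  have small (x : int) (B : R) : `|x%:~R : R| <= B -> (absz x <= Num.bound B)%N.
    move=> h; have B0' : 0 <= B := le_trans (normr_ge0 _) h.
    have := archi_boundP B0'; move: h; rewrite -intr_norm => h1 h2.
    by have := le_lt_trans h1 h2; rewrite [X in _ < X]pmulrn ltr_int; lia.
  have k1 : `|t * k%:~R| <= 2 * r.
    have := rP _ Kgq 2; have := rP _ Kq 2; rewrite gE2 /solmap row3E => h1 h2.
    have -> : t * k%:~R = (q 0 2 + t * k%:~R) - q 0 2 by ring.
    by apply: le_trans (ler_normB _ _) _; lra.
  have ek (s : R) : `|s| <= 2 * r -> `|e * expR s| <= expR (2 * r).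
    move=> h; have -> : `|e * expR s| = expR s.
      rewrite normrM [`|expR s|]ger0_norm ?expR_ge0 // (_ : `|e| = 1) ?mul1r //.
      by apply/eqP; rewrite -sqrp_eq1 ?normr_ge0 // -normrX ee normr1.
    by rewrite ler_expR; apply: le_trans h; exact: ler_norm.
  have bound (s x y : R) : `|s| <= 2 * r -> `|x| <= r -> `|e * expR s * x + y| <= r -> `|y| <= r'.
    move=> h1 h2 h3; have -> : y = (e * expR s * x + y) - e * expR s * x by ring.
    apply: le_trans (ler_normB _ _) _; apply: lerD => //.
    by rewrite normrM; apply: ler_pM => //; exact: ek.
  have Xn : `|X (lat n)| <= r'.
    by have := rP _ Kgq 0; rewrite gE2 /solmap row3E; apply: bound; rewrite ?normrN //; exact: rP.
  have Yn : `|Y (lat n)| <= r'.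
    by have := rP _ Kgq 1; rewrite gE2 /solmap row3E; apply: bound => //; exact: rP.
  have n1 : `|(n 0 1)%:~R : R| <= B1.
    have -> : (n 0 1)%:~R = (X (lat n) - Y (lat n)) / (E - Em).
      by rewrite /X /Y !mxE; field.
    rewrite normrM normfV ler_pM2r ?invr_gt0 ?normr_gt0 //.
    by apply: le_trans (ler_normB _ _) _; lra.
  have n0 : `|(n 0 0)%:~R : R| <= B0.
    have -> : (n 0 0)%:~R = (X (lat n) + (Em + a%:~R) * (n 0 1)%:~R) / c%:~R.
      by rewrite /X !mxE; field.
    rewrite normrM normfV ler_pM2r ?invr_gt0 ?normr_gt0 //.
    apply: le_trans (ler_normD _ _) _; apply: lerD => //.
    by rewrite normrM ler_wpM2l.
  have kb : `|k%:~R : R| <= 2 * r / t.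
    by rewrite ler_pdivlMr // mulrC -[X in X * _ <= _](gtr0_norm t0) -normrM.
  exists ((n 0 0, n 0 1), k).
    have := small _ _ n0; have := small _ _ n1; have := small _ _ kb.
    move=> h1 h2 h3; split; last exact: leq_trans h1 (leq_addl _ _).
    split; first exact: leq_trans h3 (leq_trans (leq_addr _ _) (leq_addr _ _)).
    exact: leq_trans h2 (leq_trans (leq_addl _ _) (leq_addr _ _)).
  rewrite gE1 /=; congr (Fi \o mt_deck _ _ (_, _) \o F).
  by apply/rowP => -[[|[|//]] i]; rewrite mxE /=; congr (n _ _); exact: val_inj.
have gq := orbit_cover Giso GPD Gfree.
have cMT : compact [set: MT].
  pose box : set (V * R^o) := [set v : V | forall i, `[0, 1]%classic (v 0 i)] `*` `[0, 1]%classic.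
  have cbox : compact box.
    apply: compact_setX; last exact: segment_compact.
    by apply: (@rV_compact R 2 (fun=> `[0, 1]%classic)) => _; exact: segment_compact.
  have -> : [set: MT] = @mt_proj R (linear_torus_map M) @` box.
    rewrite eqEsubset; split => // y _; have [[v s] <-] := gc_surj (mt_gcover tl) y.
    pose k := Num.floor (s : R); pose w := zpow (linV M) (linV M') k v.
    pose n : 'rV[int]_2 := \row_i (- Num.floor (w 0 i)).
    exists (mt_deck (linV M) (linV M') (n, k) (v, s)); last first.
      by apply/esym/(mt_proj_eq tl); exists (n, k).
    split=> /=; last by rewrite in_itv /= subr_ge0 floor_le_tmp lerBlDl -intrD1 ltW ?floorD1_gt.
    move=> i; rewrite -/w /= !mxE in_itv /= intrN subr_ge0 floor_le_tmp.
    by rewrite lerBlDl -intrD1 ltW ?floorD1_gt.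
  apply: continuous_compact => //; apply: continuous_subspaceT.
  exact: (gc_pcts (mt_gcover tl)).
exists (cover_atlas p); split.
- split; [split|exact: cMT|exact: (cover_connected gp)].
  + exact: PD_hausdorff gp GPD.
  + exact: cover_second_countable gp.
  + exact: (cover_atlas_smooth gp).
- exact: (cover_atlas_orientable gp Gaff' Gaff).
- by exists G; split => //; exact: (same_deck_diffeo gp gq Gaff').
Qed.

End HyperbolicMappingTorus.

Lemma half_inverse_comm (X Y : 'M[int]_2) : X *m Y = 2%:M -> Y *m X = 2%:M.
Proof.
move=> XY; have dY : \det Y != 0.
  apply/eqP => d0; have := congr1 determinant XY.
  by rewrite det_mulmx d0 mulr0 det_scalar.
apply/eqP; rewrite -subr_eq0; apply/eqP.
have : (Y *m X - 2%:M) *m Y = 0.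
  by rewrite mulmxBl -mulmxA XY mul_scalar_mx mul_mx_scalar subrr.
move=> /(congr1 (mulmx^~ (\adj Y))); rewrite -mulmxA mul_mx_adj mul0mx mul_mx_scalar.
move=> /matrixP e; apply/matrixP => i j; have := e i j; rewrite [LHS]mxE !mxE.
by move=> /eqP; rewrite mulf_eq0 (negPf dY) => /eqP.
Qed.

(** * The classification of $SU(2)$-abelian Sol manifolds *)

Section Classification.
Variable R : realType.

Lemma sol_SU2_abelian_monodromy (Y : topologicalType) (A : set (chart R 3 Y)) :
  closed_orientable_Sol_manifold A -> SU2_abelian R Y -> exists M : 'M[int]_2,
  [/\ \det M = 1, exists i : 'I_3, GL2Z_conjugate M (monodromy i) &
      homeomorphic Y (mapping_torus (@linear_torus_map R M))].
Proof.
move=> cA ab; have [G [p [sg gc]]] := sol_manifold_cover cA.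
have nosw g : G g -> swp g = false.
  move=> Gg; apply/negP => gs.
  have [r [h [k [rhom Gh Gk]]]] := sol_swap_nonabelian sg Gg gs; apply.
  exact: (SU2_abelianP gc).1 ab r rhom h k Gh Gk.
have [M [dM trM hM]] := sol_mapping_torus sg gc nosw.
exists M; split => //; have [M' MM'] := det1_inv dM.
have abM := (SU2_abelian_homeo gc hM).1 ab.
have dE : \det (M^T + 1%:M) = trans2 M + 2.
  move: dM; rewrite !det_mx2 !mxE /trans2 /= => dM.
  move: (M 0 0) (M 0 1) (M 1 0) (M 1 1) dM => a b c d; lia.
have [|N NE] := mt_abelian_coker (linear_torus_lift R MM') _ abM.
  rewrite dE; apply/eqP => z; have e : trans2 M = -2 by lia.
  by move: trM; rewrite e.
apply: (abelian_monodromy (N := N^T)) => //; apply: half_inverse_comm.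
by have := congr1 trmx NE; rewrite trmx_mul linearD /= trmxK trmx1 tr_scalar_mx.
Qed.

Lemma monodromy_sol_geometry (i : 'I_3) :
  exists A : set (chart R 3 (mapping_torus (@linear_torus_map R (monodromy i)))),
    closed_orientable_Sol_manifold A.
Proof.
by move: i; apply: ord3_ind; apply: hyperbolic_sol_geometry; rewrite // det_mx2 !mx2E.
Qed.

End Classification.

Theorem theorem4p1 (R : realType) :
  (* the characterization of SU(2)-abelian Sol manifolds *)
  (forall (Y : topologicalType) (A : set (chart R 3 Y)),
     closed_orientable_Sol_manifold A ->
     (SU2_abelian R Y <->
      exists (phi : torus R -> torus R) (M : 'M[int]_2),
        [/\ torus_diffeo phi, represented_by phi M, \det M = 1,
            (exists i : 'I_3, GL2Z_conjugate M (monodromy i)) &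
            homeomorphic Y (mapping_torus phi)])) /\
  (* the mapping torus only depends on the conjugacy class *)
  (forall (M N : 'M[int]_2) (phi psi : torus R -> torus R),
     \det M = 1 -> \det N = 1 -> GL2Z_conjugate M N ->
     torus_diffeo phi -> torus_diffeo psi ->
     isotopic phi (linear_torus_map M) -> isotopic psi (linear_torus_map N) ->
     homeomorphic (mapping_torus phi) (mapping_torus psi)) /\
  (* there are exactly three such manifolds up to homeomorphism *)
  [/\ (forall i : 'I_3, let Y := mapping_torus (@linear_torus_map R (monodromy i)) in
         SU2_abelian R Y /\
         exists A : set (chart R 3 Y), closed_orientable_Sol_manifold A),
      (forall i j : 'I_3,
         homeomorphic (mapping_torus (@linear_torus_map R (monodromy i)))
                      (mapping_torus (@linear_torus_map R (monodromy j))) ->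
         i = j) &
      (forall (Y : topologicalType) (A : set (chart R 3 Y)),
         closed_orientable_Sol_manifold A -> SU2_abelian R Y ->
         exists i : 'I_3,
           homeomorphic Y (mapping_torus (@linear_torus_map R (monodromy i))))].
Proof.
split; [|split; [|split]].
- move=> Y A cA; split=> [ab|[phi [M [dphi rep dM [i conj]] hY]]].
    have [M [dM cM hM]] := sol_SU2_abelian_monodromy cA ab.
    have [M' MM'] := det1_inv dM.
    exists (linear_torus_map M), M; split => //; first exact: linear_torus_diffeo MM'.
    exact: linear_torus_represented.
  have [G [p [_ gc]]] := sol_manifold_cover cA.
  have [f [f' [phi' [N [N' [_ ab]]]]]] := diffeo_SU2_abelian dphi rep dM conj.
  exact: (SU2_abelian_homeo gc hY).2 ab.
- move=> M N phi psi dM dN conj _ _; exact: isotopic_conj_mt.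
- by move=> i Y; split; [exact: monodromy_SU2_abelian|exact: monodromy_sol_geometry].
- exact: monodromy_homeo_inj.
- move=> Y A cA ab; have [M [dM [i cM] hM]] := sol_SU2_abelian_monodromy cA ab.
  exists i; apply: homeo_trans hM _.
  have [M' MM'] := det1_inv dM; have [P [Q [PQ ->]]] := (GL2Z_conjP _ _).1 cM.
  exact: mt_linear_conj MM' PQ.
Qed.
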